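(* Let $\Omega\subseteq M$ be a p-symmetric slice domain, $\Omega_0=\Omega\cap\mathbb{R}^{p+1}$, and $f:\Omega\to\mathbb{A}$ a (left) generalized partial-slice monogenic function of type $(p,q)$. Then, for odd $q\in\mathbb{N}$, $$\mathcal{PO}\big[\Delta_{\mathbf{x}}^{\frac{q-1}{2}}f\big]=\frac{\gamma_q}{q}\,HGCK\big[0,\ \Delta_{\mathbf{x}_p}^{\frac{q-1}{2}}D_{\mathbf{x}_p}f(\mathbf{x}_p)\big],\qquad \mathcal{PE}\big[\Delta_{\mathbf{x}}^{\frac{q-1}{2}}f\big]=\gamma_q\,HGCK\big[\Delta_{\mathbf{x}_p}^{\frac{q-1}{2}}f(\mathbf{x}_p),\ 0\big],$$ and consequently $$\overline{D}_{\mathbf{x}}\,\mathcal{PO}\big[\Delta_{\mathbf{x}}^{\frac{q-1}{2}}f\big]=\gamma_q\,GCK\big[\Delta_{\mathbf{x}_p}^{\frac{q-1}{2}}D_{\mathbf{x}_p}f(\mathbf{x}_p)\big],\qquad \overline{D}_{\mathbf{x}}\,\mathcal{PE}\big[\Delta_{\mathbf{x}}^{\frac{q-1}{2}}f\big]=\gamma_q\,GCK\big[\overline{D}_{\mathbf{x}_p}\Delta_{\mathbf{x}_p}^{\frac{q-1}{2}}f(\mathbf{x}_p)\big],$$ where $\gamma_q=(-1)^{\frac{q-1}{2}}\frac{(q-1)!!}{(q-2)!!}$, the functions of $\mathbf{x}_p$ inside the brackets are computed from $f|_{\Omega_0}$, and the identities hold where the right-hand sides are defined.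
   Context: Let $\mathbb{A}$ be a real alternative algebra (the associator $[a,b,c]=(ab)c-a(bc)$ is an alternating trilinear function) with unity $1$, of finite real dimension $d>1$, equipped with an anti-involution $a\mapsto a^c$ (real linear, $a^c=a$ for real $a$, $(a^c)^c=a$, $(ab)^c=b^ca^c$). Let $t(x)=x+x^c$, $n(x)=xx^c$, $\mathbb{S}_{\mathbb{A}}=\{x: t(x)=0,\ n(x)=1\}$ (assumed nonempty) and $Q_{\mathbb{A}}=\mathbb{R}\cup\{x: t(x)\in\mathbb{R},\ n(x)\in\mathbb{R},\ 4n(x)>t(x)^2\}$. Let $M$ be a real subspace with $\mathbb{R}\subsetneq M\subseteq Q_{\mathbb{A}}$ having a basis $(v_0,\dots,v_m)$, $m\ge1$, $v_0=1$, $v_s\in\mathbb{S}_{\mathbb{A}}$, $v_sv_t=-v_tv_s$ for distinct $s,t\ge1$; complete it to a basis of $\mathbb{A}$ with associated Euclidean norm. Identify $x=\sum x_sv_s\in M$ with $(x_0,\dots,x_m)\in\mathbb{R}^{m+1}$; differentiate componentwise. Fix $p\in\{0,\dots,m-1\}$, $q=m-p$; $\mathbf{x}=\mathbf{x}_p+\underline{\mathbf{x}}_q$ with $\mathbf{x}_p=\sum_{s=0}^px_sv_s\in\mathbb{R}^{p+1}$, $\underline{\mathbf{x}}_q=\sum_{s=p+1}^m x_sv_s$; $\mathbb{S}=\{\sum_{s=p+1}^m x_sv_s:\sum x_s^2=1\}$; $\underline{\mathbf{x}}_q=r\underline{\omega}$, $r=|\underline{\mathbf{x}}_q|$. $D_{\mathbf{x}_p}f=\sum_{s=0}^p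 v_s\partial_{x_s}f$, $\overline{D}_{\mathbf{x}_p}f=\partial_{x_0}f-\sum_{s=1}^pv_s\partial_{x_s}f$, $\overline{D}_{\mathbf{x}}f=\partial_{x_0}f-\sum_{s=1}^mv_s\partial_{x_s}f$, $\Delta_{\mathbf{x}_p}=\sum_{s=0}^p\partial_{x_s}^2$, $\Delta_{\mathbf{x}}=\sum_{s=0}^m\partial_{x_s}^2$. $f$ is left generalized partial-slice monogenic of type $(p,q)$ if for every $\underline{\omega}\in\mathbb{S}$ its restriction to $\Omega_{\underline{\omega}}=\Omega\cap(\mathbb{R}^{p+1}\oplus\underline{\omega}\mathbb{R})$ is $C^1$ and $(D_{\mathbf{x}_p}+\underline{\omega}\partial_r)f(\mathbf{x}_p+r\underline{\omega})=0$. A domain is a slice domain if $\Omega\cap\mathbb{R}^{p+1}\ne\emptyset$ and each $\Omega_{\underline{\omega}}$ is a domain in $\mathbb{R}^{p+2}$; p-symmetric if $\mathbf{x}_p+r\underline{\omega}\in\Omega$, $r>0$, implies $\mathbf{x}_p+r\underline{\eta}\in\Omega$ for all $\underline{\eta}\in\mathbb{S}$. With $\mathbf{x}_\diamond=\mathbf{x}_p-\underline{\mathbf{x}}_q$: $\mathcal{PE}[h](\mathbf{x})=\frac12(h(\mathbf{x})+h(\mathbf{x}_\diamond))$, $\mathcal{PO}[h](\mathbf{x})=\frac12(h(\mathbf{x})-h(\mathbf{x}_\diamond))$. For real analytic $g,A_0,A_1$ on $\Omega_0$: $GCK[g](\mathbf{x})=\sum_{k\ge0}\frac{\Gamma(\frac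 q2)(-1)^kr^{2k}}{2^{2k}k!\Gamma(k+\frac q2)}\Delta_{\mathbf{x}_p}^kg(\mathbf{x}_p)+\underline{\mathbf{x}}_q\sum_{k\ge0}\frac{\Gamma(\frac q2)(-1)^kr^{2k}}{2^{2k+1}k!\Gamma(k+\frac q2+1)}\Delta_{\mathbf{x}_p}^k(D_{\mathbf{x}_p}g(\mathbf{x}_p))$ (the unique monogenic function of the form $\sum_k\underline{\mathbf{x}}_q^kA_k(\mathbf{x}_p)$ with $A_0=g$), and $HGCK[A_0,A_1](\mathbf{x})=\sum_{k\ge0}\frac{\Gamma(\frac q2)(-1)^kr^{2k}}{2^{2k}k!\Gamma(k+\frac q2)}\Delta_{\mathbf{x}_p}^kA_0(\mathbf{x}_p)+\underline{\mathbf{x}}_q\sum_{k\ge0}\frac{\Gamma(\frac q2+1)(-1)^kr^{2k}}{2^{2k}k!\Gamma(k+\frac q2+1)}\Delta_{\mathbf{x}_p}^kA_1(\mathbf{x}_p)$ (the unique harmonic function of the form $\sum_k\underline{\mathbf{x}}_q^kA_k(\mathbf{x}_p)$ with given $A_0,A_1$). Double factorials: $0!!=(-1)!!=1$.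
   Formalization: The identities are stated at points x where the series on the right converge and the whole segment from x_p to x lies in Ω; with convergence alone they can fail, since the series may give another analytic branch of f. *)

(* Defs.v *)
From mathcomp Require Import all_boot all_order all_algebra.
From mathcomp Require Import all_classical all_reals all_analysis.
Import Order.TTheory GRing.Theory Num.Theory.
Import numFieldNormedType.Exports.

Set Implicit Arguments.
Unset Strict Implicit.
Unset Printing Implicit Defensive.

Local Open Scope ring_scope.
Local Open Scope classical_set_scope.

(* The algebra A.  A real algebra of finite dimension d is represented  *)
(* (after choosing a basis) by its coordinate space 'rV[R]_d, together  *)
(* with a multiplication, a unity and an anti-involution.               *)
Record realAlg (R : realType) (d : nat) := RealAlg {
  amul : 'rV[R]_d -> 'rV[R]_d -> 'rV[R]_d;
  aone : 'rV[R]_d;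
  aconj : 'rV[R]_d -> 'rV[R]_d }.

Section Algebra.
Variables (R : realType) (d : nat) (A : realAlg R d).
Local Notation "x ** y" := (amul A x y) (at level 40, left associativity).

Definition assoc (a b c : 'rV[R]_d) := (a ** b) ** c - a ** (b ** c).

Definition is_real (x : 'rV[R]_d) := exists a : R, x = a *: aone A.

Definition is_alt_alg_with_anti_involution :=
  (1 < d)%N /\
  [/\
      (forall (a : R) x y z, (a *: x + y) ** z = a *: (x ** z) + y ** z),
      (forall (a : R) x y z, x ** (a *: y + z) = a *: (x ** y) + x ** z),
      (forall x, aone A ** x = x /\ x ** aone A = x),
      (* the associator is alternating (vanishes when two arguments agree);
         it is trilinear by bilinearity of the product *)
      (forall x y, [/\ assoc x x y = 0, assoc x y x = 0 & assoc y x x = 0]) &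
      [/\ (forall (a : R) x y, aconj A (a *: x + y) = a *: aconj A x + aconj A y),
          (forall a : R, aconj A (a *: aone A) = a *: aone A),
          (forall x, aconj A (aconj A x) = x) &
          (forall x y, aconj A (x ** y) = aconj A y ** aconj A x)]].

Definition atr (x : 'rV[R]_d) := x + aconj A x.
Definition anrm (x : 'rV[R]_d) := x ** aconj A x.

Definition SA (x : 'rV[R]_d) := atr x = 0 /\ anrm x = aone A.

Definition QA (x : 'rV[R]_d) :=
  is_real x \/
  exists t n : R, [/\ atr x = t *: aone A, anrm x = n *: aone A & t ^+ 2 < 4 * n].

End Algebra.

(* Coordinates.  m = p + q; a point x of M is identified with its      *)
(* coordinate row (x_0,...,x_m) : 'rV[R]_(p.+1 + q), the first p+1      *)
(* coordinates being x_p and the last q ones being the coefficients of  *)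
(* underline{x}_q.  The basis of M is v : 'I_(p.+1 + q) -> A.           *)
Section Coordinates.
Variables (R : realType) (d p q : nat) (A : realAlg R d).
Variable v : 'I_(p.+1 + q) -> 'rV[R]_d.
Local Notation "x ** y" := (amul A x y) (at level 40, left associativity).
Local Notation pt := 'rV[R]_(p.+1 + q).
Local Notation Av := 'rV[R]_d.

Definition idx0 : 'I_(p.+1 + q) := lshift q (ord0 : 'I_p.+1).

Definition good_basis :=
  [/\ v idx0 = aone A,
      (forall c : 'I_(p.+1 + q) -> R,
          \sum_i c i *: v i = 0 -> forall i, c i = 0),
      (forall i, i != idx0 -> SA A (v i)),
      (forall i j, i != idx0 -> j != idx0 -> i != j -> v i ** v j = - (v j ** v i)) &
      (forall c : 'I_(p.+1 + q) -> R, QA A (\sum_i c i *: v i))].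

Definition emb (x : pt) : Av := \sum_i x ord0 i *: v i.

Definition xpart (x : pt) : 'rV[R]_p.+1 := lsubmx x.
Definition xqpart (x : pt) : 'rV[R]_q := rsubmx x.
Definition uxq (x : pt) : Av := emb (row_mx 0 (xqpart x)).
Definition r2 (x : pt) : R := \sum_(j < q) (xqpart x ord0 j) ^+ 2.
Definition xdiamond (x : pt) : pt := row_mx (xpart x) (- xqpart x).

Definition in_sphere (w : 'rV[R]_q) := \sum_(j < q) (w ord0 j) ^+ 2 = 1.

Definition slice_pt (w : 'rV[R]_q) (z : 'rV[R]_p.+1 * R) : pt :=
  row_mx z.1 (z.2 *: w).

Definition eX (i : 'I_(p.+1 + q)) : pt := delta_mx 0 i.
Definition eP (s : 'I_p.+1) : 'rV[R]_p.+1 := delta_mx 0 s.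
Definition eR (w : 'rV[R]_q) : pt := row_mx 0 w.

Definition slice_dom (Om : set pt) (w : 'rV[R]_q) : set ('rV[R]_p.+1 * R) :=
  [set z | Om (slice_pt w z)].

Definition p_sym_slice_domain (Om : set pt) :=
  [/\ open Om, connected Om,
      (exists y : 'rV[R]_p.+1, Om (row_mx y 0)),
      (forall w, in_sphere w -> connected (slice_dom Om w)) &
      (forall w (y : 'rV[R]_p.+1) (r : R), in_sphere w -> 0 < r ->
          Om (slice_pt w (y, r)) -> forall w', in_sphere w' -> Om (slice_pt w' (y, r)))].

(* Left generalized partial-slice monogenic of type (p,q): for each omega,
   the restriction (x_p, r) |-> f(x_p + r omega) is C^1 on Omega_omega
   (its first-order partial derivatives, i.e. the directional derivatives of
   f along e_0..e_p and along omega, exist and are continuous there), and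
   (D_{x_p} + omega d/dr) f(x_p + r omega) = 0. *)
Definition gpsm (Om : set pt) (f : pt -> Av) :=
  forall w, in_sphere w ->
    (forall z, slice_dom Om w z ->
       (forall s : 'I_p.+1,
          derivable f (slice_pt w z) (eX (lshift q s)) /\
          {for z, continuous (fun z' => 'D_(eX (lshift q s)) f (slice_pt w z'))}) /\
       (derivable f (slice_pt w z) (eR w) /\
          {for z, continuous (fun z' => 'D_(eR w) f (slice_pt w z'))})) /\
    (forall z, slice_dom Om w z ->
       \sum_(s < p.+1) v (lshift q s) ** 'D_(eX (lshift q s)) f (slice_pt w z)
       + emb (eR w) ** 'D_(eR w) f (slice_pt w z) = 0).

Definition lapX (h : pt -> Av) : pt -> Av :=
  fun x => \sum_i 'D_(eX i) ('D_(eX i) h) x.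
Definition DbarX (h : pt -> Av) : pt -> Av :=
  fun x => 'D_(eX idx0) h x - \sum_(i | i != idx0) v i ** 'D_(eX i) h x.
Definition lapP (g : 'rV[R]_p.+1 -> Av) : 'rV[R]_p.+1 -> Av :=
  fun y => \sum_s 'D_(eP s) ('D_(eP s) g) y.
Definition DP (g : 'rV[R]_p.+1 -> Av) : 'rV[R]_p.+1 -> Av :=
  fun y => \sum_s v (lshift q s) ** 'D_(eP s) g y.
Definition DbarP (g : 'rV[R]_p.+1 -> Av) : 'rV[R]_p.+1 -> Av :=
  fun y => 'D_(eP ord0) g y - \sum_(s | s != ord0) v (lshift q s) ** 'D_(eP s) g y.

Definition restr0 (f : pt -> Av) : 'rV[R]_p.+1 -> Av := fun y => f (row_mx y 0).

Definition PO (h : pt -> Av) : pt -> Av := fun x => 2^-1 *: (h x - h (xdiamond x)).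
Definition PE (h : pt -> Av) : pt -> Av := fun x => 2^-1 *: (h x + h (xdiamond x)).

Definition poch (a : R) (k : nat) : R := \prod_(j < k) (a + j%:R).

(* Coefficients, written with Gamma-ratios as rising factorials:
   Gamma(q/2)/Gamma(k+q/2) = 1/(q/2)_k,
   Gamma(q/2+1)/Gamma(k+q/2+1) = 1/(q/2+1)_k,
   Gamma(q/2)/Gamma(k+q/2+1) = 1/(q/2)_(k+1). *)
Definition halfq : R := q%:R / 2.
Definition cA (k : nat) : R := (-1) ^+ k / (4 ^+ k * k`!%:R * poch halfq k).
Definition cH1 (k : nat) : R := (-1) ^+ k / (4 ^+ k * k`!%:R * poch (halfq + 1) k).
Definition cG1 (k : nat) : R := (-1) ^+ k / (2 * 4 ^+ k * k`!%:R * poch halfq k.+1).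

Definition termA (c : nat -> R) (g : 'rV[R]_p.+1 -> Av) (x : pt) (k : nat) : Av :=
  (c k * r2 x ^+ k) *: iter k lapP g (xpart x).

Definition HGCK_defined (A0 A1 : 'rV[R]_p.+1 -> Av) (x : pt) :=
  cvgn (series (termA cA A0 x)) /\ cvgn (series (termA cH1 A1 x)).
Definition HGCK (A0 A1 : 'rV[R]_p.+1 -> Av) (x : pt) : Av :=
  limn (series (termA cA A0 x)) + uxq x ** limn (series (termA cH1 A1 x)).

Definition GCK_defined (g : 'rV[R]_p.+1 -> Av) (x : pt) :=
  cvgn (series (termA cA g x)) /\ cvgn (series (termA cG1 (DP g) x)).
Definition GCK (g : 'rV[R]_p.+1 -> Av) (x : pt) : Av :=
  limn (series (termA cA g x)) + uxq x ** limn (series (termA cG1 (DP g) x)).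

End Coordinates.

(* double factorial, 0!! = 1, 1!! = 1 (and (-1)!! = 1 is handled by
   truncated subtraction: (1 - 2)%N = 0) *)
Fixpoint dfact (n : nat) : nat :=
  match n with
  | 0 => 1
  | 1 => 1
  | (n'.+2) as n0 => (n0 * dfact n')%N
  end.

Definition gammaq (R : realType) (q : nat) : R :=
  (-1) ^+ (q.-1)./2 * (dfact q.-1)%:R / (dfact (q - 2))%:R.

(* Main.v *)
(* On each slice the function f solves a Dirac system in the variables (x_p, r).
   Averages over short segments show that its C^1 solutions are uniform limits of
   twice differentiable harmonic functions, and the maximum principle on cubes gives
   Cauchy estimates for these, so the restrictions of f to slices are analytic.
   Splitting f(x_p + r w) into parts even and odd in r yields
   f(x) = e(x_p, r) + x_q h(x_p, r) with e and h even in r and independent of w: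
   an even harmonic function is determined by its values at r = 0.

   Let T = r^-1 d/dr, extended to r = 0 as an average.  A function F even in r with
   Delta_p F + c T F + r^2 T^2 F = 0 satisfies
   T^n F(y, 0) = (-1)^n Delta_p^n F(y, 0) / (c (c + 2) ... (c + 2n - 2)),
   hence F is the sum of its Taylor series in r^2 / 2 wherever that series converges;
   HGCK and GCK are such sums with c = q and c = q + 2.  Here e and h satisfy the
   equation with c = 1 and c = 3, each T raises c by 2, and
   Delta_x (T^i e + x_q T^i h) = (q - 1 - 2i) (T^(i+1) e + x_q T^(i+1) h).
   For q = 2k + 1, Delta_x^k f is thus a multiple of T^k e + x_q T^k h, whose parts
   satisfy the equation with c = q and c = q + 2. *)

From mathcomp Require Import all_boot all_order all_algebra.
From mathcomp Require Import all_classical all_reals all_analysis.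
From mathcomp Require Import ring lra zify.
Require Import Defs.
Import Order.TTheory GRing.Theory Num.Theory.
Import numFieldNormedType.Exports.
Set Implicit Arguments.
Unset Strict Implicit.
Unset Printing Implicit Defensive.
Local Open Scope ring_scope.
Local Open Scope classical_set_scope.

(** * Directional derivatives *)

Section Norm.
Variable R : realType.

(** [f] is only known to be C^1 inside each slice; its derivatives in the full space exist because
    [f] turns out to be built from functions of [(x_p, r)]. The analysis therefore takes place in
    the p + 2 slice variables, on a tube around the segment from [x_p] to [x], symmetric in [r] so
    that averages along radii stay inside. Regularity comes without integral formulas: the maximum
    principle bounds increments of a harmonic function by its supremum alone, and such a bound
    survives uniform limits. The series converge at [x] by assumption, possibly on the edge of their
    disc in [t = r^2 / 2], while the Cauchy bounds on the segment hold with a constant unrelated to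
    [r]. Equality with the Taylor sum is propagated in steps of [t] and reaches the end point by
    Abel's theorem. As [T] takes two derivatives in [r], Cauchy estimates alone give (2k)!; the
    weights of the averages restore k!. The algebra need not be associative: left multiplications
    become matrices, and the left alternative law yields their Clifford relations. *)

Lemma rV_norm_coord (m n : nat) (x : 'M[R]_(m, n)) i j : `|x i j| <= `|x|.
Proof.
rewrite [leRHS]/Num.Def.normr /= mx_normrE.
exact: (le_bigmax _ (fun ij : 'I_m * 'I_n => `|x ij.1 ij.2|) (i, j)).
Qed.

Lemma rV_norm_le (n : nat) (x : 'rV[R]_n) (e : R) :
  0 <= e -> (forall j, `|x ord0 j| <= e) -> `|x| <= e.
Proof.
move=> e0 H; rewrite /Num.Def.normr /= mx_normrE.
by apply: bigmax_le => // -[i j] _ /=; rewrite ord1.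
Qed.

Lemma rV_norm_lt (n : nat) (x : 'rV[R]_n) (e : R) :
  0 < e -> (forall j, `|x ord0 j| < e) -> `|x| < e.
Proof.
move=> e0 H; rewrite /Num.Def.normr /= mx_normrE.
by apply/bigmax_ltP; split => // -[i j] _ /=; rewrite ord1.
Qed.

End Norm.

Section DirectionalDerivative.
Variable R : realType.

(** The difference quotient is multiplied out, so [h = 0] is allowed and estimates chain without
    dividing; [isDP] identifies it with [is_derive]. *)
Definition isD (V W : normedModType R) (f : V -> W) (x v : V) (d : W) :=
  forall e : R, 0 < e -> exists2 r : R, 0 < r &
    forall h : R, `|h| < r -> `|f (x + h *: v) - f x - h *: d| <= e * `|h|.

Definition contAt (V W : normedModType R) (f : V -> W) (x : V) :=
  forall e : R, 0 < e -> exists2 r : R, 0 < r &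
    forall y : V, `|y - x| < r -> `|f y - f x| <= e.

Section Generic.
Variables V W : normedModType R.
Implicit Types (f g : V -> W) (x v : V) (d : W).

Lemma contAtP f x : contAt f x <-> {for x, continuous f}.
Proof.
split=> [H|/cvgrPdist_le H e e0]; first apply/cvgrPdist_le => e e0.
  have [r r0 Hr] := H e e0.
  apply/nbhs_normP; exists r => //= y /=; rewrite distrC => /Hr.
  by rewrite distrC.
have /nbhs_normP [r /= r0 Hr] := H e e0.
by exists r => // y yx; rewrite distrC; apply: Hr; rewrite /= distrC.
Qed.

Lemma isDP f x v d : isD f x v d <-> is_derive x v f d.
Proof.
split=> H.
  suff C : (fun h => h^-1 *: ((f \o shift x) (h *: v) - f x)) @ 0^' --> d.
    split; first by apply/cvg_ex; exists d.
    exact: cvg_lim.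
  apply/cvgrPdist_le => e e0; have [r r0 Hr] := H e e0.
  near=> h.
  have h0 : h != 0 by near: h; exact: nbhs_dnbhs_neq.
  rewrite /= distrC -[d](scalerK h0) -scalerBr normrZ normfV.
  rewrite ler_pdivrMl ?normr_gt0// mulrC addrC [_ + x]addrC [- _ + _]addrC.
  apply: Hr; near: h; exact: dnbhs0_lt.
case: H => H1 H2; have : (fun h => h^-1 *: ((f \o shift x) (h *: v) - f x)) @ 0^' --> d.
  by rewrite -H2.
move=> /cvgrPdist_le C e e0; have /nbhs_normP [r /= r0 Hr] := C e e0.
exists r => // h hr.
have [->|h0] := eqVneq h 0; first by rewrite !scale0r addr0 !subrr normr0 mulr_ge0 // ltW.
have := Hr h; rewrite /= sub0r normrN => /(_ hr h0).
rewrite distrC -[X in _ - X](scalerK h0) -scalerBr normrZ normfV.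
by rewrite ler_pdivrMl ?normr_gt0// [_ * e]mulrC [h *: v + x]addrC.
Unshelve. all: by end_near. Qed.

Lemma isD_derive f x v d : isD f x v d -> 'D_v f x = d.
Proof. by move=> /isDP H; exact: derive_val. Qed.

Lemma isD_derivable f x v d : isD f x v d -> derivable f x v.
Proof. by move=> /isDP H; exact: ex_derive. Qed.

Lemma derivable_isD f x v : derivable f x v -> isD f x v ('D_v f x).
Proof. by move=> /derivableP H; apply/isDP. Qed.

Lemma isD_uniq f x v d d' : isD f x v d -> isD f x v d' -> d = d'.
Proof. by move=> /isD_derive <- /isD_derive <-. Qed.

Lemma isD_cst (c : W) x v : isD (fun=> c) x v 0.
Proof. apply/isDP; exact: is_derive_cst. Qed.

Lemma isDD f g x v d d' : isD f x v d -> isD g x v d' ->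
  isD (fun y => f y + g y) x v (d + d').
Proof. by move=> /isDP H /isDP H'; apply/isDP; exact: is_deriveD. Qed.

Lemma isDN f x v d : isD f x v d -> isD (fun y => - f y) x v (- d).
Proof. by move=> /isDP H; apply/isDP; exact: is_deriveN. Qed.

Lemma isDB f g x v d d' : isD f x v d -> isD g x v d' ->
  isD (fun y => f y - g y) x v (d - d').
Proof. by move=> H /isDN; exact: isDD. Qed.

Lemma isDZ f (k : R) x v d : isD f x v d -> isD (fun y => k *: f y) x v (k *: d).
Proof. by move=> /isDP H; apply/isDP; exact: is_deriveZ. Qed.

Lemma isD_sum (I : Type) (s : seq I) (P : pred I) (h : I -> V -> W) x v (dh : I -> W) :
  (forall i, P i -> isD (h i) x v (dh i)) ->
  isD (fun y => \sum_(i <- s | P i) h i y) x v (\sum_(i <- s | P i) dh i).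
Proof.
move=> H; elim: s => [|i s IH].
  under eq_fun do rewrite big_nil; rewrite big_nil; exact: isD_cst.
under eq_fun do rewrite big_cons; rewrite big_cons.
by case: (boolP (P i)) => Pi //; apply: (isDD _ IH); exact: H.
Qed.

Lemma isD_eqdir f x v v' d d' : isD f x v d -> v = v' -> d = d' -> isD f x v' d'.
Proof. by move=> H <- <-. Qed.

Lemma isD_near f g x v d (r : R) : 0 < r ->
  (forall y, `|y - x| < r -> f y = g y) -> isD f x v d -> isD g x v d.
Proof.
move=> r0 fg H e e0; have [r' r'0 Hr'] := H e e0.
have v1 : 0 < `|v| + 1 by rewrite ltr_wpDl.
exists (Num.min r' (r / (`|v| + 1))); first by rewrite lt_min r'0 divr_gt0.
move=> h; rewrite lt_min => /andP [h1 h2].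
rewrite -!fg ?subrr ?normr0 //; last first.
  rewrite addrAC subrr add0r normrZ.
  move: h2; rewrite ltr_pdivlMr // => h2; apply: le_lt_trans h2.
  by rewrite ler_wpM2l // lerDl.
exact: Hr'.
Qed.

Lemma isD_scaledir f x v d (k : R) : isD f x v d -> isD f x (k *: v) (k *: d).
Proof.
move=> H e e0.
(* [|k| + 1] instead of [|k|] keeps the division legitimate when [k = 0]; the same device recurs
   below. *)
have k1 : 0 < `|k| + 1 by rewrite ltr_wpDl.
have [r r0 Hr] := H (e / (`|k| + 1)) (divr_gt0 e0 k1).
exists (r / (`|k| + 1)); first exact: divr_gt0.
move=> h; rewrite ltr_pdivlMr // => hr.
rewrite !scalerA; apply: le_trans (Hr _ _) _.
  rewrite normrM; apply: le_lt_trans hr; by rewrite ler_wpM2l // lerDl.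
rewrite normrM.
have -> : e / (`|k| + 1) * (`|h| * `|k|) = e * `|h| * (`|k| / (`|k| + 1)) by ring.
rewrite ler_piMr ?mulr_ge0 ?(ltW e0) // ler_pdivrMr // mul1r lerDl //.
Qed.

Lemma contAt_near f g x (r : R) : 0 < r ->
  (forall y, `|y - x| < r -> f y = g y) -> contAt f x -> contAt g x.
Proof.
move=> r0 fg H e e0; have [r' r'0 Hr'] := H e e0.
exists (Num.min r' r); first by rewrite lt_min r'0.
move=> y; rewrite lt_min => /andP [h1 h2].
by rewrite -!fg ?subrr ?normr0 //; exact: Hr'.
Qed.

Lemma contAtD f g x : contAt f x -> contAt g x -> contAt (fun y => f y + g y) x.
Proof. by move=> /contAtP H /contAtP H'; apply/contAtP; exact: continuousD. Qed.

Lemma contAtN f x : contAt f x -> contAt (fun y => - f y) x.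
Proof. by move=> /contAtP H; apply/contAtP; exact: continuousN. Qed.

Lemma contAtZ f (k : R) x : contAt f x -> contAt (fun y => k *: f y) x.
Proof. by move=> /contAtP H; apply/contAtP; apply: continuousZr. Qed.

Lemma contAt_cst (c : W) x : contAt (fun=> c) x.
Proof. by move=> e e0; exists 1 => // y _; rewrite subrr normr0 ltW. Qed.

Lemma contAt_sum (I : Type) (s : seq I) (P : pred I) (h : I -> V -> W) x :
  (forall i, P i -> contAt (h i) x) ->
  contAt (fun y => \sum_(i <- s | P i) h i y) x.
Proof.
move=> H; elim: s => [|i s IH].
  under eq_fun do rewrite big_nil; exact: contAt_cst.
under eq_fun do rewrite big_cons.
by case: (boolP (P i)) => Pi //; apply: (contAtD _ IH); exact: H.
Qed.

End Generic.

Lemma contAt_comp (U V W : normedModType R) (f : V -> W) (g : U -> V) (x : U) :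
  contAt g x -> contAt f (g x) -> contAt (fun y => f (g y)) x.
Proof.
move=> Hg Hf e e0; have [r r0 Hr] := Hf e e0.
have r20 : 0 < r / 2 by rewrite divr_gt0.
have [s s0 Hs] := Hg (r / 2) r20.
exists s => // y /Hs H; apply: Hr; apply: le_lt_trans H _.
by rewrite ltr_pdivrMr // ltr_pMr // ltr1n.
Qed.

Lemma isD_line (V W : normedModType R) (f : V -> W) x v (s : R) d :
  isD f (x + s *: v) v d <-> isD (fun t : R => f (x + t *: v)) s 1 d.
Proof.
have E (h : R) : x + s *: v + h *: v = x + (s + h *: 1) *: v.
  by rewrite scalerDl addrA /GRing.scale /= mulr1.
by split=> H e e0; have [r r0 Hr] := H e e0; exists r => // h /Hr; rewrite E.
Qed.

Lemma isD_comp_lin (U V W : normedModType R) (f : V -> W) (l : U -> V) x v d w :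
  (forall h : R, l (x + h *: v) = l x + h *: w) ->
  isD f (l x) w d -> isD (fun y => f (l y)) x v d.
Proof.
by move=> Hl H e e0; have [r r0 Hr] := H e e0; exists r => // h /Hr; rewrite Hl.
Qed.

Lemma isD_cont1 (W : normedModType R) (f : R -> W) (x : R) d :
  isD f x 1 d -> contAt f x.
Proof.
move=> /isDP [H _]; apply/contAtP; apply: differentiable_continuous.
exact/derivable1_diffP.
Qed.

Lemma isD_coord (V : normedModType R) (n : nat) (f : V -> 'rV[R]_n) x v d :
  isD f x v d <-> forall j, isD (fun y => f y ord0 j) x v (d ord0 j).
Proof.
split=> [H j e e0|H].
  have [r r0 Hr] := H e e0; exists r => // h /Hr; apply: le_trans.
  apply: le_trans (rV_norm_coord _ ord0 j); by rewrite !mxE.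
have D : derivable f x v.
  apply/derivable_mxP => i j; rewrite (ord1 i); exact: isD_derivable (H j).
suff -> : d = 'D_v f x by apply: derivable_isD.
by rewrite derive_mx //; apply/rowP => j; rewrite mxE (isD_derive (H j)).
Qed.

Lemma contAt_coord (V : normedModType R) (n : nat) (f : V -> 'rV[R]_n) x :
  contAt f x <-> forall j, contAt (fun y => f y ord0 j) x.
Proof.
split=> [H j e e0|H].
  have [r r0 Hr] := H e e0; exists r => // y /Hr; apply: le_trans.
  by apply: le_trans (rV_norm_coord _ ord0 j); rewrite !mxE.
apply/contAtP/cvgrPdist_le => e e0.
near=> y; apply: rV_norm_le; first exact: ltW.
near: y; apply: filter_forall => j.
have /contAtP /cvgrPdist_le /(_ e e0) := H j.
by apply: filterS => y; rewrite !mxE.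
Unshelve. all: by end_near. Qed.

Lemma contAt_lip (V W : normedModType R) (f : V -> W) x (C r : R) : 0 < r -> 0 <= C ->
  (forall y, `|y - x| < r -> `|f y - f x| <= C * `|y - x|) -> contAt f x.
Proof.
move=> r0 C0 H e e0; have C1 : 0 < C + 1 by rewrite ltr_wpDl.
exists (Num.min r (e / (C + 1))); first by rewrite lt_min r0 divr_gt0.
move=> y; rewrite lt_min => /andP [/H h1]; rewrite ltr_pdivlMr // => h2.
apply: le_trans h1 _; apply: le_trans (ltW h2); rewrite mulrC.
by rewrite ler_wpM2l // lerDl.
Qed.

Lemma contAt_entry (n : nat) (j : 'I_n) (x : 'rV[R]_n) : contAt (fun z : 'rV[R]_n => z ord0 j) x.
Proof. by apply/contAtP; exact: coord_continuous. Qed.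

Lemma contAtM (V : normedModType R) (f g : V -> R) x :
  contAt f x -> contAt g x -> contAt (fun y => f y * g y) x.
Proof. by move=> /contAtP H /contAtP H'; apply/contAtP; exact: continuousM. Qed.

Lemma isDM (V : normedModType R) (f g : V -> R) x v d d' :
  isD f x v d -> isD g x v d' -> isD (fun y => f y * g y) x v (f x * d' + g x * d).
Proof. by move=> /isDP H /isDP H'; apply/isDP; exact: is_deriveM. Qed.

Lemma isDX (n : nat) (x : R) : isD (fun y : R => y ^+ n) x 1 (n%:R * x ^+ n.-1).
Proof.
have := derivable_isD (@exprn_derivable R n x 1).
by rewrite exp_derive /GRing.scale /= mulr1.
Qed.

Lemma mulmx_norm_le (m n : nat) (M : 'M[R]_(m, n)) :
  exists2 C : R, 0 <= C & forall x : 'rV[R]_m, `|x *m M| <= C * `|x|.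
Proof.
exists (\sum_(i < m) `|M|); first exact: sumr_ge0.
move=> x; apply: rV_norm_le; first by rewrite mulr_ge0 // sumr_ge0.
move=> j; rewrite mxE mulr_suml; apply: le_trans (ler_norm_sum _ _ _) _.
apply: ler_sum => i _; rewrite normrM mulrC.
by apply: ler_pM => //; exact: rV_norm_coord.
Qed.

Lemma isD_mulmx (V : normedModType R) (m n : nat) (M : 'M[R]_(m, n)) (f : V -> 'rV[R]_m) x v d :
  isD f x v d -> isD (fun y => f y *m M) x v (d *m M).
Proof.
move=> H e e0; have [C C0 HC] := mulmx_norm_le M.
have C1 : 0 < C + 1 by rewrite ltr_wpDl.
have [r r0 Hr] := H (e / (C + 1)) (divr_gt0 e0 C1); exists r => // h /Hr hh.
rewrite scalemxAl -!mulmxBl; apply: le_trans (HC _) _.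
apply: (@le_trans _ _ ((C + 1) * (e / (C + 1) * `|h|))).
  by apply: ler_pM => //; rewrite lerDl.
by rewrite mulrA mulrC [(C + 1) * _]mulrC divfK ?gt_eqF // mulrC.
Qed.

Lemma contAt_mulmx (V : normedModType R) (m n : nat) (M : 'M[R]_(m, n)) (f : V -> 'rV[R]_m) x :
  contAt f x -> contAt (fun y => f y *m M) x.
Proof.
move=> H e e0; have [C C0 HC] := mulmx_norm_le M.
have C1 : 0 < C + 1 by rewrite ltr_wpDl.
have [r r0 Hr] := H (e / (C + 1)) (divr_gt0 e0 C1); exists r => // h /Hr hh.
rewrite -mulmxBl; apply: le_trans (HC _) _.
apply: (@le_trans _ _ ((C + 1) * (e / (C + 1)))).
  by apply: ler_pM => //; rewrite lerDl.
by rewrite mulrC divfK ?gt_eqF.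
Qed.

Lemma isDZf (V : normedModType R) (n : nat) (a : V -> R) (f : V -> 'rV[R]_n) x v da d :
  isD a x v da -> isD f x v d -> isD (fun y => a y *: f y) x v (a x *: d + da *: f x).
Proof.
move=> Ha /isD_coord Hf; apply/isD_coord => j.
have := isDM Ha (Hf j); rewrite !mxE [f x ord0 j * da]mulrC.
by congr isD; apply/funext => y; rewrite mxE.
Qed.

Lemma contAtZf (V : normedModType R) (n : nat) (a : V -> R) (f : V -> 'rV[R]_n) x :
  contAt a x -> contAt f x -> contAt (fun y => a y *: f y) x.
Proof.
move=> Ha /contAt_coord Hf; apply/contAt_coord => j.
have := contAtM Ha (Hf j).
by congr contAt; apply/funext => y; rewrite mxE.
Qed.

End DirectionalDerivative.

(** * Mean value inequalities for curves *)

Section MeanValue.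
Variable R : realType.

Lemma mvt_eq (g dg : R -> R) (a b : R) : a <= b ->
  (forall s, a <= s <= b -> isD g s 1 (dg s)) ->
  exists2 c, a <= c <= b & g b - g a = dg c * (b - a).
Proof.
move=> ab H; have [||c cab E] := @MVT_segment R g dg a b ab.
- move=> x; rewrite in_itv /= => /andP [/ltW h1 /ltW h2].
  by apply/isDP/H; rewrite h1 h2.
- apply: continuous_in_subspaceT => x; rewrite inE /= in_itv /= => hx.
  exact/contAtP/(isD_cont1 (H x hx)).
by exists c => //; move: cab; rewrite in_itv.
Qed.

(** The norm is a maximum over coordinates, so it suffices to treat each coordinate of [g] with
    either sign; [B] minus that function has a nonnegative derivative. A variable majorant [B] is
    what later yields weights such as 1 / (c + 1). *)
Lemma mvt_dom (n : nat) (g dg : R -> 'rV[R]_n) (B dB : R -> R) (a b : R) : a <= b ->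
  (forall s, a <= s <= b -> isD g s 1 (dg s)) ->
  (forall s, a <= s <= b -> isD B s 1 (dB s)) ->
  (forall s, a <= s <= b -> `|dg s| <= dB s) ->
  `|g b - g a| <= B b - B a.
Proof.
move=> ab Hg HB Hd.
have key (j : 'I_n) (sg : R) : `|sg| = 1 -> sg * (g b ord0 j - g a ord0 j) <= B b - B a.
  move=> sg1.
  have [s sab|c cab E] := @mvt_eq (fun s => B s - sg * g s ord0 j)
      (fun s => dB s - sg * dg s ord0 j) a b ab.
    apply: isDB; first exact: HB.
    by have /isD_coord /(_ j) := Hg s sab; exact: isDZ.
  have : 0 <= (dB c - sg * dg c ord0 j) * (b - a).
    rewrite mulr_ge0 ?subr_ge0 //; apply: le_trans (Hd c cab).
    apply: le_trans (ler_norm _) _; rewrite normrM sg1 mul1r; exact: rV_norm_coord.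
  rewrite -E; lra.
have B0 : 0 <= B b - B a.
  have [c cab ->] := mvt_eq ab HB; rewrite mulr_ge0 ?subr_ge0 //.
  exact: le_trans (Hd c cab).
apply: rV_norm_le => // j; rewrite !mxE ler_norml.
have h1 := key j 1 (normr1 _); have h2 := key j (-1).
rewrite normrN normr1 in h2; have {h2} := h2 erefl; lra.
Qed.

Lemma mvt_le (n : nat) (g dg : R -> 'rV[R]_n) (M a b : R) : a <= b ->
  (forall s, a <= s <= b -> isD g s 1 (dg s)) ->
  (forall s, a <= s <= b -> `|dg s| <= M) ->
  `|g b - g a| <= M * (b - a).
Proof.
move=> ab Hg Hd; rewrite mulrBr.
apply: (mvt_dom (B := fun s => M * s) (dB := fun=> M)) Hg _ Hd => // s _.
apply: isD_eqdir; [|reflexivity|]; first by apply: isDZ; exact: (isDX 1 s).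
by rewrite /GRing.scale /= expr0 !mulr1.
Qed.

Lemma mvt_zero (n : nat) (g : R -> 'rV[R]_n) (a b : R) : a <= b ->
  (forall s, a <= s <= b -> isD g s 1 0) -> g b = g a.
Proof.
move=> ab H; apply/eqP; rewrite -subr_eq0 -normr_le0.
by rewrite -(mul0r (b - a)); apply: mvt_le H _ => // s _; rewrite normr0.
Qed.

End MeanValue.

(** * Partial derivatives: Lipschitz bounds and symmetry *)

Section PartialDerivatives.
Variables (R : realType) (N : nat).
Local Notation e_ i := (delta_mx 0 i : 'rV[R]_N).

Lemma norm_delta (i : 'I_N) : `|e_ i| <= 1 :> R.
Proof.
apply: rV_norm_le => // j; rewrite mxE /=.
by case: eqP => _; rewrite ?normr0 ?normr1.
Qed.

Lemma line_close (x : 'rV[R]_N) (i : 'I_N) (h : R) : `|(x + h *: e_ i) - x| <= `|h|.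
Proof.
rewrite addrAC subrr add0r normrZ ler_piMr //; exact: norm_delta.
Qed.

Lemma segment_coords (a : 'rV[R]_N) rho x i t s : `|x - a| < rho -> `|x + t *: e_ i - a| < rho ->
  0 <= s <= 1 -> `|x + (s * t) *: e_ i - a| < rho.
Proof.
move=> h1 h2 /andP [s0 s1].
have r0 : 0 < rho by apply: le_lt_trans h1.
have -> : x + (s * t) *: e_ i - a = (1 - s) *: (x - a) + s *: (x + t *: e_ i - a).
  rewrite [x + t *: _ - a]addrAC [s *: (_ + _)]scalerDr addrA -scalerDl scalerA.
  by rewrite subrK scale1r addrAC.
apply: le_lt_trans (ler_normD _ _) _; rewrite !normrZ !ger0_norm ?subr_ge0 //.
move: h1 h2; set A := `|_ - a|; set B := `|_ - a| => h1 h2.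
apply: (@le_lt_trans _ _ (Num.max A B)); last by rewrite gt_max h1.
have : A <= Num.max A B by rewrite le_max lexx.
have : B <= Num.max A B by rewrite le_max lexx orbT.
move: (Num.max A B) => m; nra.
Qed.

(* The segments joining successive points changed one coordinate at a time stay in a sup-norm ball. *)
Lemma partials_lipschitz (n : nat) (u : 'rV[R]_N -> 'rV[R]_n) (du : 'I_N -> 'rV[R]_N -> 'rV[R]_n)
    (a : 'rV[R]_N) (rho M : R) :
  (forall x i, `|x - a| < rho -> isD u x (e_ i) (du i x)) ->
  (forall x i, `|x - a| < rho -> `|du i x| <= M) ->
  forall x y, `|x - a| < rho -> `|y - a| < rho -> `|u y - u x| <= N%:R * M * `|y - x|.
Proof.
move=> HD HM x y xa ya.
have rho0 : 0 < rho by apply: le_lt_trans xa.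
case: (posnP N) => [N0|Npos].
  have -> : y = x by apply/rowP => i; have := ltn_ord i; rewrite {2}N0.
  by rewrite !subrr !normr0 mulr0.
pose i0 := Ordinal Npos.
have M0 : 0 <= M by apply: le_trans (HM x i0 xa).
pose z (k : nat) : 'rV[R]_N := \row_i (if (i < k)%N then y ord0 i else x ord0 i).
have zB k : `|z k - a| < rho.
  apply: rV_norm_lt => // j; rewrite !mxE; case: ifP => _.
    by apply: le_lt_trans ya; apply: le_trans (rV_norm_coord _ ord0 j); rewrite !mxE.
  by apply: le_lt_trans xa; apply: le_trans (rV_norm_coord _ ord0 j); rewrite !mxE.
have step k : (k <= N)%N -> `|u (z k) - u x| <= k%:R * M * `|y - x|.
  elim: k => [_|k IH kN].
    have -> : z 0%N = x by apply/rowP => i; rewrite mxE ltn0.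
    by rewrite subrr normr0 !mul0r.
  pose i := Ordinal kN; pose t := y ord0 i - x ord0 i.
  have zS : z k.+1 = z k + t *: e_ i.
    apply/rowP => j; rewrite !mxE /= ltnS leq_eqVlt.
    have [->|ne] := eqVneq j i; first by rewrite eqxx /= ltnn mulr1 /t addrC subrK.
    have -> : (j == k :> nat) = false by apply/negbTE; apply: contra ne => /eqP jk; apply/eqP/val_inj.
    by rewrite /= mulr0 addr0.
  have -> : u (z k.+1) - u x = (u (z k.+1) - u (z k)) + (u (z k) - u x) by rewrite addrA subrK.
  apply: le_trans (ler_normD _ _) _.
  have -> : k.+1%:R * M * `|y - x| = M * `|y - x| + k%:R * M * `|y - x| by rewrite -natr1; ring.
  apply: lerD; last exact: IH (ltnW kN).
  have tn : `|t| <= `|y - x|.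
    by apply: le_trans (rV_norm_coord _ ord0 i); rewrite !mxE.
  have zS1 : z k.+1 = z k + 1 *: (t *: e_ i) by rewrite scale1r.
  have HB s : 0 <= s <= 1 -> `|z k + s *: (t *: e_ i) - a| < rho.
    move=> s01; rewrite scalerA; apply: (segment_coords (zB k)) => //.
    by rewrite -zS; exact: zB.
  have := @mvt_le R n (fun s => u (z k + s *: (t *: e_ i)))
    (fun s => t *: du i (z k + s *: (t *: e_ i))) (M * `|t|) 0 1 ler01.
  rewrite -zS1 scale0r addr0 subr0 mulr1 => H.
  apply: le_trans (H _ _) _.
  - move=> s s01; apply/isD_line; apply: isD_scaledir; exact/HD/HB.
  - move=> s s01; rewrite normrZ mulrC ler_wpM2r //; exact/HM/HB.
  - by rewrite ler_wpM2l.
have := step N (leqnn N).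
by have -> : z N = y by apply/rowP => i; rewrite mxE ltn_ord.
Qed.

(** Partials that are continuous at [a] are bounded near [a], and bounded partials make [u]
    Lipschitz there. *)
Lemma partials_contAt (n : nat) (u : 'rV[R]_N -> 'rV[R]_n) (du : 'I_N -> 'rV[R]_N -> 'rV[R]_n)
    (a : 'rV[R]_N) (rho : R) : 0 < rho ->
  (forall x i, `|x - a| < rho -> isD u x (e_ i) (du i x)) ->
  (forall i, contAt (du i) a) -> contAt u a.
Proof.
move=> rho0 HD HC.
have [r r0 Hr] : exists2 r, 0 < r & forall i y, `|y - a| < r -> `|du i y - du i a| <= 1.
  have : \forall y \near a, forall i, `|du i y - du i a| <= 1.
    near=> y; near: y; apply: filter_forall => i; have /contAtP /cvgrPdist_le /(_ 1 ltr01) := HC i.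
    by apply: filterS => y; rewrite distrC.
  by move=> /nbhs_normP [r /= r0 H]; exists r => // i y ya; apply: H; rewrite /= distrC.
pose M := 1 + \sum_i `|du i a|.
have M0 : 0 <= M by rewrite addr_ge0 // sumr_ge0.
have mr0 : 0 < Num.min r rho by rewrite lt_min r0.
apply: (contAt_lip (C := N%:R * M) mr0); first by rewrite mulr_ge0.
move=> y ya; apply: (partials_lipschitz (a := a) (rho := Num.min r rho) (du := du)) => //.
- by move=> x i; rewrite lt_min => /andP [_]; exact: HD.
- move=> x i; rewrite lt_min => /andP [xr _].
  rewrite -(subrK (du i a) (du i x)); apply: le_trans (ler_normD _ _) _.
  apply: lerD; first exact: Hr.
  by rewrite (bigD1 i) //= lerDl sumr_ge0.
- by rewrite subrr normr0.
Unshelve. all: by end_near. Qed.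

Lemma schwarz_scalar (u : 'rV[R]_N -> R) (i j : 'I_N) (ui uj uij uji : 'rV[R]_N -> R) (a : 'rV[R]_N) (rho : R) :
  0 < rho ->
  (forall x, `|x - a| < rho -> isD u x (e_ i) (ui x)) ->
  (forall x, `|x - a| < rho -> isD u x (e_ j) (uj x)) ->
  (forall x, `|x - a| < rho -> isD ui x (e_ j) (uij x)) ->
  (forall x, `|x - a| < rho -> isD uj x (e_ i) (uji x)) ->
  contAt uij a -> contAt uji a -> uij a = uji a.
Proof.
move=> rho0 Hi Hj Hij Hji Cij Cji.
(* both mixed partials are limits of the same second difference quotient *)
have key (u' ui' uij' : 'rV[R]_N -> R) (k l : 'I_N) :
  (forall x, `|x - a| < rho -> isD u' x (e_ k) (ui' x)) ->
  (forall x, `|x - a| < rho -> isD ui' x (e_ l) (uij' x)) ->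
  contAt uij' a -> forall e, 0 < e -> exists2 r, 0 < r & forall t, 0 < t < r ->
   `|u' (a + t *: e_ k + t *: e_ l) - u' (a + t *: e_ k) - u' (a + t *: e_ l) + u' a
      - t * t * uij' a| <= e * (t * t).
  move=> H1 H2 C e e0; have [r r0 Hr] := C e e0.
  exists (Num.min (r / 2) (rho / 2)); first by rewrite lt_min !divr_gt0.
  move=> t /andP [t0]; rewrite lt_min => /andP [tr trho].
  have B (s s' : R) : 0 <= s <= t -> 0 <= s' <= t -> `|a + s *: e_ k + s' *: e_ l - a| <= 2 * t.
    move=> /andP [s0 st] /andP [s'0 s't].
    rewrite -!addrA addrC -!addrA [- a + a]addrC subrr addr0.
    apply: le_trans (ler_normD _ _) _; rewrite !normrZ mulr_natl mulr2n; apply: lerD.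
      by rewrite ger0_norm //; apply: le_trans (ler_piMr _ (norm_delta k)) _.
    by rewrite ger0_norm //; apply: le_trans (ler_piMr _ (norm_delta l)) _.
  have Brho s s' : 0 <= s <= t -> 0 <= s' <= t -> `|a + s *: e_ k + s' *: e_ l - a| < rho.
    by move=> h1 h2; apply: le_lt_trans (B _ _ h1 h2) _; lra.
  have t00 : 0 <= (0:R) <= t by rewrite lexx ltW.
  have tt : 0 <= t <= t by rewrite lexx ltW.
  have [|c ct E] := @mvt_eq R (fun s => u' (a + t *: e_ l + s *: e_ k) - u' (a + s *: e_ k))
     (fun s => ui' (a + s *: e_ k + t *: e_ l) - ui' (a + s *: e_ k)) 0 t (ltW t0).
    move=> s st; apply: isDB; apply/isD_line.
      rewrite addrAC; apply: H1; exact: Brho.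
    apply: H1; by have := Brho s 0 st t00; rewrite scale0r addr0.
  have [|c' ct' E'] := @mvt_eq R (fun s => ui' (a + c *: e_ k + s *: e_ l))
     (fun s => uij' (a + c *: e_ k + s *: e_ l)) 0 t (ltW t0).
    by move=> s st; apply/isD_line; apply: H2; exact: Brho.
  move: E E'; rewrite !scale0r !addr0 !subr0 => E E'.
  have -> : u' (a + t *: e_ k + t *: e_ l) - u' (a + t *: e_ k) - u' (a + t *: e_ l) + u' a
     = u' (a + t *: e_ l + t *: e_ k) - u' (a + t *: e_ k) - (u' (a + t *: e_ l) - u' a).
    by rewrite [a + t *: e_ k + _]addrAC; ring.
  rewrite E.
  have tt0 : 0 < t * t by rewrite mulr_gt0.
  have -> : ui' (a + c *: e_ k + t *: e_ l) = ui' (a + c *: e_ k) + uij' (a + c *: e_ k + c' *: e_ l) * t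
    by rewrite -E'; ring.
  have -> (X Y Z : R) : (X + Y * t - X) * t - t * t * Z = t * t * (Y - Z) by ring.
  rewrite normrM (gtr0_norm tt0) [e * _]mulrC ler_pM2l //; apply: Hr.
  by apply: le_lt_trans (B _ _ ct ct') _; lra.
apply/eqP; rewrite -subr_eq0 -normr_le0; apply/ler_addgt0Pr => e e0; rewrite add0r.
have e20 : 0 < e / 2 by rewrite divr_gt0.
have [r1 r10 K1] := key u ui uij i j Hi Hij Cij _ e20.
have [r2 r20 K2] := key u uj uji j i Hj Hji Cji _ e20.
pose t := Num.min r1 r2 / 2.
have m0 : 0 < Num.min r1 r2 by rewrite lt_min r10.
have t0 : 0 < t by rewrite divr_gt0.
have tm : t < Num.min r1 r2 by rewrite /t ltr_pdivrMr // ltr_pMr // ltr1n.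
have /andP [t1 t2] : (t < r1) && (t < r2) by rewrite -lt_min.
have := K1 t; rewrite t0 t1 => /(_ isT); have := K2 t; rewrite t0 t2 => /(_ isT).
rewrite [a + t *: e_ j + _]addrAC; set D := u _; set D1 := u (a + t *: e_ i); set D2 := u (a + t *: e_ j).
move=> k2 k1; rewrite -(ler_pM2r (mulr_gt0 t0 t0)) -{1}(gtr0_norm (mulr_gt0 t0 t0)) -normrM.
move: k1 k2; rewrite !ler_norml; move: (uij a) (uji a) (u a) => ? ? ?; lra.
Qed.

End PartialDerivatives.

(** * Parametric integrals over [0,1] *)

Section UnitIntervalIntegral.
Variable R : realType.

(** Composing with the clamp [c] onto the unit interval makes the integrand continuous on the whole
    line. Integrating from -1, with 2 as upper limit, keeps 0 and 1 interior, so two-sided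
    derivatives exist at both ends. *)
Lemma primitive_exists (k : R -> R) : (forall s, 0 <= s <= 1 -> contAt k s) ->
  exists G : R -> R, forall s, 0 <= s <= 1 -> isD G s 1 (k s).
Proof.
move=> kc.
pose c (s : R) := Num.max 0 (Num.min 1 s).
have c01 s : 0 <= c s <= 1.
  by rewrite /c le_max lexx /= ge_max ler01 /= ge_min lexx.
have cid s : 0 <= s <= 1 -> c s = s.
  by move=> /andP [s0 s1]; rewrite /c min_r // max_r.
have cc s : contAt c s.
  move=> e e0; exists e => // y /ltW; apply: le_trans.
  have := ler_norm (y - s); have := ler_norm (s - y); rewrite [`|s - y|]distrC /c.
  by have [?|?] := leP 1 y; have [?|?] := leP 1 s; rewrite ?(max_r ler01);
    have [?|?] := leP 0 y; have [?|?] := leP 0 s; rewrite ler_norml; lra.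
have Kc : continuous (k \o c).
  move=> s; apply/contAtP; apply: contAt_comp; first exact: cc.
  exact/kc/c01.
exists (fun x => \int[lebesgue_measure]_(t in [set` Interval (BLeft (-1)) (BRight x)]) (k \o c) t)%R.
move=> s s01.
have [|||| d1 d2] := @continuous_FTC1 R (k \o c) (BLeft (-1)) s 2.
- lra.
- apply: continuous_compact_integrable; first exact: segment_compact.
  exact: continuous_subspaceT.
- by rewrite /= lte_fin; lra.
- exact: Kc.
have := derivable_isD d1; rewrite -derive1E d2 /= cid //.
Qed.

(* All primitives give the same value; [0] when [K] has no primitive on [0, 1]. *)
Definition vint (n : nat) (K : R -> 'rV[R]_n) : 'rV[R]_n :=
  xget 0 [set I | exists G : R -> 'rV[R]_n,
    (forall s, 0 <= s <= 1 -> isD G s 1 (K s)) /\ I = G 1 - G 0].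

Section Fixed.
Variable n : nat.
Implicit Types K : R -> 'rV[R]_n.

Lemma vint_prim K (G : R -> 'rV[R]_n) :
  (forall s, 0 <= s <= 1 -> isD G s 1 (K s)) -> vint K = G 1 - G 0.
Proof.
move=> HG; rewrite /vint; case: xgetP => [I -> [G' [HG' ->]]|/(_ (G 1 - G 0)) []]; last by exists G.
have := @mvt_zero R n (fun s => G' s - G s) 0 1 ler01.
have H s : 0 <= s <= 1 -> isD (fun s => G' s - G s) s 1 0.
  by move=> s01; rewrite -(subrr (K s)); apply: isDB; [exact: HG'|exact: HG].
move=> /(_ H) /rowP E; apply/rowP => j; have := E j; rewrite !mxE; lra.
Qed.

Lemma vint_ex K : (forall s, 0 <= s <= 1 -> contAt K s) ->
  exists G : R -> 'rV[R]_n, (forall s, 0 <= s <= 1 -> isD G s 1 (K s)) /\ vint K = G 1 - G 0.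
Proof.
move=> Kc.
have H j : exists G : R -> R, forall s, 0 <= s <= 1 -> isD G s 1 (K s ord0 j).
  by apply: primitive_exists => s /Kc /contAt_coord.
have [G HG] := choice H.
have HG' s : 0 <= s <= 1 -> isD (fun s => \row_j G j s) s 1 (K s).
  move=> s01; apply/isD_coord => j; have := HG j s s01.
  by congr isD; apply/funext => t; rewrite mxE.
exists (fun s => \row_j G j s); split => //; exact: (vint_prim HG').
Qed.

Lemma vint_eq K K' : (forall s, 0 <= s <= 1 -> K s = K' s) -> vint K = vint K'.
Proof.
move=> E; rewrite /vint; congr xget; apply/funext => I; apply/propext.
split=> -[G [HG EI]]; exists G; split=> // s s01.
  by rewrite -(E s s01); exact: HG.
by rewrite (E s s01); exact: HG.
Qed.

Lemma vintD K K' : (forall s, 0 <= s <= 1 -> contAt K s) ->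
  (forall s, 0 <= s <= 1 -> contAt K' s) ->
  vint (fun s => K s + K' s) = vint K + vint K'.
Proof.
move=> /vint_ex [G [HG ->]] /vint_ex [G' [HG' ->]].
rewrite (@vint_prim _ (fun s => G s + G' s)).
  by rewrite opprD addrACA.
by move=> s s01; apply: isDD; [exact: HG|exact: HG'].
Qed.

Lemma vintZ K (a : R) : (forall s, 0 <= s <= 1 -> contAt K s) ->
  vint (fun s => a *: K s) = a *: vint K.
Proof.
move=> /vint_ex [G [HG ->]]; rewrite (@vint_prim _ (fun s => a *: G s)).
  by rewrite scalerBr.
by move=> s s01; apply: isDZ; exact: HG.
Qed.

Lemma vint_le K (B dB : R -> R) : (forall s, 0 <= s <= 1 -> contAt K s) ->
  (forall s, 0 <= s <= 1 -> isD B s 1 (dB s)) ->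
  (forall s, 0 <= s <= 1 -> `|K s| <= dB s) -> `|vint K| <= B 1 - B 0.
Proof. by move=> /vint_ex [G [HG ->]] HB; apply: mvt_dom. Qed.

Lemma vint_le_cst K (M : R) : (forall s, 0 <= s <= 1 -> contAt K s) ->
  (forall s, 0 <= s <= 1 -> `|K s| <= M) -> `|vint K| <= M.
Proof.
by move=> /vint_ex [G [HG ->]] H; rewrite -[M]mulr1 -[X in M * X](subr0 1); exact: mvt_le HG H.
Qed.

End Fixed.

Lemma vint_mulmx (m n : nat) (K : R -> 'rV[R]_n) (M : 'M[R]_(n, m)) :
  (forall s, 0 <= s <= 1 -> contAt K s) -> vint (fun s => K s *m M) = vint K *m M.
Proof.
move=> /vint_ex [G [HG ->]]; rewrite (@vint_prim _ _ (fun s => G s *m M)).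
  by rewrite mulmxBl.
by move=> s s01; apply: isD_mulmx; exact: HG.
Qed.

Lemma vint_sum (n : nat) (I : Type) (s : seq I) (K : I -> R -> 'rV[R]_n) :
  (forall i t, 0 <= t <= 1 -> contAt (K i) t) ->
  vint (fun t => \sum_(i <- s) K i t) = \sum_(i <- s) vint (K i).
Proof.
move=> H; elim: s => [|i s IH].
  rewrite big_nil (@vint_prim _ _ (fun=> 0)) ?subrr // => t _.
  rewrite big_nil; exact: isD_cst.
rewrite big_cons -IH -vintD //; last by move=> t t01; apply: contAt_sum => j _; exact: H.
- by congr vint; apply/funext => t; rewrite big_cons.
- by move=> t; exact: H.
Qed.

Section Parametric.
Variables (V : normedModType R) (n : nat).
Implicit Types K : R -> V -> 'rV[R]_n.

Definition jcont K (s : R) (x : V) := forall e : R, 0 < e -> exists2 r : R, 0 < r &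
  forall s' x', `|s' - s| < r -> `|x' - x| < r -> `|K s' x' - K s x| <= e.

Lemma jcont_contAt K s x : jcont K s x -> contAt (fun s => K s x) s.
Proof.
move=> H e /H [r r0 Hr]; exists r => // s' hs; apply: Hr => //.
by rewrite subrr normr0.
Qed.

(** Compactness of the unit interval makes the radius around [x] independent of [s]; this uniformity
    lets limits pass under [vint]. *)
Lemma jcont_unif K x : (forall s, 0 <= s <= 1 -> jcont K s x) ->
  forall e : R, 0 < e -> exists2 r : R, 0 < r &
  forall s x', 0 <= s <= 1 -> `|x' - x| < r -> `|K s x' - K s x| <= e.
Proof.
move=> H e e0.
have /compact_near_coveringP C : compact `[(0 : R), 1]%classic by exact: segment_compact.
have /nbhs_normP [r /= r0 Hr] : \forall x' \near x,
    `[(0 : R), 1]%classic `<=` (fun s => `|K s x' - K s x| <= e).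
  apply: C.
  move=> s /=; rewrite in_itv /= => s01.
  have [r r0 Hr] := H s s01 (e / 2) (divr_gt0 e0 (ltr0Sn _ _)).
  exists (ball s r, ball x r); first by split => /=; exact: nbhsx_ballx.
  move=> [s' x'] /= []; rewrite -!ball_normE /= => h1 h2.
  have -> : K s' x' - K s' x = (K s' x' - K s x) - (K s' x - K s x) by rewrite opprB addrA subrK.
  apply: le_trans (ler_normB _ _) _; rewrite [e]splitr; apply: lerD.
    by apply: Hr; rewrite distrC.
  by apply: Hr; rewrite ?subrr ?normr0 // distrC.
exists r => // s x' s01 hx; apply: (Hr x'); last by rewrite /= in_itv.
by rewrite /= distrC.
Qed.

Lemma vint_param_cont K x (rho : R) : 0 < rho ->
  (forall x' s, `|x' - x| < rho -> 0 <= s <= 1 -> jcont K s x') ->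
  contAt (fun x => vint (fun s => K s x)) x.
Proof.
move=> rho0 H e e0.
have xx : `|x - x| < rho by rewrite subrr normr0.
have [r r0 Hr] := @jcont_unif K x (fun s => H x s xx) e e0.
exists (Num.min r rho); first by rewrite lt_min r0.
move=> y; rewrite lt_min => /andP [yr yrho].
rewrite -[X in _ - X]scale1r -scaleNr -vintZ; last first.
  by move=> s s01; apply/jcont_contAt/H.
rewrite -vintD; first last.
- by move=> s s01; apply/contAtZ/jcont_contAt/H.
- by move=> s s01; apply/jcont_contAt/H.
apply: vint_le_cst => s s01; last by rewrite scaleN1r; exact: Hr.
by apply: contAtD; [|apply/contAtZ]; apply/jcont_contAt/H.
Qed.

(** The remainder of the difference quotient is itself an integral, whose integrand is estimated by
    the mean value inequality along the segment from [x] to [x + h *: v], uniformly in [s]. *)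
Lemma vint_param_isD K dK x v (rho : R) : 0 < rho ->
  (forall x' s, `|x' - x| < rho -> 0 <= s <= 1 -> jcont K s x') ->
  (forall x' s, `|x' - x| < rho -> 0 <= s <= 1 -> jcont dK s x') ->
  (forall x' s, `|x' - x| < rho -> 0 <= s <= 1 -> isD (K s) x' v (dK s x')) ->
  isD (fun x => vint (fun s => K s x)) x v (vint (fun s => dK s x)).
Proof.
move=> rho0 HK HdK HD e e0.
have xx : `|x - x| < rho by rewrite subrr normr0.
have [r r0 Hr] := @jcont_unif dK x (fun s => HdK x s xx) e e0.
have v1 : 0 < `|v| + 1 by rewrite ltr_wpDl.
exists (Num.min r rho / (`|v| + 1)); first by rewrite divr_gt0 // lt_min r0.
move=> h; rewrite ltr_pdivlMr // => hr.
have small t : 0 <= t <= 1 -> `|x + t *: (h *: v) - x| < Num.min r rho.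
  move=> /andP [t0 t1]; rewrite addrAC subrr add0r !normrZ ger0_norm //.
  apply: le_lt_trans hr; apply: (@le_trans _ _ (`|h| * `|v|)).
    by rewrite ler_piMl // mulr_ge0.
  by rewrite ler_wpM2l // lerDl.
have smr t : 0 <= t <= 1 -> `|x + t *: (h *: v) - x| < r.
  by move=> /small; rewrite lt_min => /andP [].
have smrho t : 0 <= t <= 1 -> `|x + t *: (h *: v) - x| < rho.
  by move=> /small; rewrite lt_min => /andP [].
have i1 : 0 <= (1 : R) <= 1 by rewrite ler01 lexx.
have xh : `|x + h *: v - x| < rho by have := smrho 1 i1; rewrite scale1r.
have c1 s : 0 <= s <= 1 -> contAt (fun s => K s (x + h *: v)) s.
  by move=> s01; apply/jcont_contAt/HK.
have c2 s : 0 <= s <= 1 -> contAt (fun s => K s x) s.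
  by move=> s01; apply/jcont_contAt/HK.
have c3 s : 0 <= s <= 1 -> contAt (fun s => dK s x) s.
  by move=> s01; apply/jcont_contAt/HdK.
have c2' s : 0 <= s <= 1 -> contAt (fun s => -1 *: K s x) s by move=> /c2; exact: contAtZ.
have c3' s : 0 <= s <= 1 -> contAt (fun s => (- h) *: dK s x) s by move=> /c3; exact: contAtZ.
have c12 s : 0 <= s <= 1 -> contAt (fun s => K s (x + h *: v) + -1 *: K s x) s.
  by move=> s01; apply: contAtD; [exact: c1|exact: c2'].
rewrite -[X in _ - X - _]scale1r -!scaleNr -!vintZ // -!vintD //.
apply: vint_le_cst => s s01; first by apply: contAtD; [exact: c12|exact: c3'].
rewrite scaleN1r scaleNr.
have := @mvt_le R n (fun t => K s (x + t *: (h *: v)) - t *: (h *: dK s x))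
  (fun t => h *: dK s (x + t *: (h *: v)) - h *: dK s x) (`|h| * e) 0 1 ler01.
rewrite !scale1r scale0r addr0 scale0r subr0 subr0 mulr1 [e * _]mulrC.
rewrite -[_ - _ - _]addrA [- (h *: _) - _]addrC addrA; apply.
  move=> t t01; apply: isDB.
    apply/isD_line; apply: isD_scaledir; apply: HD => //; exact: smrho.
  have := isDZf (isDX 1 t) (isD_cst (h *: dK s x) t (1 : R)).
  rewrite expr0 mulr1 scaler0 add0r scale1r.
  by congr isD.
move=> t t01; rewrite -scalerBr normrZ ler_wpM2l //; apply: Hr => //; exact: smr.
Qed.

End Parametric.
End UnitIntervalIntegral.

(** * Maximum principle on cubes *)

Section GradientEstimate.
Variable R : realType.

(** The function [W s + al * s + be * s ^+ 2] has a maximum at 0, so its first derivative vanishes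
    there; a positive second derivative at 0 would make the first one positive just to the right.
    The quadratic term leaves room for the barrier of the next lemma. *)
Lemma second_derivative_test (W dW : R -> R) (k al be r : R) : 0 < r ->
  (forall s, `|s| < r -> isD W s 1 (dW s)) -> isD dW 0 1 k ->
  (forall s, `|s| < r -> W s + al * s + be * s ^+ 2 <= W 0) -> k + 2 * be <= 0.
Proof.
move=> r0 HW HdW Hmax.
pose G (s : R) := W s + (al * s + be * s ^+ 2).
pose dG (s : R) := dW s + (al + be * (2 * s)).
have HG s : `|s| < r -> isD G s 1 (dG s).
  move=> /HW H; apply: isDD => //; apply: isDD.
    have := isDZ al (isDX 1 s); rewrite expr0 mulr1 /GRing.scale /= mulr1.
    by congr isD.
  by have := isDZ be (isDX 2 s); rewrite /GRing.scale /= expr1.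
have HdG : isD dG 0 1 (k + 2 * be).
  apply: isDD => //; rewrite -[2 * be]add0r; apply: isDD; first exact: isD_cst.
  have -> : (fun s : R => be * (2 * s)) = (fun s : R => (2 * be) *: (s ^+ 1)).
    by apply/funext => s; rewrite expr1 /GRing.scale /= mulrCA mulrA.
  by have := isDZ (2 * be) (isDX 1 0); rewrite expr0 !mulr1 /GRing.scale /= mulr1.
have G0 : G 0 = W 0 by rewrite /G expr2 !mulr0 !addr0.
have Gmax s : `|s| < r -> G s <= G 0 by move=> /Hmax; rewrite G0 /G addrA.
have dG0 : dG 0 = 0.
  have r2 : 0 < r / 2 by rewrite divr_gt0.
  have inr t : t \in `](- (r / 2)), (r / 2)[%R -> `|t| < r.
    by rewrite in_itv /= => /andP [h1 h2]; rewrite ltr_norml; lra.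
  have H : is_derive (0 : R) 1 G 0.
    apply: (@derive1_at_max R G (- (r / 2)) (r / 2) 0).
    - lra.
    - by move=> t /inr /HG; exact: isD_derivable.
    - by rewrite in_itv /=; lra.
    - by move=> t /inr; exact: Gmax.
  move/isDP : H => H; have n0 : `|0 : R| < r by rewrite normr0.
  exact: (isD_uniq (HG 0 n0) H).
rewrite leNgt; apply/negP => kp.
have [r1 r10 Hr1] := HdG ((k + 2 * be) / 2) (divr_gt0 kp (ltr0Sn _ _)).
have dGp s : 0 < s -> s < r1 -> 0 < dG s.
  move=> s0 s1; have := Hr1 s; rewrite gtr0_norm // => /(_ s1).
  rewrite add0r dG0 subr0 /GRing.scale /= mulr1 ler_norml => /andP [h _].
  have : 0 < (k + 2 * be) / 2 * s by rewrite mulr_gt0 // divr_gt0.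
  lra.
pose h := Num.min r r1 / 2.
have m0 : 0 < Num.min r r1 by rewrite lt_min r0.
have h0 : 0 < h by rewrite divr_gt0.
have hm : h < Num.min r r1 by rewrite /h ltr_pdivrMr // ltr_pMr // ltr1n.
have /andP [hr hr1] : (h < r) && (h < r1) by rewrite -lt_min.
have inr s : 0 <= s <= h -> `|s| < r by move=> /andP [s0 sh]; rewrite ger0_norm //; lra.
have h20 : 0 < h / 2 by rewrite divr_gt0.
(* A mean value point of the whole interval might be 0, where [dG] vanishes; the second half
   supplies a point with [dG] strictly positive. *)
have [s /andP [s0 sh]|c /andP [c1 c2] E1] := @mvt_eq R G dG 0 (h / 2) (ltW h20).
  by apply/HG/inr; lra.
have hh : h / 2 <= h by lra.
have [s /andP [s0 sh]|c' /andP [c'1 c'2] E2] := @mvt_eq R G dG (h / 2) h hh.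
  by apply/HG/inr; lra.
have dc : 0 <= dG c.
  by move: c1; rewrite le_eqVlt => /predU1P [<-|c0]; rewrite ?dG0 // ltW // dGp //; lra.
have dc' : 0 < dG c' by apply: dGp; lra.
have : G h <= G 0 by apply: Gmax; rewrite gtr0_norm.
have : 0 <= dG c * (h / 2 - 0) by rewrite mulr_ge0 //; lra.
have : 0 < dG c' * (h - h / 2) by rewrite mulr_gt0 //; lra.
by rewrite -E1 -E2; lra.
Qed.

Variable N : nat.
Local Notation e_ i := (delta_mx 0 i : 'rV[R]_N).

Definition harm2 (w : 'rV[R]_N -> R) (a : 'rV[R]_N) (rho : R) :=
  exists w1 w2 : 'I_N -> 'rV[R]_N -> R, forall x, `|x - a| < rho ->
   [/\ contAt w x, forall i, isD w x (e_ i) (w1 i x),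
       forall i, isD (w1 i) x (e_ i) (w2 i x), forall i, contAt (w1 i) x &
       \sum_i w2 i x = 0].

Lemma entryD (x : 'rV[R]_N) (s : R) (i k : 'I_N) :
  (x + s *: e_ i) ord0 k = x ord0 k + (if k == i then s else 0).
Proof. by rewrite !mxE /=; case: eqP => _; rewrite /= ?mulr1 ?mulr0. Qed.

(** Barrier argument on the half cube [K], for the difference of [w] and its reflection [w (sg x)]
    in the hyperplane [y_j = 0]. The barrier [c * (Q + T (y_j))] is harmonic, since [T] contributes
    [- 2 (N - 1)] against [2 (N - 1)] from [Q]. On the faces [|y_i| = d] and [y_j = d] one has
    [Q + T >= d ^+ 2], so the barrier is at least [2 M] and dominates; on [y_j = 0] the difference
    is zero. At the point [t] of the j-th axis [Q] vanishes and [T t <= t N d], whence the constant.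
    The term in [eps] makes the comparison function strictly subharmonic, which excludes an interior
    maximum. *)
Lemma harm2_odd_bound (w : 'rV[R]_N -> R) a (rho d M t : R) (j : 'I_N) :
  harm2 w a rho -> 0 < d < rho -> (forall x, `|x - a| < rho -> `|w x| <= M) ->
  0 <= t <= d -> w (a + t *: e_ j) - w (a - t *: e_ j) <= 2 * t * N%:R * M / d.
Proof.
move=> [w1 [w2 H]] /andP [d0 drho] HM /andP [t0 td].
pose sg (x : 'rV[R]_N) := x - (2 * (x ord0 j - a ord0 j)) *: e_ j.
pose y (x : 'rV[R]_N) i := x ord0 i - a ord0 i.
pose Q (x : 'rV[R]_N) := \sum_(i | i != j) (y x i) ^+ 2.
pose n1 : R := N%:R - 1.
pose T (s : R) := s * (N%:R * d - n1 * s).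
pose c := 2 * M / d ^+ 2.
have Npos : (0 < N)%N by apply: leq_ltn_trans (ltn_ord j).
have n10 : 0 <= n1 by rewrite subr_ge0 ler1n.
have M0 : 0 <= M by apply: le_trans (HM a _) => //; rewrite subrr normr0; lra.
have c0 : 0 <= c by rewrite divr_ge0 ?mulr_ge0 ?exprn_ge0 ?(ltW d0).
have cd : c * d ^+ 2 = 2 * M by rewrite /c divfK // expf_neq0 // gt_eqF.
have T0 s : 0 <= s <= d -> 0 <= T s.
  move=> /andP [s0 sd]; have h := ler_wpM2l n10 sd; rewrite /T mulr_ge0 //.
  have -> : N%:R * d = n1 * d + d by rewrite /n1; ring.
  by rewrite subr_ge0; apply: le_trans h _; rewrite lerDl ltW.
have sgE x i : sg x ord0 i = a ord0 i + (if i == j then - y x i else y x i).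
  rewrite /sg -scaleNr entryD /y; case: eqP => [->|_]; ring.
pose A i := if i == j then `[a ord0 j, a ord0 j + d]%classic
   else `[a ord0 i - d, a ord0 i + d]%classic.
pose K := [set x : 'rV[R]_N | forall i, A i (x ord0 i)].
have KP x : K x <-> (forall i, `|y x i| <= d) /\ 0 <= y x j.
  rewrite /K /A /y /=; split=> [Kx|[h1 h2] i].
    split=> [i|]; last by have := Kx j; rewrite eqxx /= in_itv /=; lra.
    by have := Kx i; case: eqP => [->|_]; rewrite /= in_itv /= ler_norml; lra.
  have := h1 i; case: eqP => [ij|_]; rewrite /= in_itv /= ler_norml; last by lra.
  by rewrite ij; lra.
have Kc : compact K by apply: rV_compact => i; rewrite /A; case: ifP => _; exact: segment_compact.
have KB x : K x -> `|x - a| < rho /\ `|sg x - a| < rho.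
  move=> /KP [h _]; split; apply: le_lt_trans drho; apply: rV_norm_le (ltW d0) _ => i.
    by rewrite !mxE; exact: h.
  rewrite mxE sgE mxE addrAC subrr add0r; case: ifP => _; rewrite ?normrN; exact: h.
have w2M x : K x -> w x - w (sg x) <= 2 * M.
  move=> /KB [h1 h2]; have := HM _ h1; have := HM _ h2; rewrite !ler_norml; lra.
have Q0 x : 0 <= Q x by apply: sumr_ge0 => i _; exact: sqr_ge0.
have tK : K (a + t *: e_ j).
  apply/KP; split=> [i|]; rewrite /y entryD addrAC subrr add0r ?eqxx //.
  by case: eqP => _; rewrite ?normr0 ?(ltW d0) // ger0_norm.
have sgt : sg (a + t *: e_ j) = a - t *: e_ j.
  by apply/rowP => i; rewrite sgE /y -scaleNr !entryD; case: eqP => _; ring.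
suff main eps : 0 < eps -> w (a + t *: e_ j) - w (a - t *: e_ j) <= 2 * t * N%:R * M / d + eps * d ^+ 2.
  apply/ler_addgt0Pr => e e0; have := main (e / d ^+ 2); rewrite divfK ?expf_neq0 ?gt_eqF //; apply.
  by rewrite divr_gt0 // exprn_gt0.
move=> eps0.
pose v (x : 'rV[R]_N) := w x - w (sg x) - c * (Q x + T (y x j)) + eps * (y x j) ^+ 2.
have vT : forall x, K x -> v x <= eps * d ^+ 2.
  have yc i x : contAt (y^~ i) x.
    by apply: contAtD; [exact: contAt_entry|exact: contAt_cst].
  have vc : {within K, continuous v}.
    apply: continuous_in_subspaceT => x; rewrite inE => /KB [xa sxa]; apply/contAtP.
    have [cw _ _ _ _] := H _ xa; have [csw _ _ _ _] := H _ sxa.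
    apply: contAtD; first apply: contAtD; first apply: contAtD => //.
    - apply: contAtN; apply: (contAt_comp _ csw).
      apply/contAt_coord => i; have -> : (fun x => sg x ord0 i) = (fun x => a ord0 i + (if i == j then - y x i else y x i)).
        by apply/funext => z; rewrite sgE.
      apply: contAtD; first exact: contAt_cst.
      by case: eqP => _; [apply: contAtN|]; exact: yc.
    - apply: contAtN; apply: contAtZ; apply: contAtD.
        by apply: contAt_sum => i _; apply: contAtM; exact: yc.
      apply: contAtM; first exact: yc.
      by apply: contAtD; [exact: contAt_cst|apply/contAtN/contAtZ/yc].
    - by apply: contAtZ; apply: contAtM; exact: yc.
  have [m] := EVT_max_rV (ex_intro _ _ tK) Kc vc.
  rewrite inE => mK mmax x xK; apply: le_trans (mmax x _) _; first by rewrite inE.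
  have [mB smB] := KB m mK.
  have /KP [md mj0] := mK.
  have mjd : y m j <= d by apply: le_trans (ler_norm _) (md j).
  have bdry : d ^+ 2 <= Q m + T (y m j) -> v m <= eps * d ^+ 2.
    move=> h; have := ler_wpM2l c0 h; rewrite cd => h1.
    have h2 := w2M _ mK.
    have : eps * (y m j) ^+ 2 <= eps * d ^+ 2 by rewrite ler_wpM2l ?(ltW eps0) // ler_sqr ?nnegrE // ltW.
    by rewrite /v; lra.
  have [[i ij mi]|noface] := pselect (exists2 i, i != j & `|y m i| = d).
    apply: bdry; rewrite -[d ^+ 2]addr0; apply: lerD; last by apply: T0; rewrite mj0.
    rewrite /Q (bigD1 i) //= -mi -[`|_| ^+ 2]addr0 real_normK ?num_real // lerD2l.
    by apply: sumr_ge0 => k _; exact: sqr_ge0.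
  have [mjdE|mjdN] := eqVneq (y m j) d.
    apply: bdry; rewrite mjdE /T -[X in X <= _]add0r; apply: lerD => //.
    by rewrite /n1; lra.
  have [mj0E|mj0N] := eqVneq (y m j) 0.
    have -> : v m = - (c * Q m).
      rewrite /v /sg -/(y m j) mj0E mulr0 scale0r subr0 subrr /T mul0r addr0 expr2 !mulr0; ring.
    have : 0 <= c * Q m by rewrite mulr_ge0.
    have : 0 <= eps * d ^+ 2 by rewrite mulr_ge0 ?exprn_ge0 // ltW.
    lra.
  (* no boundary face: m is an interior maximum, impossible since the Laplacian of v is 2 eps *)
  exfalso.
  have mjlt : y m j < d by rewrite lt_neqAle mjdN.
  have mjgt : 0 < y m j by rewrite lt_neqAle eq_sym mj0N.
  (* Half the second derivative along [e_ i] of the terms added to [w x - w (sg x)]. Since the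
     barrier is harmonic, these numbers add up to [eps]. *)
  pose be i := if i == j then c * n1 + eps else - c.
  have K2 i : (w2 i m - w2 i (sg m)) + 2 * be i <= 0.
    pose s0 : R := if i == j then -1 else 1.
    pose r := if i == j then Num.min (y m j) (d - y m j) else d - `|y m i|.
    have r0 : 0 < r.
      rewrite /r; case: eqP => [_|/eqP ij]; first by rewrite lt_min mjgt subr_gt0.
      rewrite subr_gt0 lt_neqAle md andbT; apply/eqP => E; apply: noface; by exists i.
    have ys s k : y (m + s *: e_ i) k = y m k + (if k == i then s else 0).
      by rewrite /y entryD addrAC.
    have sKr s : `|s| < r -> K (m + s *: e_ i).
      move=> sr; apply/KP; move: sr; rewrite /r; case: (eqVneq i j) => [->|ij].
        rewrite lt_min => /andP [s1 s2]; split=> [k|]; last first.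
          by rewrite /y entryD eqxx -/(y _ _); move: s1; rewrite ltr_norml; rewrite addrAC -/(y m j); lra.
        rewrite /y entryD addrAC -/(y m k); case: eqP => [->|_]; last by rewrite addr0.
        by move: s1 s2; rewrite ler_norml !ltr_norml; lra.
      move=> s1; split=> [k|]; last by rewrite ys eq_sym (negbTE ij) addr0.
      rewrite ys; case: eqP => [->|_]; last by rewrite addr0.
      by apply: le_trans (ler_normD _ _) _; lra.
    have sgs s : sg (m + s *: e_ i) = sg m + s *: (s0 *: e_ i).
      apply/rowP => k; rewrite sgE [RHS]mxE sgE ys !mxE /= /s0.
      have [->|kj] := eqVneq k j; have [E|ij] := eqVneq i j.
      - by rewrite mulr1n; ring.
      - by rewrite mulr0n; ring.
      - by rewrite E (negbTE kj) mulr0n; ring.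
      - by case: (k == i); rewrite ?mulr1n ?mulr0n; ring.
    have al_ex : exists al, forall s, - c * (Q (m + s *: e_ i) + T (y (m + s *: e_ i) j)) + eps * (y (m + s *: e_ i) j) ^+ 2
         = - c * (Q m + T (y m j)) + eps * (y m j) ^+ 2 + al * s + be i * s ^+ 2.
      rewrite /be; case: (eqVneq i j) => [ij|ij].
        have QE s : Q (m + s *: e_ i) = Q m.
          by apply: eq_bigr => k kj; rewrite ys ij (negbTE kj) addr0.
        exists (- c * (N%:R * d - 2 * n1 * y m j) + 2 * eps * y m j) => s.
        by rewrite QE ys ij eqxx /T; ring.
      have QE s : Q (m + s *: e_ i) = Q m + 2 * y m i * s + s ^+ 2.
        rewrite /Q (bigD1 i) //= [in RHS](bigD1 i) //= ys eqxx.
        under eq_bigr => k /andP [_ ki] do rewrite ys (negbTE ki) addr0.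
        by ring.
      exists (- c * (2 * y m i)) => s.
      by rewrite QE ys eq_sym (negbTE ij) addr0; ring.
    have [al Hal] := al_ex.
    apply: (@second_derivative_test (fun s => w (m + s *: e_ i) - w (sg m + s *: (s0 *: e_ i)))
       (fun s => w1 i (m + s *: e_ i) - s0 * w1 i (sg m + s *: (s0 *: e_ i)))
       _ al _ r r0).
    - move=> s sr; have [B1 B2] := KB _ (sKr _ sr).
      have [_ D1 _ _ _] := H _ B1; have [_ D2 _ _ _] := H _ B2.
      apply: isDB; first by apply/isD_line; exact: D1.
      apply/isD_line; apply: isD_scaledir; rewrite -sgs; exact: D2.
    - have [_ _ D1 _ _] := H _ mB; have [_ _ D2 _ _] := H _ smB.
      apply: isDB; first by apply/isD_line; rewrite scale0r addr0; exact: D1.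
      have -> : w2 i (sg m) = s0 *: (s0 * w2 i (sg m)).
        by rewrite /GRing.scale /= mulrA /s0; case: eqP => _; rewrite ?mulrNN !mulr1 mul1r.
      by apply: isDZ; apply/isD_line; apply: isD_scaledir; rewrite scale0r addr0; exact: D2.
    - move=> s sr; have := mmax (m + s *: e_ i); rewrite inE => /(_ (sKr s sr)).
      rewrite -sgs !scale0r !addr0 /v; have := Hal s; lra.
  have : \sum_i ((w2 i m - w2 i (sg m)) + 2 * be i) <= 0 by apply: sumr_le0 => i _; exact: K2.
  have [_ _ _ _ S1] := H _ mB; have [_ _ _ _ S2] := H _ smB.
  rewrite big_split sumrB S1 S2 subrr /= add0r -mulr_sumr (bigD1 j) //= /be eqxx.
  rewrite (eq_bigr (fun=> - c)); last by move=> i /negbTE ->.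
  rewrite sumr_const cardC1 card_ord.
  have -> : - c *+ N.-1 = - (c * n1) by rewrite mulNrn -mulr_natr /n1 -subn1 natrB.
  by rewrite addrAC subrr add0r; lra.
have := vT _ tK; rewrite /v sgt.
have -> : Q (a + t *: e_ j) = 0.
  rewrite /Q big1 // => i ij; by rewrite /y entryD (negbTE ij) addr0 subrr expr2 mulr0.
have -> : y (a + t *: e_ j) j = t by rewrite /y entryD eqxx addrAC subrr add0r.
have : c * (0 + T t) <= 2 * t * N%:R * M / d.
  have -> : 2 * t * N%:R * M / d = c * (t * (N%:R * d)) by rewrite /c; field; rewrite gt_eqF.
  by rewrite add0r ler_wpM2l // /T ler_wpM2l // gerBl mulr_ge0.
have : 0 <= eps * t ^+ 2 by rewrite mulr_ge0 ?sqr_ge0 // ltW.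
lra.
Qed.

End GradientEstimate.

(** * Uniform limits of harmonic functions *)

Section HarmonicLimits.
Variables (R : realType) (N : nat).
Local Notation e_ i := (delta_mx 0 i : 'rV[R]_N).
Local Notation pt := 'rV[R]_N.
Implicit Types (w phi psi : pt -> R) (a x : pt).

(** Stronger than uniform continuity on [K]: the second point may lie outside [K], as is required
    for tubes around [K]. *)
Lemma compact_unif (V W : normedModType R) (f : V -> W) (K : set V) :
  compact K -> (forall x : V, K x -> contAt f x) ->
  forall e : R, 0 < e -> exists2 r : R, 0 < r &
    forall x y : V, K x -> `|y - x| < r -> `|f y - f x| <= e.
Proof.
move=> /compact_near_coveringP C H e e0.
have /nbhs_normP [r /= r0 Hr] : \forall z \near (0 : V),
    K `<=` (fun x : V => `|f (x + z) - f x| <= e).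
  apply: C => x Kx.
  have [r r0 Hr] := H x Kx (e / 2) (divr_gt0 e0 (ltr0Sn _ _)).
  have r20 : 0 < r / 2 by rewrite divr_gt0.
  have rr : r / 2 < r by rewrite ltr_pdivrMr // ltr_pMr // ltr1n.
  exists (ball x (r / 2), ball (0 : V) (r / 2)); first by split => /=; exact: nbhsx_ballx.
  move=> [x' z] /= []; rewrite -!ball_normE /= sub0r normrN distrC => h1 h2.
  have -> : f (x' + z) - f x' = (f (x' + z) - f x) - (f x' - f x) by rewrite opprB addrA subrK.
  apply: le_trans (ler_normB _ _) _; rewrite [e]splitr; apply: lerD; apply: Hr; last exact: lt_trans rr.
  rewrite addrAC; apply: le_lt_trans (ler_normD _ _) _; rewrite [r]splitr; exact: ltrD.
exists r => // x y Kx yx; have := Hr (y - x); rewrite /= sub0r normrN => /(_ yx x Kx).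
by rewrite [x + _]addrC subrK.
Qed.

(** The indicator of [U] is continuous at the points of [K], and a variation of at most 1/2 cannot
    lead from the value 1 to the value 0. *)
Lemma compact_tube (K U : set pt) : compact K ->
  (forall x, U x -> exists2 r : R, 0 < r & forall y, `|y - x| < r -> U y) -> K `<=` U ->
  exists2 r : R, 0 < r & forall x y, K x -> `|y - x| < r -> U y.
Proof.
move=> Kc Uopen KU; pose chi (x : pt) : R := if `[< U x >] then 1 else 0.
have chic x : K x -> contAt chi x.
  move=> /KU Ux; have [r r0 Hr] := Uopen x Ux; move=> e e0; exists r => // y /Hr Uy.
  by rewrite /chi !asboolT // subrr normr0 ltW.
have h20 : 0 < 2^-1 :> R by rewrite invr_gt0.
have [r r0 H] := compact_unif Kc chic h20; exists r => // x y Kx /(H _ _ Kx).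
rewrite /chi (asboolT (KU _ Kx)); case: asboolP => // nU.
by rewrite sub0r normrN normr1 => h; have : (1 : R) <= 2^-1 := h; lra.
Qed.

Lemma closed_ball_compact a (r : R) : 0 <= r -> compact [set x : pt | `|x - a| <= r].
Proof.
move=> r0; suff -> : [set x : pt | `|x - a| <= r] =
   [set x : pt | forall i, `[a ord0 i - r, a ord0 i + r]%classic (x ord0 i)].
  apply: (@rV_compact _ _ (fun i => `[a ord0 i - r, a ord0 i + r]%classic)) => i.
  exact: segment_compact.
apply/seteqP; split=> x /= H.
  move=> i; have := le_trans (rV_norm_coord (x - a) ord0 i) H; rewrite !mxE in_itv /= ler_norml; lra.
apply: rV_norm_le => // i; have := H i; rewrite !mxE in_itv /= ler_norml; lra.
Qed.

Lemma harm2_sub w a b (rho rho' : R) : (forall x, `|x - b| < rho' -> `|x - a| < rho) ->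
  harm2 w a rho -> harm2 w b rho'.
Proof. by move=> S [w1 [w2 H]]; exists w1, w2 => x /S /H. Qed.

Lemma harm2Z (k : R) w a (rho : R) : harm2 w a rho -> harm2 (fun x => k * w x) a rho.
Proof.
move=> [w1 [w2 H]]; exists (fun i x => k * w1 i x), (fun i x => k * w2 i x) => x /H [c d1 d2 c1 S].
split.
- exact: (contAtZ k c).
- by move=> i; exact: (isDZ k (d1 i)).
- by move=> i; exact: (isDZ k (d2 i)).
- by move=> i; exact: (contAtZ k (c1 i)).
- by rewrite -mulr_sumr S mulr0.
Qed.

Lemma harm2D w w' a (rho : R) : harm2 w a rho -> harm2 w' a rho ->
  harm2 (fun x => w x + w' x) a rho.
Proof.
move=> [w1 [w2 H]] [w1' [w2' H']].
exists (fun i x => w1 i x + w1' i x), (fun i x => w2 i x + w2' i x) => x xa.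
have [c d1 d2 c1 S] := H x xa; have [c' d1' d2' c1' S'] := H' x xa.
split.
- exact: contAtD.
- by move=> i; exact: isDD.
- by move=> i; exact: isDD.
- by move=> i; exact: contAtD.
- by rewrite big_split /= S S' addr0.
Qed.

Lemma harm2_shift w a (rho : R) u : harm2 w a rho -> harm2 (fun x => w (x + u)) (a - u) rho.
Proof.
move=> [w1 [w2 H]]; exists (fun i x => w1 i (x + u)), (fun i x => w2 i (x + u)) => x.
rewrite opprB addrA => /H [c d1 d2 c1 S].
have tc (f : pt -> R) : contAt f (x + u) -> contAt (fun x => f (x + u)) x.
  move=> cf; apply: (@contAt_comp _ _ _ _ f (fun x => x + u) x _ cf) => e e0; exists e => // y /ltW.
  by rewrite opprD addrACA subrr addr0.
have td (f : pt -> R) v d : isD f (x + u) v d -> isD (fun x => f (x + u)) x v d.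
  by move=> Hf; apply: (@isD_comp_lin _ _ _ _ f (fun x => x + u) x v d v _ Hf) => h; rewrite addrAC.
split => //.
- exact: tc.
- by move=> i; exact: td.
- by move=> i; exact: td.
- by move=> i; exact: tc.
Qed.

(** A notion of harmonicity stable under differentiation: [harm2] gives no derivatives beyond the
    second, whereas uniform limits of [harm2] functions will turn out to be differentiable with
    derivatives of the same kind. *)
Definition approxH phi a (rho : R) := forall e : R, 0 < e ->
  exists2 w, harm2 w a rho & forall x, `|x - a| < rho -> `|phi x - w x| <= e.

Lemma approxH_sub phi a b (rho rho' : R) : (forall x, `|x - b| < rho' -> `|x - a| < rho) ->
  approxH phi a rho -> approxH phi b rho'.
Proof.
move=> S H e e0; have [w Hw Hd] := H e e0; exists w; first exact: harm2_sub S Hw.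
by move=> x /S /Hd.
Qed.

Lemma harm2_approxH w a (rho : R) : harm2 w a rho -> approxH w a rho.
Proof. by move=> H e e0; exists w => // x _; rewrite subrr normr0 ltW. Qed.

Lemma approxHZ (k : R) phi a (rho : R) : approxH phi a rho -> approxH (fun x => k * phi x) a rho.
Proof.
move=> H e e0; have k1 : 0 < `|k| + 1 by rewrite ltr_wpDl.
have [w Hw Hd] := H (e / (`|k| + 1)) (divr_gt0 e0 k1).
exists (fun x => k * w x); first exact: harm2Z.
move=> x /Hd h; rewrite -mulrBr normrM.
apply: (@le_trans _ _ ((`|k| + 1) * (e / (`|k| + 1)))); last by rewrite mulrC divfK // gt_eqF.
by apply: ler_pM => //; rewrite lerDl.
Qed.

Lemma approxHD phi psi a (rho : R) : approxH phi a rho -> approxH psi a rho ->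
  approxH (fun x => phi x + psi x) a rho.
Proof.
move=> H H' e e0; have e20 : 0 < e / 2 by rewrite divr_gt0.
have [w Hw Hd] := H _ e20; have [w' Hw' Hd'] := H' _ e20.
exists (fun x => w x + w' x); first exact: harm2D.
move=> x xa; rewrite opprD addrACA; apply: le_trans (ler_normD _ _) _.
by rewrite [e]splitr; apply: lerD; [exact: Hd|exact: Hd'].
Qed.

Lemma approxH_ext phi psi a (rho : R) : (forall x, `|x - a| < rho -> phi x = psi x) ->
  approxH phi a rho -> approxH psi a rho.
Proof.
by move=> E H e /H [w Hw Hd]; exists w => // x xa; rewrite -E //; exact: Hd.
Qed.

Lemma approxH_odd_bound phi a (rho d M t : R) (j : 'I_N) :
  approxH phi a rho -> 0 < d < rho -> (forall x, `|x - a| < rho -> `|phi x| <= M) ->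
  0 <= t <= d -> `|phi (a + t *: e_ j) - phi (a - t *: e_ j)| <= 2 * t * N%:R * M / d.
Proof.
move=> H dd HM tt; have /andP [d0 drho] := dd; have /andP [t0 td] := tt.
have inB s : `|s| <= d -> `|a + s *: e_ j - a| < rho.
  by move=> h; apply: le_lt_trans (line_close _ _ _) _; exact: le_lt_trans drho.
have B1 : `|a + t *: e_ j - a| < rho by apply: inB; rewrite ger0_norm.
have B2 : `|a - t *: e_ j - a| < rho by rewrite -scaleNr; apply: inB; rewrite normrN ger0_norm.
apply/ler_addgt0Pr => e e0.
(* An approximation error of [e / C] costs [2 t N / d] times itself through the larger supremum, and
   twice itself at the two evaluation points. *)
pose C := 2 * t * N%:R / d + 2.
have C0 : 0 < C by rewrite ltr_wpDl // divr_ge0 ?mulr_ge0 ?(ltW d0).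
have eC0 : 0 < e / C by rewrite divr_gt0.
have [w Hw Hd] := H _ eC0.
have Mw x : `|x - a| < rho -> `|w x| <= M + e / C.
  move=> xa; rewrite -(subKr (phi x) (w x)); apply: le_trans (ler_normB _ _) _.
  by apply: lerD; [exact: HM|exact: Hd].
have k1 := harm2_odd_bound j Hw dd Mw tt.
have Mw' x : `|x - a| < rho -> `|-1 * w x| <= M + e / C.
  by move=> /Mw; rewrite mulN1r normrN.
have k2 := harm2_odd_bound j (harm2Z (-1) Hw) dd Mw' tt.
have h1 := Hd _ B1; have h2 := Hd _ B2.
have E : e = 2 * t * N%:R * (e / C) / d + 2 * (e / C).
  have E0 y : y * C = 2 * t * N%:R * y / d + 2 * y by rewrite /C; field; rewrite gt_eqF.
  by rewrite -E0 divfK // gt_eqF.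
have -> : 2 * t * N%:R * M / d + e = 2 * t * N%:R * (M + e / C) / d + 2 * (e / C).
  by rewrite {1}E; move: (e / C) => y; field; rewrite gt_eqF.
move: h1 h2 k1 k2; rewrite !ler_norml; lra.
Qed.

(** Centred at the midpoint of the increment, the two end points are symmetric and
    [approxH_odd_bound] applies. The outcome bounds difference quotients by the supremum, before any
    derivative is known to exist. *)
Lemma approxH_increment phi a (rho d M h : R) x (j : 'I_N) :
  approxH phi a rho -> (forall x, `|x - a| < rho -> `|phi x| <= M) -> 0 < d -> `|h| <= d ->
  `|x - a| + `|h| + d < rho -> `|phi (x + h *: e_ j) - phi x| <= `|h| * (N%:R * M / d).
Proof.
move=> H HM d0 hd hrho.
have [->|h0] := eqVneq h 0; first by rewrite scale0r addr0 subrr normr0 mul0r.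
have h0' : 0 < `|h| by rewrite normr_gt0.
pose c := x + (h / 2) *: e_ j.
have S y : `|y - c| < d + `|h| / 2 -> `|y - a| < rho.
  move=> yc; have -> : y - a = (y - c) + (x - a) + (h / 2) *: e_ j.
    by apply/rowP => i; rewrite /c !mxE; ring.
  apply: le_lt_trans hrho; apply: le_trans (ler_normD _ _) _.
  apply: le_trans (lerD (ler_normD _ _) (lexx _)) _.
  have : `|(h / 2) *: e_ j| <= `|h| / 2.
    by rewrite normrZ normrM [`|2^-1|]gtr0_norm ?invr_gt0 // ler_piMr ?norm_delta // divr_ge0.
  lra.
have Hc := approxH_sub S H.
have dd : 0 < d < d + `|h| / 2 by rewrite d0 ltrDl divr_gt0.
have HMc y : `|y - c| < d + `|h| / 2 -> `|phi y| <= M by move=> /S /HM.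
have tt : 0 <= `|h| / 2 <= d by rewrite divr_ge0 //= ler_pdivrMr // (le_trans hd) // ler_peMr ?ler1n ?ltW.
have := approxH_odd_bound j Hc dd HMc tt.
have -> : 2 * (`|h| / 2) * N%:R * M / d = `|h| * (N%:R * M / d) by field; rewrite gt_eqF.
have E1 : c + (h / 2) *: e_ j = x + h *: e_ j by apply/rowP => i; rewrite /c !mxE; field.
have E2 : c - (h / 2) *: e_ j = x by rewrite /c addrK.
have [hp|hn] := leP 0 h; first by rewrite (ger0_norm hp) E1 E2.
by rewrite (ltr0_norm hn) mulNr scaleNr opprK E2 E1 distrC.
Qed.

(** Applied to [phi - w], the increment bound makes the quotients of [phi] and [w] uniformly close
    for all small steps. So the quotients of [phi] inherit the Cauchy property from those of [w]. *)
Lemma approxH_derive phi a (rho rho' : R) (j : 'I_N) : 0 < rho' < rho ->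
  approxH phi a rho ->
  (forall x, `|x - a| < rho' -> derivable phi x (e_ j)) /\ approxH ('D_(e_ j) phi) a rho'.
Proof.
move=> /andP [rho'0 rr] H.
(* A third of the gap: a step of size at most [d] and the margin [d] of the increment bound fit
   together between the two balls. *)
pose d := (rho - rho') / 3.
have d0 : 0 < d by rewrite divr_gt0 // subr_gt0.
have incr w (e : R) x (h : R) : approxH w a rho -> (forall x, `|x - a| < rho -> `|phi x - w x| <= e) ->
  `|x - a| < rho' -> `|h| <= d ->
  `|(phi (x + h *: e_ j) - phi x) - (w (x + h *: e_ j) - w x)| <= `|h| * (N%:R * e / d).
  move=> Hw Hd xa hd.
  have Hdiff : approxH (fun x => phi x + -1 * w x) a rho by apply: approxHD => //; exact: approxHZ.
  have := @approxH_increment _ a rho d e h x j Hdiff _ d0 hd _.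
  have -> : phi (x + h *: e_ j) - phi x - (w (x + h *: e_ j) - w x) =
    phi (x + h *: e_ j) + -1 * w (x + h *: e_ j) - (phi x + -1 * w x) by ring.
  apply; first by move=> y /Hd; rewrite mulN1r.
  by rewrite /d in hd *; lra.
have rho0 : 0 < rho by lra.
pose Kc := N%:R / d + 2.
have Kc0 : 0 < Kc by rewrite ltr_wpDl // divr_ge0 // ltW.
(* the difference quotients of phi are uniformly close to those of a harmonic approximation *)
have quot (e : R) : 0 < e -> exists w (w1 w2 : 'I_N -> pt -> R), [/\ harm2 w a rho,
   (forall x, `|x - a| < rho -> [/\ contAt w x, forall i, isD w x (e_ i) (w1 i x),
       forall i, isD (w1 i) x (e_ i) (w2 i x), forall i, contAt (w1 i) x & \sum_i w2 i x = 0]) &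
   forall x, `|x - a| < rho' -> exists2 r, 0 < r & forall h, `|h| < r ->
     `|phi (x + h *: e_ j) - phi x - h * w1 j x| <= `|h| * e].
  move=> e0; have [w Hw Hd] := H (e / Kc) (divr_gt0 e0 Kc0).
  have [w1 [w2 Hw12]] := Hw; exists w, w1, w2; split => //.
  move=> x xa; have xrho : `|x - a| < rho by apply: lt_trans rr.
  have [_ D1 _ _ _] := Hw12 x xrho.
  have [r r0 Hr] := D1 j (e / Kc) (divr_gt0 e0 Kc0).
  exists (Num.min r d); first by rewrite lt_min r0.
  move=> h; rewrite lt_min => /andP [hr hd].
  have k1 := incr w _ x h (harm2_approxH Hw) Hd xa (ltW hd).
  have k2 := Hr h hr; rewrite /GRing.scale /= in k2.
  have : `|h| * (N%:R * (e / Kc) / d) + e / Kc * `|h| <= `|h| * e.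
    have -> : `|h| * (N%:R * (e / Kc) / d) + e / Kc * `|h| = `|h| * (e / Kc * (Kc - 1)).
      have E y : `|h| * (N%:R * y / d) + y * `|h| = `|h| * (y * (Kc - 1)) by rewrite /Kc; field; rewrite gt_eqF.
      exact: E.
    rewrite ler_wpM2l // mulrBr divfK ?gt_eqF // mulr1 gerBl divr_ge0 // ltW //.
  move: k1 k2; move: (`|h| * (N%:R * (e / Kc) / d)) (e / Kc * `|h|) (`|h| * e) => X Y Z.
  rewrite !ler_norml; lra.
have der x : `|x - a| < rho' -> derivable phi x (e_ j).
  move=> xa; apply: cauchy_cvg; apply: cauchy_exP => e e0.
  have [w [w1 [w2 [_ _ Q]]]] := quot (e / 2) (divr_gt0 e0 (ltr0Sn _ _)).
  have [r r0 Hr] := Q x xa.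
  exists (w1 j x).
  suff : \forall h \near (0 : R)^',
    ball (w1 j x) e (h^-1 *: ((phi \o shift x) (h *: e_ j) - phi x)) by [].
  near=> h.
  have h0 : h != 0 by near: h; exact: nbhs_dnbhs_neq.
  have hr : `|h| < r by near: h; exact: dnbhs0_lt.
  rewrite -ball_normE /= distrC addrC [_ + x]addrC [- _ + _]addrC.
  rewrite -[X in _ - X](mulKf h0) /GRing.scale /= -mulrBr normrM normfV.
  apply: (@le_lt_trans _ _ (e / 2)); last by rewrite ltr_pdivrMr // ltr_pMr // ltr1n.
  by rewrite ler_pdivrMl ?normr_gt0 //; exact: Hr.
split=> // e e0.
have e20 : 0 < e / 2 by rewrite divr_gt0.
have e40 : 0 < e / 2 / 2 by rewrite divr_gt0.
have [w [w1 [w2 [Hw Hw12 Q]]]] := quot (e / 2 / 2) e40.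
have Dw1 x : `|x - a| < rho' -> `|'D_(e_ j) phi x - w1 j x| <= e / 2.
  move=> xa; have [r r0 Hr] := Q x xa.
  have [r' r'0 Hr'] := derivable_isD (der x xa) e40.
  pose h := Num.min r r' / 2.
  have m0 : 0 < Num.min r r' by rewrite lt_min r0.
  have h0 : 0 < h by rewrite divr_gt0.
  have hm : h < Num.min r r' by rewrite /h ltr_pdivrMr // ltr_pMr // ltr1n.
  have /andP [hr hr'] : (h < r) && (h < r') by rewrite -lt_min.
  have := Hr h; have := Hr' h; rewrite gtr0_norm // => /(_ hr') k1 /(_ hr) k2.
  rewrite -(ler_pM2l h0) -{1}(gtr0_norm h0) -normrM mulrBr [h * (e / 2)]mulrC.
  have -> : e / 2 * h = e / 2 / 2 * h + h * (e / 2 / 2) by field.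
  move: k1 k2; rewrite /GRing.scale /=; move: (e / 2 / 2 * h) (h * (e / 2 / 2)) => X Y.
  rewrite !ler_norml; lra.
(* replace the derivative of the approximation by a difference quotient, which is again twice differentiable *)
pose rho'' := (rho + rho') / 2.
have r''0 : 0 <= rho'' by rewrite /rho''; lra.
have Cw1 x : `|x - a| <= rho'' -> contAt (w1 j) x.
  move=> xa; have [|_ _ _ c _] := Hw12 x; first by rewrite /rho'' in xa; lra.
  exact: c.
have [r r0 Hr] := @compact_unif _ _ (w1 j) _ (@closed_ball_compact a _ r''0) Cw1 _ e20.
pose t := Num.min r d / 2.
have m0 : 0 < Num.min r d by rewrite lt_min r0.
have t0 : 0 < t by rewrite divr_gt0.
have tm : t < Num.min r d by rewrite /t ltr_pdivrMr // ltr_pMr // ltr1n.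
have /andP [tr td] : (t < r) && (t < d) by rewrite -lt_min.
exists (fun x => t^-1 * (w (x + t *: e_ j) + -1 * w x)).
  apply: harm2Z; apply: harm2D; last first.
    by apply: harm2Z; apply: harm2_sub Hw => x xa; exact: lt_trans rr.
  apply: harm2_sub (harm2_shift (t *: e_ j) Hw) => x xa.
  rewrite opprB addrA addrAC; apply: le_lt_trans (ler_normD _ _) _.
  have : `|t *: e_ j| <= t by rewrite normrZ gtr0_norm // ler_piMr ?norm_delta // ltW.
  rewrite /d in td; lra.
move=> x xa; have inB s : 0 <= s <= t -> `|x + s *: e_ j - a| < rho''.
  move=> /andP [s0 st]; have -> : x + s *: e_ j - a = (x - a) + s *: e_ j by rewrite addrAC.
  apply: le_lt_trans (ler_normD _ _) _.
  have : `|s *: e_ j| <= s by rewrite normrZ ger0_norm // ler_piMr ?norm_delta.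
  rewrite /rho''; rewrite /d in td; lra.
have [s st|c ct E] := @mvt_eq R (fun s => w (x + s *: e_ j)) (fun s => w1 j (x + s *: e_ j)) 0 t (ltW t0).
  apply/isD_line; have [|_ D _ _ _] := Hw12 (x + s *: e_ j); last exact: D.
  by have := inB s st; rewrite /rho''; lra.
move: E; rewrite scale0r addr0 subr0 mulN1r => ->; rewrite mulrC mulfK ?gt_eqF //.
have k1 := Dw1 x xa.
have k2 : `|w1 j (x + c *: e_ j) - w1 j x| <= e / 2.
  apply: Hr; first by rewrite /= /rho''; lra.
  apply: le_lt_trans (line_close _ _ _) _; case/andP: ct => c0 ct; rewrite ger0_norm //.
  exact: le_lt_trans tr.
move: k1 k2; rewrite !ler_norml; lra.
Unshelve. all: by end_near. Qed.

Lemma approxH_cont phi a (rho : R) x : approxH phi a rho -> `|x - a| < rho -> contAt phi x.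
Proof.
move=> H xa e e0; have e30 : 0 < e / 3 by rewrite divr_gt0.
have [w [w1 [w2 Hw]] Hd] := H _ e30; have [c _ _ _ _] := Hw x xa.
have [r r0 Hr] := c _ e30.
exists (Num.min r (rho - `|x - a|)); first by rewrite lt_min r0 subr_gt0.
move=> y; rewrite lt_min => /andP [yr yrho].
have ya : `|y - a| < rho.
  have -> : y - a = (y - x) + (x - a) by rewrite addrA subrK.
  by apply: le_lt_trans (ler_normD _ _) _; lra.
move: (Hr y yr) (Hd x xa) (Hd y ya); rewrite !ler_norml; lra.
Qed.

(** Approximation is asked only on smaller concentric balls, because smoothing and difference
    quotients both lose a margin at the boundary. *)
Definition harmonic_on (U : set pt) phi := forall a (rho rho' : R), 0 < rho' < rho ->
  (forall x, `|x - a| < rho -> U x) -> approxH phi a rho'.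

Section OnOpen.
Variable U : set pt.
Hypothesis Uopen : forall x, U x -> exists2 r : R, 0 < r & forall y, `|y - x| < r -> U y.

Lemma harmonic_onZ (k : R) phi : harmonic_on U phi -> harmonic_on U (fun x => k * phi x).
Proof. by move=> H a rho rho' h1 h2; apply: approxHZ; exact: H h1 h2. Qed.

Lemma harmonic_onD phi psi : harmonic_on U phi -> harmonic_on U psi ->
  harmonic_on U (fun x => phi x + psi x).
Proof. by move=> H H' a rho rho' h1 h2; apply: approxHD; [exact: H h1 h2|exact: H' h1 h2]. Qed.

Lemma harmonic_on_ext phi psi : (forall x, U x -> phi x = psi x) ->
  harmonic_on U phi -> harmonic_on U psi.
Proof.
move=> E H a rho rho' h1 h2; apply: approxH_ext (H a rho rho' h1 h2) => x xa.
by apply/E/h2; case/andP: h1 => _; exact: lt_trans.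
Qed.

Lemma harmonic_on_cont phi x : harmonic_on U phi -> U x -> contAt phi x.
Proof.
move=> H Ux; have [r r0 Hr] := Uopen Ux.
have r20 : 0 < r / 2 < r by rewrite divr_gt0 //= ltr_pdivrMr // ltr_pMr // ltr1n.
apply: approxH_cont (H x r (r / 2) r20 Hr) _.
by rewrite subrr normr0; case/andP: r20.
Qed.

Lemma harmonic_on_derive phi (j : 'I_N) : harmonic_on U phi ->
  (forall x, U x -> derivable phi x (e_ j)) /\ harmonic_on U ('D_(e_ j) phi).
Proof.
move=> H; split=> [x Ux|a rho rho' /andP [h0 h1] h2].
  have [r r0 Hr] := Uopen Ux.
  have r20 : 0 < r / 2 < r by rewrite divr_gt0 //= ltr_pdivrMr // ltr_pMr // ltr1n.
  have r40 : 0 < r / 4 < r / 2 by lra.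
  have [D _] := approxH_derive j r40 (H x r (r / 2) r20 Hr).
  by apply: D; rewrite subrr normr0; case/andP: r40.
pose r := (rho + rho') / 2.
have r1 : 0 < r < rho by rewrite /r; lra.
have r2 : 0 < rho' < r by rewrite /r; lra.
by have [_] := approxH_derive j r2 (H a rho r r1 h2).
Qed.

Lemma harmonic_on_grad phi (j : 'I_N) x (r M : R) : harmonic_on U phi -> 0 < r ->
  (forall y, `|y - x| < r -> U y) -> (forall y, `|y - x| < r -> `|phi y| <= M) ->
  `|'D_(e_ j) phi x| <= 2 * N%:R * M / r.
Proof.
move=> H r0 HU HM.
(* Three quarters of [r] leave room for the margin [d = r / 2], which gives the factor 2, and for a
   step shorter than [r / 4]. *)
have r1 : 0 < r * 3 / 4 < r by lra.
have A := H x r _ r1 HU.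
have HM' y : `|y - x| < r * 3 / 4 -> `|phi y| <= M by move=> h; apply: HM; lra.
have Ux : U x by apply: HU; rewrite subrr normr0.
apply/ler_addgt0Pr => e e0.
have [r' r'0 Hr'] := derivable_isD ((harmonic_on_derive j H).1 x Ux) e0.
pose h := Num.min r' (r / 4) / 2.
have m0 : 0 < Num.min r' (r / 4) by rewrite lt_min r'0 divr_gt0.
have h0 : 0 < h by rewrite divr_gt0.
have hm : h < Num.min r' (r / 4) by rewrite /h ltr_pdivrMr // ltr_pMr // ltr1n.
have /andP [hr' hr] : (h < r') && (h < r / 4) by rewrite -lt_min.
have := Hr' h; rewrite gtr0_norm // => /(_ hr') k1.
have k2 : `|phi (x + h *: e_ j) - phi x| <= h * (N%:R * M / (r / 2)).
  rewrite -{2}(gtr0_norm h0); apply: (approxH_increment j A HM'); rewrite ?(gtr0_norm h0).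
  - by rewrite divr_gt0.
  - by lra.
  - by rewrite subrr normr0; lra.
rewrite -(ler_pM2l h0) -{1}(gtr0_norm h0) -normrM mulrDr [h * e]mulrC.
have -> : h * (2 * N%:R * M / r) = h * (N%:R * M / (r / 2)) by field; rewrite gt_eqF.
move: k1 k2; rewrite /GRing.scale /=; move: (h * (N%:R * M / (r / 2))) (e * h) => X Y.
rewrite !ler_norml; lra.
Qed.

Lemma harmonic_on_iter phi (j : 'I_N) n : harmonic_on U phi -> harmonic_on U (iter n (fun f : pt -> R => 'D_(e_ j) f) phi).
Proof. by move=> H; elim: n => //= n IH; exact: (harmonic_on_derive j IH).2. Qed.

(** A weak form of Stirling's formula. Passing from [n] to [n.+1] multiplies the left side by [n.+1]
    and by the power [n.+1] of [1 + 1 / n.+1], which is at most [expR 1]. *)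
Lemma succ_exp_le_fact n : (n.+1%:R : R) ^+ n <= expR 1 ^+ n * n`!%:R.
Proof.
elim: n => [|n IH]; first by rewrite !expr0 mul1r.
have h1 : (1 + n.+1%:R^-1 : R) ^+ n.+1 <= expR 1.
  apply: (@le_trans _ _ (expR (n.+1%:R^-1) ^+ n.+1)).
    by rewrite lerXn2r ?nnegrE ?expR_ge0 ?expR_ge1Dx // addr_ge0 // invr_ge0.
  by rewrite -expRM_natr mulVf // pnatr_eq0.
have -> : (n.+2%:R : R) ^+ n.+1 = (1 + n.+1%:R^-1) ^+ n.+1 * (n.+1%:R * n.+1%:R ^+ n).
  by rewrite -exprS -exprMn mulrDl mul1r mulVf ?pnatr_eq0 // -[n.+2%:R]natr1.
rewrite [expR 1 ^+ _]exprS factS natrM -mulrA; apply: ler_pM => //.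
by rewrite mulrCA ler_wpM2l.
Qed.

(** Each of the [n] gradient estimates uses up a radius [rho / n.+1], so the ball of radius [rho] is
    never exhausted. The resulting power of [n.+1] is turned into a factorial by
    [succ_exp_le_fact]. *)
Lemma harmonic_on_cauchy phi (j : 'I_N) a (rho M : R) : harmonic_on U phi -> 0 < rho ->
  (forall y, `|y - a| < rho -> U y) -> (forall y, `|y - a| < rho -> `|phi y| <= M) ->
  forall n, `|iter n (fun f : pt -> R => 'D_(e_ j) f) phi a| <= M * (2 * N%:R * expR 1 / rho) ^+ n * n`!%:R.
Proof.
move=> H rho0 HU HM n.
pose r := rho / n.+1%:R.
have n0 : 0 < n.+1%:R :> R by rewrite ltr0Sn.
have r0 : 0 < r by rewrite divr_gt0.
have rE : n.+1%:R * r = rho by rewrite /r mulrC divfK // gt_eqF.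
have aa : `|a - a| < rho by rewrite subrr normr0.
have M0 : 0 <= M by apply: le_trans (HM a aa).
have key k x : `|x - a| + k%:R * r < rho -> `|iter k (fun f : pt -> R => 'D_(e_ j) f) phi x| <= M * (2 * N%:R / r) ^+ k.
  elim: k x => [|k IH] x; first by rewrite mul0r addr0 expr0 mulr1; exact: HM.
  rewrite -natr1 mulrDl mul1r addrA => hx /=.
  have sub y : `|y - x| < r -> `|y - a| + k%:R * r < rho.
    move=> yx; have -> : y - a = (y - x) + (x - a) by rewrite addrA subrK.
    by apply: le_lt_trans (lerD (ler_normD _ _) (lexx _)) _; lra.
  have kr : 0 <= k%:R * r by rewrite mulr_ge0 // ltW.
  apply: le_trans (@harmonic_on_grad _ j x r (M * (2 * N%:R / r) ^+ k) (harmonic_on_iter j k H) r0 _ _) _.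
  - by move=> y /sub h; apply: HU; lra.
  - by move=> y /sub; exact: IH.
  - by rewrite exprS; rewrite le_eqVlt; apply/orP; left; apply/eqP; field; rewrite gt_eqF.
have ka : `|a - a| + n%:R * r < rho by rewrite subrr normr0 add0r -rE -natr1 mulrDl mul1r ltrDl.
apply: le_trans (key n a ka) _; rewrite -[leRHS]mulrA ler_wpM2l //.
have -> : 2 * N%:R / r = (2 * N%:R / rho) * n.+1%:R by rewrite /r; field; rewrite !gt_eqF.
have -> : 2 * N%:R * expR 1 / rho = (2 * N%:R / rho) * expR 1 by field; rewrite gt_eqF.
have z0 : 0 <= 2 * N%:R / rho by rewrite divr_ge0 ?mulr_ge0 // ltW.
move: z0; move: (2 * N%:R / rho) => z z0.
rewrite !exprMn -[leRHS]mulrA ler_wpM2l ?succ_exp_le_fact //.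
by rewrite exprn_ge0.
Qed.

End OnOpen.
End HarmonicLimits.

(** * Dirac systems *)

Section JointContinuity.
Variables (R : realType) (V : normedModType R) (n : nat).

Lemma jcontP (K : R -> V -> 'rV[R]_n) (s : R) (x : V) :
  jcont K s x <-> contAt (fun p : R * V => K p.1 p.2) (s, x).
Proof.
split=> H e /H [r r0 Hr]; exists r => //.
  move=> [s' x']; rewrite prod_normE /= gt_max => /andP [h1 h2]; exact: Hr.
by move=> s' x' h1 h2; apply: (Hr (s', x')); rewrite prod_normE /= gt_max h1.
Qed.

Lemma contAt_fst (p : R * V) : contAt (fun p : R * V => p.1) p.
Proof.
move=> e e0; exists e => // q; rewrite prod_normE gt_max => /andP [h _]; exact: ltW.
Qed.

Lemma contAt_snd (p : R * V) : contAt (fun p : R * V => p.2) p.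
Proof.
move=> e e0; exists e => // q; rewrite prod_normE gt_max => /andP [_ h]; exact: ltW.
Qed.

End JointContinuity.

Lemma contAt_id (R : realType) (V : normedModType R) (x : V) : contAt (fun y : V => y) x.
Proof. by move=> e e0; exists e => // y /ltW. Qed.

(** Symmetric weights let the terms [(s, t)] and [(t, s)] be paired, so that only anticommutators
    occur. With second derivatives as weights this factorises a Laplacian; with products of
    coordinates it computes the square of a vector. *)
Lemma clifford_sum (R : realType) (n : nat) (I : finType) (w : I -> I -> 'rV[R]_n) (P Q : I -> 'M[R]_n) :
  (forall s t, P s *m Q t + P t *m Q s = (2 * (s == t)%:R)%:M) -> (forall s t, w s t = w t s) ->
  \sum_t \sum_s w s t *m (P s *m Q t) = \sum_t w t t.
Proof.
move=> PQ sym; have two : (2 : R) != 0 by rewrite pnatr_eq0.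
apply: (scalerI two); rewrite [LHS]scalerDl scale1r.
have E : \sum_t \sum_s w s t *m (P s *m Q t) = \sum_t \sum_s w s t *m (P t *m Q s).
  by rewrite exchange_big; apply: eq_bigr => s _; apply: eq_bigr => t _; rewrite sym.
rewrite {2}E -big_split scaler_sumr; apply: eq_bigr => t _ /=.
rewrite -big_split /= (bigD1 t) //= -mulmxDr PQ eqxx mulr1 mul_mx_scalar big1 ?addr0 // => s st.
by rewrite -mulmxDr PQ (negbTE st) mulr0 mul_mx_scalar scale0r.
Qed.

Section DiracSystem.
Variables (R : realType) (N n : nat).
Local Notation e_ i := (delta_mx 0 i : 'rV[R]_N).
Local Notation pt := 'rV[R]_N.
Local Notation val := 'rV[R]_n.
Variables (M_ K_ : 'I_N -> 'M[R]_n).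
Hypothesis clifford : forall i j, M_ i *m K_ j + M_ j *m K_ i = (2 * (i == j)%:R)%:M.

Definition dirac_C1 (u : pt -> val) (du : 'I_N -> pt -> val) (a : pt) (rho : R) :=
  forall x, `|x - a| < rho ->
   [/\ forall i, isD u x (e_ i) (du i x), forall i, contAt (du i) x &
       \sum_i du i x *m M_ i = 0].

(* [k] counts the coordinate directions in which [u] has already been averaged. *)
Definition dirac_C2 (k : nat) (u : pt -> val) du a rho := dirac_C1 u du a rho /\
  exists ddu : 'I_N -> 'I_N -> pt -> val, forall x, `|x - a| < rho ->
    forall i : 'I_N, (i < k)%N -> forall l, isD (du i) x (e_ l) (ddu i l x) /\ contAt (ddu i l) x.

Lemma dirac_C1_cont u du a (rho : R) x : dirac_C1 u du a rho -> `|x - a| < rho -> contAt u x.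
Proof.
move=> H xa; have r0 : 0 < rho - `|x - a| by rewrite subr_gt0.
have sub y : `|y - x| < rho - `|x - a| -> `|y - a| < rho.
  move=> yx; have -> : y - a = (y - x) + (x - a) by rewrite addrA subrK.
  by apply: le_lt_trans (ler_normD _ _) _; lra.
apply: (@partials_contAt R N n u du x _ r0).
  by move=> y i /sub /H [D _ _].
by move=> i; have [_ C _] := H x xa.
Qed.

Lemma jcont_shift (f : pt -> val) (h : R) (j : 'I_N) (s : R) (x : pt) :
  contAt f (x + (s * h) *: e_ j) -> jcont (fun s x => f (x + (s * h) *: e_ j)) s x.
Proof.
move=> cf; apply/jcontP.
apply: (@contAt_comp _ _ _ _ f (fun p : R * pt => p.2 + (p.1 * h) *: e_ j) (s, x) _ cf).
apply: contAtD; first exact: contAt_snd.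
apply: contAtZf; last exact: contAt_cst.
by apply: contAtM; [exact: contAt_fst|exact: contAt_cst].
Qed.

(* Averaging over a short segment in direction j gains one derivative in that direction. *)
Lemma steklov_step (k : nat) u du a (rho rho' eps : R) : (k < N)%N -> 0 < rho' < rho -> 0 < eps ->
  dirac_C2 k u du a rho ->
  exists u' du', dirac_C2 k.+1 u' du' a rho' /\ forall x, `|x - a| < rho' -> `|u' x - u x| <= eps.
Proof.
move=> kN /andP [rho'0 rr] eps0 [H [ddu Hdd]].
pose j := Ordinal kN.
pose rho'' := (rho + rho') / 2.
have r''0 : 0 <= rho'' by rewrite /rho''; lra.
have cu x : `|x - a| <= rho'' -> contAt u x.
  by move=> xa; apply: (dirac_C1_cont H); rewrite /rho'' in xa; lra.
have [d d0 Hd] := @compact_unif R _ _ u _ (@closed_ball_compact R N a _ r''0) cu _ eps0.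
pose h := Num.min d ((rho - rho') / 2) / 2.
have m0 : 0 < Num.min d ((rho - rho') / 2) by rewrite lt_min d0 divr_gt0 // subr_gt0.
have h0 : 0 < h by rewrite divr_gt0.
have hm : h < Num.min d ((rho - rho') / 2) by rewrite /h ltr_pdivrMr // ltr_pMr // ltr1n.
have /andP [hd hr] : (h < d) && (h < (rho - rho') / 2) by rewrite -lt_min.
have sh s : 0 <= s <= 1 -> 0 <= s * h <= h.
  by move=> /andP [s0 s1]; rewrite mulr_ge0 ?(ltW h0) // ler_piMl // ltW.
have inB x s : `|x - a| < rho' -> 0 <= s <= 1 -> `|x + (s * h) *: e_ j - a| < rho.
  move=> xa /sh /andP [s0 s1]; rewrite addrAC; apply: le_lt_trans (ler_normD _ _) _.
  have : `|(s * h) *: e_ j| <= h.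
    by rewrite normrZ ger0_norm //; apply: le_trans s1; rewrite ler_piMr ?norm_delta.
  lra.
have near x : `|x - a| < rho' -> exists2 r, 0 < r & forall y, `|y - x| < r -> `|y - a| < rho'.
  move=> xa; exists (rho' - `|x - a|); first by rewrite subr_gt0.
  move=> y yx; have -> : y - a = (y - x) + (x - a) by rewrite addrA subrK.
  by apply: le_lt_trans (ler_normD _ _) _; lra.
pose S (f : pt -> val) (x : pt) := vint (fun s => f (x + (s * h) *: e_ j)).
have Scont (f : pt -> val) x : (forall y, `|y - a| < rho -> contAt f y) -> `|x - a| < rho' -> contAt (S f) x.
  move=> cf xa; have [r r0 Hr] := near x xa.
  apply: (vint_param_cont (rho := r) (K := fun s x => f (x + (s * h) *: e_ j)) r0).
  by move=> y s /Hr ya s01; apply: jcont_shift; apply/cf/inB.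
have Sder (f df : pt -> val) i x : (forall y, `|y - a| < rho -> contAt f y) ->
    (forall y, `|y - a| < rho -> contAt df y) ->
    (forall y, `|y - a| < rho -> isD f y (e_ i) (df y)) -> `|x - a| < rho' ->
    isD (S f) x (e_ i) (S df x).
  move=> cf cdf Df xa; have [r r0 Hr] := near x xa.
  apply: (vint_param_isD (rho := r) (K := fun s x => f (x + (s * h) *: e_ j)) (dK := fun s x => df (x + (s * h) *: e_ j)) r0).
  - by move=> y s /Hr ya s01; apply: jcont_shift; apply/cf/inB.
  - by move=> y s /Hr ya s01; apply: jcont_shift; apply/cdf/inB.
  - move=> y s /Hr ya s01; apply: (@isD_comp_lin _ _ _ _ f (fun x => x + (s * h) *: e_ j) y _ _ (e_ i)).
      by move=> t; rewrite addrAC.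
    exact/Df/inB.
have cuB y : `|y - a| < rho -> contAt u y by exact: dirac_C1_cont H.
have cdu i y : `|y - a| < rho -> contAt (du i) y by move=> /H [_ C _].
have Du i y : `|y - a| < rho -> isD u y (e_ i) (du i y) by move=> /H [D _ _].
have cK (f : pt -> val) x : (forall y, `|y - a| < rho -> contAt f y) -> `|x - a| < rho' ->
    forall s : R, 0 <= s <= 1 -> contAt (fun s : R => f (x + (s * h) *: e_ j)) s.
  move=> cf xa s s01; apply: (@jcont_contAt _ _ _ (fun (s : R) (x : pt) => f (x + (s * h) *: e_ j))).
  by apply: jcont_shift; apply/cf/inB.
have lin s x : x + (s * h) *: e_ j = x + s *: (h *: e_ j) by rewrite scalerA.
(* The gain of a derivative: the average in direction [j] of the j-th partial is an exact difference
   quotient of [u], which is as regular as [u]. *)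
have Sj x : `|x - a| < rho' -> S (du j) x = h^-1 *: (u (x + h *: e_ j) - u x).
  move=> xa; rewrite /S (@vint_prim _ _ _ (fun s => h^-1 *: u (x + (s * h) *: e_ j))).
    by rewrite mul1r mul0r scale0r addr0 scalerBr.
  move=> s s01; have hN0 : h != 0 by rewrite gt_eqF.
  rewrite -[du j _](scalerK hN0); apply: isDZ.
  have -> : (fun s => u (x + (s * h) *: e_ j)) = (fun s => u (x + s *: (h *: e_ j))).
    by apply/funext => t; rewrite lin.
  rewrite lin; apply/isD_line; apply: isD_scaledir; rewrite -lin; exact/Du/inB.
exists (S u), (fun i => S (du i)); split; last first.
  move=> x xa; rewrite /S.
  have -> : u x = vint (fun=> u x).
    rewrite (@vint_prim _ _ _ (fun s => s *: u x)); first by rewrite scale1r scale0r subr0.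
    move=> s _; have := isDZf (isDX 1 s) (isD_cst (u x) s 1).
    by rewrite expr0 mulr1 scaler0 add0r scale1r; congr isD.
  have cst (s : R) : 0 <= s <= 1 -> contAt (fun _ : R => -1 *: u x) s by move=> _; exact: contAt_cst.
  rewrite -[- vint _]scaleN1r -vintZ; last by move=> s _; exact: contAt_cst.
  rewrite -vintD //; last exact: cK.
  apply: vint_le_cst => s s01; first by apply: contAtD; [exact: (cK u)|exact: contAt_cst].
  rewrite scaleN1r; apply: Hd.
    by rewrite /= /rho''; lra.
  rewrite addrAC subrr add0r normrZ; have /andP [s0 s1] := sh s s01.
  rewrite ger0_norm //; apply: le_lt_trans hd; apply: le_trans s1.
  by rewrite ler_piMr ?norm_delta.
split.
  move=> x xa; split=> [i|i|].
  - by apply: Sder => //; [exact: cdu|exact: Du].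
  - by apply: Scont => //; exact: cdu.
  - rewrite (eq_bigr (fun i => vint (fun s => du i (x + (s * h) *: e_ j) *m M_ i))); last first.
      by move=> i _; rewrite vint_mulmx //; apply: cK => //; exact: cdu.
    rewrite -vint_sum; last first.
      by move=> i t t01; apply: contAt_mulmx; apply: cK => //; exact: cdu.
    rewrite (@vint_prim _ _ _ (fun=> 0)) ?subrr // => s s01.
    have [_ _ ->] := H _ (inB x s xa s01); exact: isD_cst.
(* In the new direction the second derivatives are difference quotients of first ones; in the
   directions already treated they are averages of the previous second derivatives. *)
exists (fun i l => if i == j then (fun x => h^-1 *: (du l (x + h *: e_ j) - du l x)) else S (ddu i l)).
move=> x xa i; rewrite ltnS leq_eqVlt; have [-> _|ij] := eqVneq i j.
  move=> l; have [r r0 Hr] := near x xa.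
  have i1 : 0 <= (1 : R) <= 1 by rewrite ler01 lexx.
  have xh : `|x + h *: e_ j - a| < rho by have := inB x 1 xa i1; rewrite mul1r.
  have xrho : `|x - a| < rho by lra.
  have sc (f : pt -> val) : contAt f (x + h *: e_ j) -> contAt (fun x => f (x + h *: e_ j)) x.
    move=> cf; apply: (@contAt_comp _ _ _ _ f (fun x => x + h *: e_ j) x _ cf).
    by apply: contAtD; [exact: contAt_id|exact: contAt_cst].
  split; last by apply: contAtZ; apply: contAtD; [exact/sc/cdu|apply/contAtN/cdu].
  apply: (isD_near (f := fun x => h^-1 *: (u (x + h *: e_ j) - u x)) r0).
    by move=> y /Hr /Sj ->.
  apply: isDZ; apply: isDB; last exact: Du.
  apply: (@isD_comp_lin _ _ _ _ u (fun x => x + h *: e_ j) x _ _ (e_ l)); last exact: Du.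
  by move=> t; rewrite addrAC.
case/orP => [/eqP ik|ik] l; first by case/eqP: ij; exact: val_inj.
split; first apply: Sder => //.
- exact: cdu.
- by move=> y /Hdd /(_ i ik l) [].
- by move=> y /Hdd /(_ i ik l) [].
- by apply: Scont => // y /Hdd /(_ i ik l) [].
Qed.

Lemma dirac_smoothing k u du a (rho rho' eps : R) : (k <= N)%N -> 0 < rho' < rho -> 0 < eps ->
  dirac_C1 u du a rho ->
  exists u' du', dirac_C2 k u' du' a rho' /\ forall x, `|x - a| < rho' -> `|u' x - u x| <= eps.
Proof.
move=> kN rr eps0 H; elim: k kN rho' eps rr eps0 => [_|k IH kN] rho' eps rr eps0.
  exists u, du; split; last by move=> x _; rewrite subrr normr0 ltW.
  split; first by move=> x xa; apply: H; lra.
  by exists (fun _ _ _ => 0).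
pose r := (rho + rho') / 2.
have r1 : 0 < r < rho by rewrite /r; lra.
have r2 : 0 < rho' < r by rewrite /r; lra.
have e20 : 0 < eps / 2 by rewrite divr_gt0.
have [u1 [du1 [H1 E1]]] := IH (ltnW kN) r (eps / 2) r1 e20.
have [u2 [du2 [H2 E2]]] := steklov_step kN r2 e20 H1.
exists u2, du2; split => // x xa.
have -> : u2 x - u x = (u2 x - u1 x) + (u1 x - u x) by rewrite addrA subrK.
apply: le_trans (ler_normD _ _) _; rewrite [eps]splitr; apply: lerD; first exact: E2.
by apply: E1; lra.
Qed.

Lemma dirac_C2_harm2 u du a (rho : R) (k : 'I_n) : dirac_C2 N u du a rho ->
  harm2 (fun x => u x ord0 k) a rho.
Proof.
move=> [H [ddu Hdd]].
exists (fun i x => du i x ord0 k), (fun i x => ddu i i x ord0 k) => x xa.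
have [D C S] := H x xa.
split.
- by move/contAt_coord: (dirac_C1_cont H xa); exact.
- by move=> i; move/isD_coord: (D i); exact.
- by move=> i; move/isD_coord: (Hdd x xa i (ltn_ord i) i).1; exact.
- by move=> i; move/contAt_coord: (C i); exact.
have r0 : 0 < rho - `|x - a| by rewrite subr_gt0.
have sub y : `|y - x| < rho - `|x - a| -> `|y - a| < rho.
  move=> yx; have -> : y - a = (y - x) + (x - a) by rewrite addrA subrK.
  by apply: le_lt_trans (ler_normD _ _) _; lra.
(* The averages made the second derivatives continuous, so Schwarz's theorem applies. *)
have sym i j : ddu i j x = ddu j i x.
  apply/rowP => l.
  apply: (@schwarz_scalar R N (fun x => u x ord0 l) i j (fun x => du i x ord0 l) (fun x => du j x ord0 l)
    (fun x => ddu i j x ord0 l) (fun x => ddu j i x ord0 l) x _ r0).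
  - by move=> y /sub ya; have [D' _ _] := H y ya; move/isD_coord: (D' i); exact.
  - by move=> y /sub ya; have [D' _ _] := H y ya; move/isD_coord: (D' j); exact.
  - by move=> y /sub ya; move/isD_coord: (Hdd y ya i (ltn_ord i) j).1; exact.
  - by move=> y /sub ya; move/isD_coord: (Hdd y ya j (ltn_ord j) i).1; exact.
  - by move/contAt_coord: (Hdd x xa i (ltn_ord i) j).2; exact.
  - by move/contAt_coord: (Hdd x xa j (ltn_ord j) i).2; exact.
(* apply the conjugate operator to the Dirac equation *)
have Z j : \sum_i ddu i j x *m M_ i = 0.
  have H0 : isD (fun x => \sum_i du i x *m M_ i) x (e_ j) (\sum_i ddu i j x *m M_ i).
    by apply: isD_sum => i _; apply: isD_mulmx; exact: (Hdd x xa i (ltn_ord i) j).1.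
  apply: (isD_uniq H0); apply: (isD_near (f := fun=> 0) r0); last exact: isD_cst.
  by move=> y /sub /H [_ _ ->].
have Z1 : \sum_j \sum_i ddu i j x *m (M_ i *m K_ j) = 0.
  rewrite big1 // => j _; under eq_bigr do rewrite mulmxA.
  by rewrite -mulmx_suml Z mul0mx.
rewrite (clifford_sum (w := fun i j => ddu i j x) clifford sym) in Z1.
have : (\sum_i ddu i i x) ord0 k = 0 by rewrite Z1 mxE.
by rewrite summxE.
Qed.

Lemma dirac_approxH u du a (rho rho' : R) (k : 'I_n) : 0 < rho' < rho -> dirac_C1 u du a rho ->
  approxH (fun x => u x ord0 k) a rho'.
Proof.
move=> rr H e e0; have [u' [du' [H' E]]] := dirac_smoothing (leqnn N) rr e0 H.
exists (fun x => u' x ord0 k); first exact: dirac_C2_harm2 H'.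
move=> x /E h; rewrite distrC; apply: le_trans h.
by apply: le_trans (rV_norm_coord _ ord0 k); rewrite !mxE.
Qed.

End DiracSystem.

(** * Sums of one-dimensional Taylor series *)

Section AnalyticTowers.
Variable R : realType.

(** Partial sums of the expansion of the power [- n.+1] of [1 - x]. By Pascal's rule, multiplication
    by [1 - x] lowers [n] by one, up to a nonnegative last term. *)
Lemma negative_binomial_sum (x : R) n K : 0 <= x < 1 ->
  (1 - x) ^+ n.+1 * \sum_(k < K) 'C(n + k, k)%:R * x ^+ k <= 1.
Proof.
move=> /andP [x0 x1]; have y0 : 0 <= 1 - x by lra.
elim: n K => [|n IH] [|K]; rewrite ?big_ord0 ?mulr0 ?ler01 //.
  rewrite expr1; have -> : (1 - x) * \sum_(k < K.+1) 'C(0 + k, k)%:R * x ^+ k = 1 - x ^+ K.+1.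
    elim: K => [|K IH]; first by rewrite big_ord1 add0n bin0 expr0 expr1 !mulr1.
    by rewrite big_ord_recr /= mulrDr IH add0n binn mul1r [in RHS]exprS; ring.
  by rewrite gerBl exprn_ge0.
have E : (1 - x) * (\sum_(k < K.+1) 'C(n.+1 + k, k)%:R * x ^+ k) + 'C(n.+1 + K, K)%:R * x ^+ K.+1
   = \sum_(k < K.+1) 'C(n + k, k)%:R * x ^+ k.
  elim: K => [|K IHK]; first by rewrite !big_ord1 !bin0 expr1 expr0; ring.
  rewrite big_ord_recr [in RHS]big_ord_recr /= -IHK !addSn !addnS binS natrD [in X in _ + X = _]exprS.
  by ring.
rewrite exprS -mulrA mulrCA.
apply: le_trans (IH K.+1); rewrite ler_wpM2l ?exprn_ge0 // -E lerDl mulr_ge0 // exprn_ge0 //.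
Qed.

Lemma fact_add_le n m : ((n + m)`!%:R : R) <= 2 ^+ (n + m) * n`!%:R * m`!%:R.
Proof.
have H : 'C(n + m, n) * (n`! * m`!) = (n + m)`! by have := bin_fact (leq_addr m n); rewrite addKn.
have H2 : ('C(n + m, n) <= 2 ^ (n + m))%N.
  have -> : (2 ^ (n + m) = \sum_(i < (n + m).+1) 'C(n + m, i))%N.
    by rewrite -[2%N]/(1 + 1)%N expnDn; apply: eq_bigr => i _; rewrite !exp1n !muln1.
  have nm : (n < (n + m).+1)%N by rewrite ltnS leq_addr.
  by rewrite (bigD1 (Ordinal nm)) //= leq_addr.
by rewrite -H !natrM -mulrA ler_wpM2r ?mulr_ge0 // -natrX ler_nat.
Qed.

(* Towers dl_n' = r dl_(n+1) are derivatives with respect to t = r^2/2. *)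
Section Identity.
Variables (dl : nat -> R -> R) (r1 M C : R).
Hypotheses (r10 : 0 <= r1) (C0 : 0 < C).
Hypothesis dlD : forall n r, 0 <= r <= r1 -> isD (dl n) r 1 (r * dl n.+1 r).
Hypothesis dlB : forall n r, 0 <= r <= r1 -> `|dl n r| <= M * C ^+ n * n`!%:R.

Let M0 : 0 <= M.
Proof.
have := dlB 0 (r := 0); rewrite lexx r10 => /(_ isT); rewrite expr0 !mulr1.
exact: le_trans.
Qed.

(** Taylor's estimate in the variable [r^2 / 2] around [rho]: the bound on [dl (n + m)] is
    integrated [m] times, every lower term vanishing at [rho]. *)
Lemma tower_remainder rho m n r : 0 <= rho -> (forall k, dl k rho = 0) -> rho <= r <= r1 ->
  `|dl n r| <= M * C ^+ (n + m) * (n + m)`!%:R / m`!%:R * ((r ^+ 2 - rho ^+ 2) / 2) ^+ m.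
Proof.
move=> rho0 Z; elim: m n r => [|m IH] n r /andP [h1 h2].
  by rewrite addn0 expr0 mulr1 invr1 mulr1; apply: dlB; lra.
pose c := M * C ^+ (n.+1 + m) * (n.+1 + m)`!%:R / m.+1`!%:R.
pose B (s : R) := c * ((s ^+ 2 - rho ^+ 2) / 2) ^+ m.+1.
pose dB (s : R) := s * (c * m.+1%:R * ((s ^+ 2 - rho ^+ 2) / 2) ^+ m).
have HB s : isD B s 1 (dB s).
  have k1 : isD (fun s : R => (s ^+ 2 - rho ^+ 2) / 2) s 1 s.
    have := isDZ (2^-1) (isDB (isDX 2 s) (isD_cst (rho ^+ 2) s 1)).
    have -> : 2^-1 *: (2%:R * s ^+ 2.-1 - 0) = s by rewrite /GRing.scale /= expr1; field.
    by congr isD; apply/funext => y; rewrite /GRing.scale /= mulrC.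
  have k2 := isDX m.+1 ((s ^+ 2 - rho ^+ 2) / 2).
  have /isDP k3 : is_derive s 1 ((fun y => y ^+ m.+1) \o (fun s : R => (s ^+ 2 - rho ^+ 2) / 2))
     (m.+1%:R * ((s ^+ 2 - rho ^+ 2) / 2) ^+ m * s).
    by apply: is_derive1_comp; apply/isDP.
  have := isDZ c k3; rewrite /dB.
  by have -> : s * (c * m.+1%:R * ((s ^+ 2 - rho ^+ 2) / 2) ^+ m) = c *: (m.+1%:R * ((s ^+ 2 - rho ^+ 2) / 2) ^+ m * s)
    by rewrite /GRing.scale /=; ring.
have := @mvt_dom R 1 (fun s => \row_(_ < 1) dl n s) (fun s => \row_(_ < 1) (s * dl n.+1 s)) B dB rho r h1.
have Brho : B rho = 0 by rewrite /B subrr mul0r exprS mul0r mulr0.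
have N1 (y : R) : `|\row_(_ < 1) y : 'rV[R]_1| <= `|y|.
  by apply: rV_norm_le => // j; rewrite mxE.
move=> H; rewrite addnS -addSn -/c -[X in _ <= X]subr0 -Brho.
apply: le_trans (H _ _ _); last first.
- move=> s /andP [s1 s2]; apply: le_trans (N1 _) _.
  have s0 : 0 <= s by lra.
  rewrite normrM (ger0_norm s0) /dB ler_wpM2l //.
  have -> : c * m.+1%:R = M * C ^+ (n.+1 + m) * (n.+1 + m)`!%:R / m`!%:R.
    rewrite /c factS natrM; move: (M * C ^+ _ * _) => A.
    have p0 : m.+1%:R != 0 :> R by rewrite pnatr_eq0.
    have f0 : m`!%:R != 0 :> R by rewrite pnatr_eq0 -lt0n fact_gt0.
    by move: p0 f0; move: (m.+1%:R : R) (m`!%:R : R) => p f p0 f0; field; rewrite ?p0 ?f0.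
  by apply: IH; rewrite s1; lra.
- by move=> s _; exact: HB.
- move=> s /andP [s1 s2]; apply/isD_coord => j; rewrite mxE.
  have := dlD n (r := s); have -> : 0 <= s <= r1 by lra.
  by move=> /(_ isT); congr isD; apply/funext => y; rewrite mxE.
- by apply: le_trans (rV_norm_coord _ ord0 ord0); rewrite !mxE Z subr0.
Qed.

(** With [fact_add_le] the m-th remainder is at most a constant times [(2 C t) ^+ m], where [t] is
    the increment of [r^2 / 2]; the limit [1 / (4 C)] on [t] makes the ratio at most 1/2. *)
Lemma tower_zero_step rho r : 0 <= rho -> (forall k, dl k rho = 0) -> rho <= r <= r1 ->
  (r ^+ 2 - rho ^+ 2) / 2 <= (4 * C)^-1 -> forall n, dl n r = 0.
Proof.
move=> rho0 Z /andP [h1 h2] ht n.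
set t := (r ^+ 2 - rho ^+ 2) / 2 in ht.
have t0 : 0 <= t by rewrite divr_ge0 // subr_ge0 ler_sqr ?nnegrE //; lra.
pose A := M * C ^+ n * 2 ^+ n * n`!%:R.
have A0 : 0 <= A by rewrite !mulr_ge0 ?exprn_ge0 // ltW.
have key m : `|dl n r| <= A * (2^-1) ^+ m.
  apply: le_trans (@tower_remainder rho m n r rho0 Z _) _; first by rewrite h1.
  rewrite -/t.
  have f0 : 0 < m`!%:R :> R by rewrite ltr0n fact_gt0.
  apply: (@le_trans _ _ (M * C ^+ (n + m) * (2 ^+ (n + m) * n`!%:R * m`!%:R) / m`!%:R * t ^+ m)).
    rewrite ler_wpM2r ?exprn_ge0 // ler_wpM2r ?invr_ge0 ?(ltW f0) // ler_wpM2l ?fact_add_le //.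
    by rewrite mulr_ge0 // exprn_ge0 // ltW.
  have -> : M * C ^+ (n + m) * (2 ^+ (n + m) * n`!%:R * m`!%:R) / m`!%:R * t ^+ m = A * (2 * C * t) ^+ m.
    by rewrite /A !exprD !exprMn; field; rewrite gt_eqF.
  have q0 : 0 <= 2 * C * t by rewrite (mulr_ge0 _ t0) // mulr_ge0 // ltW.
  rewrite ler_wpM2l // lerXn2r ?nnegrE ?invr_ge0 //.
  apply: (@le_trans _ _ (2 * C * (4 * C)^-1)); first by rewrite ler_wpM2l // mulr_ge0 // ltW.
  by rewrite le_eqVlt; apply/orP; left; apply/eqP; field; rewrite gt_eqF.
apply/eqP; rewrite -normr_le0.
have : (fun m => A * (2^-1) ^+ m : R) @ \oo --> A * 0.
  by apply: cvgMl_tmp; apply: cvg_expr; rewrite ger0_norm ?invr_ge0 //; lra.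
rewrite mulr0 => cv; rewrite -(cvg_lim _ cv) //.
apply: limr_ge; first by apply/cvg_ex; exists 0.
by near=> m; exact: key.
Unshelve. all: by end_near. Qed.

(** Vanishing spreads from 0 by steps of length [1 / (4 C)] in [r^2 / 2], for the interval may be
    much longer than one step. The j-th restart point is the [rho] whose half square is
    [j / (4 C)]. *)
Lemma tower_zero : (forall n, dl n 0 = 0) -> forall n r, 0 <= r <= r1 -> dl n r = 0.
Proof.
move=> Z.
have key j : forall r, 0 <= r <= r1 -> r ^+ 2 / 2 <= j%:R / (4 * C) -> forall n, dl n r = 0.
  elim: j => [|j IH] r /andP [h1 h2] hr.
    apply: (@tower_zero_step 0) => //; first by rewrite h1.
    rewrite expr0n subr0; apply: le_trans hr _; rewrite mul0r invr_ge0 mulr_ge0 //; exact: ltW.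
  have [small|big] := leP (r ^+ 2 / 2) (j%:R / (4 * C)); first by apply: IH; rewrite ?h1.
  pose rho := Num.sqrt (j%:R / (2 * C)).
  have q0 : 0 <= j%:R / (2 * C) by rewrite divr_ge0 // mulr_ge0 // ltW.
  have rho2 : rho ^+ 2 = j%:R / (2 * C) by rewrite sqr_sqrtr.
  have E : rho ^+ 2 / 2 = j%:R / (4 * C) by rewrite rho2; field; rewrite gt_eqF.
  have rhor : rho <= r.
    by rewrite -ler_sqr ?nnegrE ?sqrtr_ge0 //; lra.
  apply: (@tower_zero_step rho); rewrite ?sqrtr_ge0 ?rhor //.
    by apply: IH; rewrite ?E ?sqrtr_ge0 //=; lra.
  have J : j.+1%:R / (4 * C) = j%:R / (4 * C) + (4 * C)^-1 by rewrite -natr1 mulrDl mul1r.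
  move: hr; rewrite J -E; lra.
move=> n r hr; have [j hj] : exists j : nat, r ^+ 2 / 2 * (4 * C) <= j%:R.
  exists (Num.truncn (r ^+ 2 / 2 * (4 * C))).+1.
  by apply/ltW/truncnS_gt.
apply: (key j r hr); rewrite ler_pdivlMr // mulr_gt0 //.
Qed.

End Identity.

(** Summation by parts: the weighted sum is a convex combination of partial sums, with weights
    [(1 - x) x ^+ j] and a last weight [x ^+ m]. *)
Lemma abel_bound (b : nat -> R) (x E : R) : 0 <= x <= 1 ->
  (forall m, `|\sum_(j < m) b j| <= E) -> forall m, `|\sum_(j < m) b j * x ^+ j| <= E.
Proof.
move=> /andP [x0 x1] H [|m]; first by rewrite big_ord0 normr0; apply: le_trans (H 0%N).
pose S m := \sum_(j < m) b j.
have P : \sum_(j < m.+1) b j * x ^+ j = (1 - x) * (\sum_(j < m) S j.+1 * x ^+ j) + S m.+1 * x ^+ m.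
  elim: m => [|m IH]; first by rewrite big_ord0 mulr0 add0r /S !big_ord1.
  rewrite big_ord_recr /= IH [in RHS]big_ord_recr /=.
  have -> : S m.+2 = S m.+1 + b m.+1 by rewrite /S big_ord_recr.
  by rewrite exprS; ring.
rewrite P; apply: le_trans (ler_normD _ _) _.
have -> : E = (1 - x) * (\sum_(j < m) E * x ^+ j) + E * x ^+ m.
  elim: m {P} => [|m IH]; first by rewrite big_ord0 mulr0 expr0 mulr1 add0r.
  by rewrite big_ord_recr /= {1}IH exprS; ring.
apply: lerD.
  rewrite normrM ger0_norm ?subr_ge0 // ler_wpM2l ?subr_ge0 //.
  apply: le_trans (ler_norm_sum _ _ _) _; apply: ler_sum => j _.
  by rewrite normrM [`|x ^+ _|]ger0_norm ?exprn_ge0 // ler_wpM2r ?exprn_ge0 //; exact: H.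
by rewrite normrM [`|x ^+ _|]ger0_norm ?exprn_ge0 // ler_wpM2r ?exprn_ge0 //; exact: H.
Qed.

(** Abel's theorem: an initial polynomial is continuous at 1, and [abel_bound] controls all tails
    uniformly in [x]. *)
Lemma abel_limit (b : nat -> R) (l e : R) : series b @ \oo --> l -> 0 < e ->
  exists2 d : R, 0 < d & forall x s, 1 - d < x < 1 ->
    series (fun k => b k * x ^+ k) @ \oo --> s -> `|s - l| <= e.
Proof.
move=> bl e0; have e60 : 0 < e / 6 by rewrite divr_gt0.
have serE (u : nat -> R) m : series u m = \sum_(j < m) u j by rewrite /series /= big_mkord.
have [k0 Hk0] : exists k0, forall k, (k0 <= k)%N -> `|series b k - l| <= e / 6.
  have /cvgrPdist_le /(_ _ e60) [k0 _ H] := bl.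
  by exists k0 => k hk; rewrite distrC; exact: H.
pose P (x : R) := \sum_(j < k0) b j * x ^+ j.
have Pc : contAt P 1.
  apply: contAt_sum => j _; apply: contAtM; first exact: contAt_cst.
  exact: isD_cont1 (isDX j 1).
have [d d0 Hd] := Pc (e / 6) e60.
exists (Num.min d 1); first by rewrite lt_min d0 ltr01.
move=> x s /andP [x1 x2] xs.
have xd : `|x - 1| < d.
  have h : Num.min d 1 <= d by rewrite ge_min lexx.
  by rewrite ltr_norml; lra.
have x0 : 0 <= x <= 1.
  have h : Num.min d 1 <= 1 by rewrite ge_min lexx orbT.
  lra.
have P1 : P 1 = series b k0 by rewrite serE; apply: eq_bigr => j _; rewrite expr1n mulr1.
have tail m : `|\sum_(j < m) b (k0 + j)%N * x ^+ j| <= e / 3.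
  apply: (@abel_bound (fun j => b (k0 + j)%N) x _ x0) => {}m.
  have -> : \sum_(j < m) b (k0 + j)%N = series b (k0 + m)%N - series b k0.
    by rewrite !serE big_split_ord /= addrAC subrr add0r.
  have := Hk0 (k0 + m)%N (leq_addr _ _); have := Hk0 k0 (leqnn _); rewrite !ler_norml; lra.
have bound m : `|series (fun k => b k * x ^+ k) (k0 + m)%N - l| <= e.
  have -> : series (fun k => b k * x ^+ k) (k0 + m)%N = P x + x ^+ k0 * \sum_(j < m) b (k0 + j)%N * x ^+ j.
    by rewrite serE big_split_ord /= mulr_sumr; congr (_ + _); apply: eq_bigr => j _; rewrite exprD; ring.
  have h1 := Hd x xd; rewrite P1 in h1.
  have h2 := Hk0 k0 (leqnn _).
  have h3 : `|x ^+ k0 * \sum_(j < m) b (k0 + j)%N * x ^+ j| <= e / 3.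
    case/andP: x0 => x0 x0'; rewrite normrM ger0_norm ?exprn_ge0 //; apply: le_trans (tail m).
    by rewrite ler_piMl // exprn_ile1.
  move: h1 h2 h3; rewrite !ler_norml; lra.
have cv : (fun n => `|series (fun k => b k * x ^+ k) n - l|) @ \oo --> `|s - l|.
  by apply: cvg_norm; apply: cvgB => //; exact: cvg_cst.
rewrite -(cvg_lim _ cv) //; apply: limr_le; first by apply/cvg_ex; exists `|s - l|.
near=> n; have kn : (k0 <= n)%N by near: n; exact: nbhs_infty_ge.
by rewrite -(subnKC kn); exact: bound.
Unshelve. all: by end_near. Qed.

Section PowerSeriesTower.
Variables (a : nat -> R) (t0 : R).
Hypothesis t00 : 0 < t0.
Hypothesis acv : cvgn (series (fun k => a k / k`!%:R * t0 ^+ k)).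

Let c (n k : nat) : R := a (n + k)%N / k`!%:R.
(** The n-th derivative of the sum of [a_k t^k / k!]. *)
Let P (n : nat) (t : R) : R := limn (pseries (c n) t).

(** Convergence at [t0] bounds the terms there by some [B]. With [x = t1 / t0], the terms of the
    n-th derivative are then dominated by [B n! / t0^n] times those of the negative binomial series
    in [x]. *)
Lemma tower_series_bounds : exists2 B : R, 0 <= B & forall n t t1, `|t| <= t1 -> t1 < t0 ->
  cvgn (pseries (c n) t) /\ `|P n t| <= B / (1 - t1 / t0) * (t0 * (1 - t1 / t0))^-1 ^+ n * n`!%:R.
Proof.
have [B B0 HB] : exists2 B : R, 0 <= B & forall k, `|a k / k`!%:R * t0 ^+ k| <= B.
  have := cvg_series_cvg_0 acv => /cvgP /cvg_seq_bounded [B [Br HB]].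
  exists (`|B| + 1); first by rewrite addr_ge0.
  move=> k; apply: (HB (`|B| + 1)) => //.
  by apply: le_lt_trans (ler_norm _) _; rewrite ltrDl.
exists B => // n t t1 tt1 t10.
have t1p : 0 <= t1 by apply: le_trans tt1.
pose x := t1 / t0.
have x01 : 0 <= x < 1 by rewrite divr_ge0 ?(ltW t00) //= ltr_pdivrMr // mul1r.
have y0 : 0 < 1 - x by lra.
have term k : `|c n k * t ^+ k| <= B * n`!%:R / t0 ^+ n * ('C(n + k, k)%:R * x ^+ k).
  have fk : k`!%:R != 0 :> R by rewrite pnatr_eq0 -lt0n fact_gt0.
  have fnk : (n + k)`!%:R != 0 :> R by rewrite pnatr_eq0 -lt0n fact_gt0.
  have fE : (n + k)`!%:R = 'C(n + k, k)%:R * k`!%:R * n`!%:R :> R.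
    by rewrite -!natrM -(bin_fact (leq_addl n k)) addnK mulnA.
  have -> : B * n`!%:R / t0 ^+ n * ('C(n + k, k)%:R * x ^+ k) = B * ((n + k)`!%:R / (k`!%:R * t0 ^+ (n + k)) * t1 ^+ k).
    by rewrite fE /x exprMn exprVn exprD; field; rewrite !expf_neq0 ?gt_eqF //= fk.
  have -> : c n k * t ^+ k = (a (n + k)%N / (n + k)`!%:R * t0 ^+ (n + k)) * ((n + k)`!%:R / (k`!%:R * t0 ^+ (n + k)) * t ^+ k).
    rewrite /c exprD; field; rewrite !expf_neq0 ?gt_eqF //= fk fnk //.
  rewrite normrM; apply: ler_pM => //.
  have q0 : 0 <= (n + k)`!%:R / (k`!%:R * t0 ^+ (n + k)) by rewrite divr_ge0 ?mulr_ge0 ?exprn_ge0 ?(ltW t00).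
  rewrite normrM (ger0_norm q0) ler_wpM2l // normrX lerXn2r ?nnegrE //.
have D0 : 0 <= B * n`!%:R / t0 ^+ n by rewrite divr_ge0 ?mulr_ge0 ?exprn_ge0 // ltW.
have part K : \sum_(k < K) `|c n k * t ^+ k| <= B / (1 - x) * (t0 * (1 - x))^-1 ^+ n * n`!%:R.
  apply: (@le_trans _ _ (\sum_(k < K) B * n`!%:R / t0 ^+ n * ('C(n + k, k)%:R * x ^+ k))).
    by apply: ler_sum => i _; exact: term.
  rewrite -mulr_sumr.
  have -> : B / (1 - x) * (t0 * (1 - x))^-1 ^+ n * n`!%:R = B * n`!%:R / t0 ^+ n * ((1 - x) ^+ n.+1)^-1.
    by rewrite exprVn exprMn exprS; field; rewrite ?expf_neq0 ?gt_eqF.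
  rewrite ler_wpM2l // -[leRHS]mul1r ler_pdivlMr ?exprn_gt0 // mulrC; exact: negative_binomial_sum.
have ncv : cvgn (series (fun k => `|c n k * t ^+ k|)).
  apply: nondecreasing_is_cvgn.
    by apply/nondecreasing_seqP => m; rewrite /series /= big_nat_recr //= lerDl.
  exists (B / (1 - x) * (t0 * (1 - x))^-1 ^+ n * n`!%:R) => _ [m _ <-].
  by rewrite /series /= big_mkord.
split; first exact: normed_cvg.
apply: le_trans (lim_series_norm ncv) _; apply: limr_le => //.
apply: nearW => m; have := part m.
by rewrite -(big_mkord xpredT (fun k => `|c n k * t ^+ k|)).
Qed.

Lemma tower_series_derive n t : 0 <= t < t0 -> isD (P n) t 1 (P n.+1 t).
Proof.
move=> /andP [tp tt]; have [B B0 HB] := tower_series_bounds.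
pose K := (t + t0) / 2.
have K0 : 0 <= K by rewrite /K; lra.
have Kt : K < t0 by rewrite /K; lra.
have cv m : cvgn (pseries (c m) K).
  have nK : `|K| <= K by rewrite ger0_norm.
  by have [] := HB m K K nK Kt.
have dE m : pseries_diffs (c m) = c m.+1.
  apply/funext => k; rewrite /pseries_diffs /c addSn addnS factS natrM; field.
  by rewrite addrC natr1 !pnatr_eq0 -!lt0n fact_gt0.
have := @pseries_snd_diffs R (c n) K t; rewrite !dE => H.
by apply/isDP; apply: H => //; rewrite !ger0_norm // /K; lra.
Qed.

End PowerSeriesTower.

(** On every shorter interval, the tower [g] minus the tower of its power series vanishes at 0 with
    factorial bounds, so [tower_zero] applies. Those bounds on the power series blow up towards
    [r0], so the end point is handled by a limit. *)
Lemma tower_sum_scalar (g : nat -> R -> R) (r0 M C : R) : 0 <= r0 -> 0 < C ->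
  (forall n r, 0 <= r <= r0 -> isD (g n) r 1 (r * g n.+1 r)) ->
  (forall n r, 0 <= r <= r0 -> `|g n r| <= M * C ^+ n * n`!%:R) ->
  cvgn (series (fun k => g k 0 / k`!%:R * (r0 ^+ 2 / 2) ^+ k)) ->
  series (fun k => g k 0 / k`!%:R * (r0 ^+ 2 / 2) ^+ k) @ \oo --> g 0%N r0.
Proof.
move=> r00 C0 gD gB; move: r00; rewrite le_eqVlt => /predU1P [r0E _|r0p cv].
  rewrite -r0E; apply: cvg_near_cst; near=> n.
  have n0 : (0 < n)%N by near: n; exact: nbhs_infty_gt.
  rewrite -(prednK n0) /series /= big_nat_recl //= big1 => [|i _].
    by rewrite expr0 mulr1 fact0 divr1 addr0.
  by rewrite expr2 mulr0 mul0r exprS mul0r mulr0.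
pose a k := g k 0.
pose t0 := r0 ^+ 2 / 2.
have t0p : 0 < t0 by rewrite divr_gt0 // exprn_gt0.
pose P n t := limn (pseries (fun k => a (n + k)%N / k`!%:R) t).
have [B B0 HB] := @tower_series_bounds a t0 t0p cv.
have M0 : 0 <= M.
  have := gB 0%N 0; rewrite lexx (ltW r0p) => /(_ isT); rewrite expr0 !mulr1; exact: le_trans.
have eqn r1 : 0 <= r1 < r0 -> g 0%N r1 = P 0%N (r1 ^+ 2 / 2).
  move=> /andP [r10 r1r].
  pose t1 := r1 ^+ 2 / 2.
  have t10 : 0 <= t1 by rewrite divr_ge0 // sqr_ge0.
  have t1t : t1 < t0 by rewrite ltr_pM2r ?invr_gt0 // ltr_sqr ?nnegrE // ltW.
  pose y := 1 - t1 / t0.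
  have y0 : 0 < y by rewrite subr_gt0 ltr_pdivrMr // mul1r.
  pose C' := Num.max C (t0 * y)^-1.
  have C'0 : 0 < C' by rewrite lt_max C0.
  pose dl n r := g n r - P n (r ^+ 2 / 2).
  have rt r : 0 <= r <= r1 -> 0 <= r ^+ 2 / 2 <= t1.
    move=> /andP [h1 h2]; rewrite divr_ge0 ?sqr_ge0 //= ler_pM2r ?invr_gt0 // ler_sqr ?nnegrE //; lra.
  suff : dl 0%N r1 = 0 by move/eqP; rewrite subr_eq0 => /eqP.
  apply: (@tower_zero dl r1 (M + B / y) C' r10 C'0); last by rewrite r10 lexx.
  - move=> n r hr; have /andP [k1 k2] := rt r hr.
    rewrite /dl mulrBr; apply: isDB; first by apply: gD; lra.
    have D1 : isD (P n) (r ^+ 2 / 2) 1 (P n.+1 (r ^+ 2 / 2)).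
      by apply: (tower_series_derive t0p cv); rewrite k1 /=; lra.
    have D2 : isD (fun r : R => r ^+ 2 / 2) r 1 r.
      have := isDZ (2^-1) (isDX 2 r).
      have -> : 2^-1 *: (2%:R * r ^+ 2.-1) = r by rewrite /GRing.scale /= expr1; field.
      by congr isD; apply/funext => z; rewrite /GRing.scale /= mulrC.
    rewrite [r * _]mulrC; apply/isDP; move/isDP: D1 => D1; move/isDP: D2 => D2; exact: (@is_derive1_comp R (P n) (fun r : R => r ^+ 2 / 2) r _ _ D1 D2).
  - move=> n r hr; have /andP [k1 k2] := rt r hr.
    rewrite !mulrDl; apply: le_trans (ler_normB _ _) _; apply: lerD.
      apply: (@le_trans _ _ (M * C ^+ n * n`!%:R)); first by apply: gB; lra.
      rewrite ler_wpM2r // ler_wpM2l // lerXn2r ?nnegrE ?(ltW C0) ?(ltW C'0) //.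
      by rewrite le_max lexx.
    have k3 : `|r ^+ 2 / 2| <= t1 by rewrite ger0_norm.
    have [_ h] := HB n (r ^+ 2 / 2) t1 k3 t1t; apply: le_trans h _.
    rewrite -/y ler_wpM2r // ler_wpM2l ?divr_ge0 ?(ltW y0) // lerXn2r ?nnegrE ?invr_ge0 ?(ltW C'0) //.
      by rewrite mulr_ge0 ?(ltW y0) ?(ltW t0p).
    by rewrite le_max lexx orbT.
  - move=> n; rewrite /dl expr2 mulr0 mul0r; apply/eqP; rewrite subr_eq0; apply/eqP.
    symmetry; apply/cvg_lim => //; apply: cvg_near_cst; near=> m.
    have m0 : (0 < m)%N by near: m; exact: nbhs_infty_gt.
    rewrite -(prednK m0) /pseries /series /= big_nat_recl //= big1 => [|i _].
      by rewrite expr0 mulr1 fact0 divr1 addr0 addn0.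
    by rewrite exprS mul0r mulr0.
(* Abel's theorem at the endpoint *)
pose b k := a k / k`!%:R * t0 ^+ k.
have /cvg_ex [/= l bl] := cv.
rewrite -/a -/t0 in bl *.
suff -> : g 0%N r0 = l by exact: bl.
apply/eqP; rewrite -subr_eq0 -normr_le0; apply/ler_addgt0Pr => e e0; rewrite add0r.
have e20 : 0 < e / 2 by rewrite divr_gt0.
have [d d0 Hd] := abel_limit bl e20.
have r00 : 0 <= r0 <= r0 by rewrite lexx ltW.
have [d' d'0 Hd'] := isD_cont1 (gD 0%N r0 r00) e20.
(* This radius forces [x = (r / r0) ^+ 2] into the interval where [abel_limit] applies. *)
have [d'' d''0 Hd''] := isD_cont1 (isDX 2 r0) (divr_gt0 (mulr_gt0 d0 (exprn_gt0 2 r0p)) (ltr0Sn R 1)).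
pose m := Num.min r0 (Num.min d' d'').
have m0 : 0 < m by rewrite !lt_min r0p d'0.
pose r := r0 - m / 2.
have /andP [mr /andP [md' md'']] : (m <= r0) && ((m <= d') && (m <= d'')) by rewrite /m !ge_min !lexx !orbT.
have rr : 0 <= r < r0 by rewrite /r; lra.
have /andP [rp rlt] := rr.
have rd : `|r - r0| = m / 2 by rewrite /r addrAC subrr add0r normrN gtr0_norm // divr_gt0.
have k1 : `|g 0%N r - g 0%N r0| <= e / 2 by apply: Hd'; rewrite rd; lra.
have k2 : `|r ^+ 2 - r0 ^+ 2| <= d * r0 ^+ 2 / 2 by apply: Hd''; rewrite rd; lra.
pose x := (r / r0) ^+ 2.
have xE : r ^+ 2 / 2 = x * t0 by rewrite /x /t0; field; rewrite gt_eqF.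
have x1 : x < 1.
  by rewrite expr_lt1 // ?divr_ge0 ?(ltW r0p) // ltr_pdivrMr // mul1r.
have x2 : 1 - d < x.
  have r02 : 0 < r0 ^+ 2 by rewrite exprn_gt0.
  have : d * r0 ^+ 2 / 2 < d * r0 ^+ 2 by rewrite ltr_pdivrMr // ltr_pMr ?mulr_gt0 // ltr1n.
  have xx : x * r0 ^+ 2 = r ^+ 2 by rewrite /x; field; rewrite gt_eqF.
  move=> hdr; rewrite -(ltr_pM2r r02) xx mulrBl mul1r.
  by move: k2; rewrite ler_norml; lra.
have x12 : 1 - d < x < 1 by rewrite x2.
have k3 : `|g 0%N r - l| <= e / 2.
  apply: (Hd x _ x12); rewrite (eqn r rr).
  have t1 : r ^+ 2 / 2 < t0 by rewrite ltr_pM2r ?invr_gt0 // ltr_sqr ?nnegrE // ltW.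
  have tp : 0 <= r ^+ 2 / 2 by rewrite divr_ge0 // sqr_ge0.
  have tn : `|r ^+ 2 / 2| <= r ^+ 2 / 2 by rewrite ger0_norm.
  have [cvP _] := HB 0%N (r ^+ 2 / 2) (r ^+ 2 / 2) tn t1.
  have -> : series (fun k => b k * x ^+ k) = pseries (fun k => a (0 + k)%N / k`!%:R) (r ^+ 2 / 2).
    by apply/funext => k; rewrite /pseries /series /=; apply: eq_bigr => i _; rewrite /b xE [(x * t0) ^+ _]exprMn add0n -[LHS]mulrA [t0 ^+ _ * _]mulrC.
  exact: cvP.
move: k1 k3; rewrite !ler_norml; lra.
Unshelve. all: by end_near. Qed.

End AnalyticTowers.

(** * Smooth functions on open sets *)

Section SmoothFunctions.
Variables (R : realType) (N n : nat).
Local Notation pt := 'rV[R]_N.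
Local Notation val := 'rV[R]_n.
Variable U : set pt.
Hypothesis Uopen : forall x, U x -> exists2 r : R, 0 < r & forall y, `|y - x| < r -> U y.
Implicit Types (f g : pt -> val).

Definition pd (i : 'I_N) f : pt -> val := 'D_(delta_mx 0 i : pt) f.

Fixpoint Ck (k : nat) f : Prop :=
  (forall x, U x -> contAt f x) /\
  if k is k'.+1 then forall i, (forall x, U x -> derivable f x (delta_mx 0 i : pt)) /\ Ck k' (pd i f)
  else True.

Definition smooth f := forall k, Ck k f.

Lemma Ck_cont k f x : Ck k f -> U x -> contAt f x.
Proof. by case: k => [|k] [H _]; exact: H. Qed.

Lemma CkS k f : Ck k.+1 f -> Ck k f.
Proof.
elim: k f => [|k IH] f [c H]; split=> // i.
by have [h1 h2] := H i; split=> //; exact: IH.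
Qed.

Lemma Ck_isD k f i x : Ck k.+1 f -> U x -> isD f x (delta_mx 0 i : pt) (pd i f x).
Proof. by move=> [_ /(_ i) [D _]] /D; exact: derivable_isD. Qed.

Lemma Ck_pd k f i : Ck k.+1 f -> Ck k (pd i f).
Proof. by move=> [_ /(_ i) []]. Qed.

Lemma CkI k f (df : 'I_N -> pt -> val) : (forall x, U x -> contAt f x) ->
  (forall i x, U x -> isD f x (delta_mx 0 i : pt) (df i x)) ->
  (forall i, Ck k (pd i f)) -> Ck k.+1 f.
Proof.
move=> c D H; split=> // i; split=> // x Ux; exact: isD_derivable (D i x Ux).
Qed.

(** The quotients agree for small steps, hence so do their limits, whether or not a derivative
    exists. *)
Lemma eq_on_pd f g i x : (forall y, U y -> f y = g y) -> U x -> pd i f x = pd i g x.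
Proof.
move=> E /Uopen [r r0 Hr]; rewrite /pd /derive.
have nr : \forall h \near (0 : R)^', `|h| < r by exact: dnbhs0_lt.
congr (lim _); rewrite eqEsubset; split.
  apply: near_eq_cvg; near=> h.
  have hr : `|h| < r by near: h.
  rewrite /= E ?(E x) //; first by apply: Hr; rewrite subrr normr0.
  by apply: Hr; rewrite [h *: _ + x]addrC; exact: le_lt_trans (line_close _ _ _) hr.
apply: near_eq_cvg; near=> h.
have hr : `|h| < r by near: h.
rewrite /= E ?(E x) //; first by apply: Hr; rewrite subrr normr0.
by apply: Hr; rewrite [h *: _ + x]addrC; exact: le_lt_trans (line_close _ _ _) hr.
Unshelve. all: by end_near. Qed.

Lemma isD_pd f i x d : isD f x (delta_mx 0 i : pt) d -> pd i f x = d.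
Proof. exact: isD_derive. Qed.

Lemma isD_eq_on f g v x d : (forall y, U y -> f y = g y) -> U x -> isD f x v d -> isD g x v d.
Proof. by move=> E /Uopen [r r0 Hr]; apply: (isD_near r0) => y /Hr /E. Qed.

Lemma Ck_eq_on k f g : (forall y, U y -> f y = g y) -> Ck k f -> Ck k g.
Proof.
elim: k f g => [|k IH] f g E.
  by move=> [c _]; split=> // x Ux; have [r r0 Hr] := Uopen Ux; apply: (contAt_near r0) (c x Ux) => y /Hr /E.
move=> Cf; apply: (CkI (df := fun i => pd i f)).
- move=> x Ux; have [r r0 Hr] := Uopen Ux.
  by apply: (contAt_near r0) (Ck_cont Cf Ux) => y /Hr /E.
- by move=> i x Ux; apply: (isD_eq_on E Ux); exact: (Ck_isD i Cf Ux).
- by move=> i; apply: IH (Ck_pd i Cf) => y Uy; exact: eq_on_pd.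
Qed.

Lemma CkD k f g : Ck k f -> Ck k g -> Ck k (fun x => f x + g x).
Proof.
elim: k f g => [|k IH] f g Cf Cg.
  by split=> // x Ux; apply: contAtD; [exact: Ck_cont Cf Ux|exact: Ck_cont Cg Ux].
have D i x : U x -> isD (fun x => f x + g x) x (delta_mx 0 i : pt) (pd i f x + pd i g x).
  by move=> Ux; apply: isDD; [exact: (Ck_isD i Cf Ux)|exact: (Ck_isD i Cg Ux)].
apply: (CkI (df := fun i x => pd i f x + pd i g x)) => //.
  by move=> x Ux; apply: contAtD; [exact: Ck_cont Cf Ux|exact: Ck_cont Cg Ux].
move=> i; apply: (@Ck_eq_on _ (fun x => pd i f x + pd i g x)).
  by move=> y Uy; rewrite (isD_pd (D i y Uy)).
by apply: IH; exact: Ck_pd.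
Qed.

Lemma CkZ k (a : R) f : Ck k f -> Ck k (fun x => a *: f x).
Proof.
elim: k f => [|k IH] f Cf.
  by split=> // x Ux; apply: contAtZ; exact: Ck_cont Cf Ux.
have D i x : U x -> isD (fun x => a *: f x) x (delta_mx 0 i : pt) (a *: pd i f x).
  by move=> Ux; apply: isDZ; exact: (Ck_isD i Cf Ux).
apply: (CkI (df := fun i x => a *: pd i f x)) => //.
  by move=> x Ux; apply: contAtZ; exact: Ck_cont Cf Ux.
move=> i; apply: (@Ck_eq_on _ (fun x => a *: pd i f x)).
  by move=> y Uy; rewrite (isD_pd (D i y Uy)).
by apply: IH; exact: Ck_pd.
Qed.

Lemma Ck_mulmx k (M : 'M[R]_n) f : Ck k f -> Ck k (fun x => f x *m M).
Proof.
elim: k f => [|k IH] f Cf.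
  by split=> // x Ux; apply: contAt_mulmx; exact: Ck_cont Cf Ux.
have D i x : U x -> isD (fun x => f x *m M) x (delta_mx 0 i : pt) (pd i f x *m M).
  by move=> Ux; apply: isD_mulmx; exact: (Ck_isD i Cf Ux).
apply: (CkI (df := fun i x => pd i f x *m M)) => //.
  by move=> x Ux; apply: contAt_mulmx; exact: Ck_cont Cf Ux.
move=> i; apply: (@Ck_eq_on _ (fun x => pd i f x *m M)).
  by move=> y Uy; rewrite (isD_pd (D i y Uy)).
by apply: IH; exact: Ck_pd.
Qed.

Lemma Ck_cst0 k : Ck k (fun=> 0).
Proof.
elim: k => [|k IH]; first by split=> // x _; exact: contAt_cst.
apply: (CkI (df := fun i x => 0)).
- by move=> x _; exact: contAt_cst.
- by move=> i x _; exact: isD_cst.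
- move=> i; apply: (@Ck_eq_on _ (fun=> 0)) => // y _.
  by rewrite (isD_pd (isD_cst _ _ _)).
Qed.

Lemma Ck_sum (I : Type) (s : seq I) (P : pred I) (F : I -> pt -> val) k : (forall i, P i -> Ck k (F i)) ->
  Ck k (fun x => \sum_(i <- s | P i) F i x).
Proof.
move=> H; elim: s => [|i s IH].
  by under eq_fun do rewrite big_nil; exact: Ck_cst0.
under eq_fun do rewrite big_cons.
by case: (boolP (P i)) => Pi //; apply: (CkD _ IH); exact: H.
Qed.

Lemma smooth_cont f x : smooth f -> U x -> contAt f x.
Proof. by move=> /(_ 0%N); exact: Ck_cont. Qed.

Lemma smooth_isD f i x : smooth f -> U x -> isD f x (delta_mx 0 i : pt) (pd i f x).
Proof. by move=> /(_ 1%N) Cf Ux; exact: (Ck_isD i Cf Ux). Qed.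

Lemma smooth_pd f i : smooth f -> smooth (pd i f).
Proof. by move=> Cf k; exact: Ck_pd. Qed.

Lemma smooth_D f g : smooth f -> smooth g -> smooth (fun x => f x + g x).
Proof. by move=> Cf Cg k; exact: CkD. Qed.

Lemma smooth_Z (a : R) f : smooth f -> smooth (fun x => a *: f x).
Proof. by move=> Cf k; exact: CkZ. Qed.

Lemma smooth_mulmx M f : smooth f -> smooth (fun x => f x *m M).
Proof. by move=> Cf k; exact: Ck_mulmx. Qed.

Lemma smooth_sum (I : Type) (s : seq I) (P : pred I) (F : I -> pt -> val) : (forall i, P i -> smooth (F i)) ->
  smooth (fun x => \sum_(i <- s | P i) F i x).
Proof. by move=> H k; apply: Ck_sum => i Pi; exact: H. Qed.

Lemma pdC f i j x : smooth f -> U x -> pd i (pd j f) x = pd j (pd i f) x.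
Proof.
move=> Sf Ux; have [r r0 Hr] := Uopen Ux.
have co g l k y : smooth g -> U y ->
    isD (fun x => g x ord0 k) y (delta_mx 0 l : pt) (pd l g y ord0 k).
  by move=> Sg Uy; have /isD_coord := smooth_isD l Sg Uy; exact.
apply/rowP => k.
apply: (@schwarz_scalar R N (fun x => f x ord0 k) j i (fun x => pd j f x ord0 k)
   (fun x => pd i f x ord0 k) (fun x => pd i (pd j f) x ord0 k) (fun x => pd j (pd i f) x ord0 k) x r r0).
- by move=> y /Hr; exact: co.
- by move=> y /Hr; exact: co.
- by move=> y /Hr; apply: co; exact: smooth_pd.
- by move=> y /Hr; apply: co; exact: smooth_pd.
- by have /contAt_coord := smooth_cont (smooth_pd i (smooth_pd j Sf)) Ux; exact.
- by have /contAt_coord := smooth_cont (smooth_pd j (smooth_pd i Sf)) Ux; exact.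
Qed.

Lemma pdD f g i x : smooth f -> smooth g -> U x -> pd i (fun y => f y + g y) x = pd i f x + pd i g x.
Proof. by move=> Sf Sg Ux; apply: isD_pd; apply: isDD; exact: smooth_isD. Qed.

Lemma pdZ (a : R) f i x : smooth f -> U x -> pd i (fun y => a *: f y) x = a *: pd i f x.
Proof. by move=> Sf Ux; apply: isD_pd; apply: isDZ; exact: smooth_isD. Qed.

Lemma pd_mulmx (M : 'M[R]_n) f i x : smooth f -> U x -> pd i (fun y => f y *m M) x = pd i f x *m M.
Proof. by move=> Sf Ux; apply: isD_pd; apply: isD_mulmx; exact: smooth_isD. Qed.

Lemma pd_sum (I : Type) (s : seq I) (P : pred I) (F : I -> pt -> val) i x :
  (forall k, P k -> smooth (F k)) -> U x ->
  pd i (fun y => \sum_(k <- s | P k) F k y) x = \sum_(k <- s | P k) pd i (F k) x.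
Proof. by move=> H Ux; apply: isD_pd; apply: isD_sum => k /H Sk; exact: smooth_isD. Qed.

Definition harmonic_val f := forall k, harmonic_on U (fun x => f x ord0 k).

Lemma harmonic_val_pd f i : harmonic_val f -> harmonic_val (pd i f).
Proof.
move=> H k; have [D Hd] := harmonic_on_derive Uopen i (H k).
apply: harmonic_on_ext Hd => x Ux; rewrite /pd derive_mx ?mxE //.
apply/derivable_mxP => a b; rewrite (ord1 a); exact: (harmonic_on_derive Uopen i (H b)).1.
Qed.

(** Partial derivatives are again harmonic on [U], so every order follows by induction over all
    harmonic functions at once. *)
Lemma harmonic_val_smooth f : harmonic_val f -> smooth f.
Proof.
move=> H k; elim: k f H => [|k IH] f H.
  by split=> // x Ux; apply/contAt_coord => j; exact: (harmonic_on_cont Uopen (H j) Ux).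
split.
  by move=> x Ux; apply/contAt_coord => j; exact: (harmonic_on_cont Uopen (H j) Ux).
move=> i; split; last by apply: IH; exact: harmonic_val_pd.
move=> x Ux; apply/derivable_mxP => a b; rewrite (ord1 a); exact: (harmonic_on_derive Uopen i (H b)).1.
Qed.

Lemma harmonic_val_D f g : harmonic_val f -> harmonic_val g -> harmonic_val (fun x => f x + g x).
Proof.
move=> Hf Hg k; apply: harmonic_on_ext (harmonic_onD (Hf k) (Hg k)) => x _.
by rewrite mxE.
Qed.

Lemma harmonic_val_Z (a : R) f : harmonic_val f -> harmonic_val (fun x => a *: f x).
Proof. by move=> Hf k; apply: harmonic_on_ext (harmonic_onZ a (Hf k)) => x _; rewrite mxE. Qed.

Lemma harmonic_on0 : harmonic_on U (fun=> 0).
Proof.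
move=> a rho rho' _ _; apply: harm2_approxH; exists (fun _ _ => 0), (fun _ _ => 0) => x _.
split=> *; try exact: contAt_cst; try exact: isD_cst.
by rewrite big1.
Qed.

Lemma harmonic_on_sum (I : Type) (s : seq I) (F : I -> pt -> R) : (forall i, harmonic_on U (F i)) ->
  harmonic_on U (fun x => \sum_(i <- s) F i x).
Proof.
move=> H; elim: s => [|i s IH].
  by apply: harmonic_on_ext harmonic_on0 => x _; rewrite big_nil.
by apply: harmonic_on_ext (harmonic_onD (H i) IH) => x _; rewrite big_cons.
Qed.

Lemma harmonic_val_mulmx (M : 'M[R]_n) f : harmonic_val f -> harmonic_val (fun x => f x *m M).
Proof.
move=> Hf k; apply: harmonic_on_ext (harmonic_on_sum (index_enum _) (fun j => harmonic_onZ (M j k) (Hf j))).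
by move=> x _; rewrite mxE; apply: eq_bigr => j _; rewrite mulrC.
Qed.

Lemma harmonic_val_sum (I : Type) (s : seq I) (P : pred I) (F : I -> pt -> val) :
  (forall i, P i -> harmonic_val (F i)) -> harmonic_val (fun x => \sum_(i <- s | P i) F i x).
Proof.
move=> H; elim: s => [|i s IH].
  under eq_fun do rewrite big_nil.
  by move=> k; apply: harmonic_on_ext harmonic_on0 => x _; rewrite mxE.
under eq_fun do rewrite big_cons.
by case: (boolP (P i)) => Pi //; apply: (harmonic_val_D _ IH); exact: H.
Qed.

End SmoothFunctions.

(** * Averages and the radial derivative *)

Section RadialOperators.
Variables (R : realType) (N n : nat) (l : 'I_N).
Local Notation pt := 'rV[R]_N.
Local Notation val := 'rV[R]_n.
Local Notation e_ i := (delta_mx 0 i : pt).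
Implicit Types (f g : pt -> val) (z x y : pt) (s t : R).

Definition sc (s : R) (z : pt) : pt := z + ((s - 1) * z ord0 l) *: e_ l.

Lemma scE s z k : sc s z ord0 k = (if k == l then s else 1) * z ord0 k.
Proof. by rewrite entryD; case: eqP => [->|_]; ring. Qed.

Lemma sc1 z : sc 1 z = z.
Proof. by rewrite /sc subrr mul0r scale0r addr0. Qed.

Lemma scM s t z : sc s (sc t z) = sc (s * t) z.
Proof. by apply/rowP => k; rewrite !scE; case: eqP => _; ring. Qed.

Lemma sc_fix s z : z ord0 l = 0 -> sc s z = z.
Proof. by move=> z0; rewrite /sc z0 mulr0 scale0r addr0. Qed.

Lemma sc_line s (z : pt) (h : R) i : sc s (z + h *: e_ i) = sc s z + h *: ((if i == l then s else 1) *: e_ i).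
Proof.
apply/rowP => k; rewrite scE [RHS]mxE scE !mxE /=.
have [->|kl] := eqVneq k l; have [E|il] := eqVneq i l.
- by rewrite mulr1n; ring.
- by rewrite mulr0n; ring.
- by rewrite E (negbTE kl) mulr0n; ring.
- by ring.
Qed.

Variable U : set pt.
Hypothesis Uopen : forall x, U x -> exists2 r : R, 0 < r & forall y, `|y - x| < r -> U y.
Hypothesis Usc : forall s z, -1 <= s <= 1 -> U z -> U (sc s z).

Local Notation pdv := (@pd R N n).
Local Notation Ckv := (@Ck R N n U).
Local Notation smth := (@smooth R N n U).

Lemma Usc01 s z : 0 <= s <= 1 -> U z -> U (sc s z).
Proof. by move=> h; apply: Usc; lra. Qed.

Lemma jcont_sc f c s z : contAt f (sc s z) -> jcont (fun s z => s ^+ c *: f (sc s z)) s z.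
Proof.
move=> cf; apply/jcontP; apply: contAtZf.
  apply: (@contAt_comp _ _ _ _ (fun t : R => t ^+ c) (fun p : R * pt => p.1) (s, z)); first exact: contAt_fst.
  exact: isD_cont1 (isDX c s).
apply: (@contAt_comp _ _ _ _ f (fun p : R * pt => sc p.1 p.2) (s, z) _ cf).
apply: contAtD; first exact: contAt_snd.
apply: contAtZf; last exact: contAt_cst.
apply: contAtM.
  by apply: contAtD; [exact: contAt_fst|exact: contAt_cst].
apply: (@contAt_comp _ _ _ _ (fun z : pt => z ord0 l) (fun p : R * pt => p.2) (s, z)); first exact: contAt_snd.
exact: contAt_entry.
Qed.

(** Weighted average over the segment from the slice [z_l = 0] to [z]. It solves the Euler equation
    [(c + 1) g + z_l dg/dz_l = f] without dividing by [z_l]; see [Avg_ode] and [pd_Avg]. *)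
Definition Avg (c : nat) f (z : pt) : val := vint (fun s => s ^+ c *: f (sc s z)).

Lemma Avg_contK c f z s : (forall x, U x -> contAt f x) -> U z -> 0 <= s <= 1 ->
  contAt (fun s => s ^+ c *: f (sc s z)) s.
Proof.
move=> cf Uz s01; apply: (@jcont_contAt _ _ _ (fun s z => s ^+ c *: f (sc s z))).
by apply: jcont_sc; apply/cf/Usc01.
Qed.

Lemma Avg_cont c f z : (forall x, U x -> contAt f x) -> U z -> contAt (Avg c f) z.
Proof.
move=> cf Uz; have [r r0 Hr] := Uopen Uz.
apply: (vint_param_cont (rho := r) (K := fun s z => s ^+ c *: f (sc s z)) r0).
by move=> y s /Hr Uy s01; apply: jcont_sc; apply/cf/Usc01.
Qed.

Lemma Avg_eq_on c f g z : (forall y, U y -> f y = g y) -> U z -> Avg c f z = Avg c g z.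
Proof. by move=> E Uz; apply: vint_eq => s s01; rewrite (E _ (Usc01 s01 Uz)). Qed.

(** The chain rule contributes a factor [s] exactly when [i = l]; the boolean added to the weight
    records it. *)
Lemma Avg_isD c f i z : Ckv 1 f -> U z ->
  isD (Avg c f) z (e_ i) (Avg (c + (i == l)) (pdv i f) z).
Proof.
move=> Cf Uz; have [r r0 Hr] := Uopen Uz.
have cf x : U x -> contAt f x by move=> Ux; exact: (Ck_cont Cf Ux).
have cdf x : U x -> contAt (pdv i f) x by exact: Ck_cont (Ck_pd i Cf).
apply: (vint_param_isD (rho := r) (K := fun s z => s ^+ c *: f (sc s z))
  (dK := fun s z => s ^+ (c + (i == l)) *: pdv i f (sc s z)) r0).
- by move=> y s /Hr Uy s01; apply: jcont_sc; apply/cf/Usc01.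
- by move=> y s /Hr Uy s01; apply: jcont_sc; apply/cdf/Usc01.
- move=> y s /Hr Uy s01.
  have -> : s ^+ (c + (i == l)) *: pdv i f (sc s y) = s ^+ c *: ((if i == l then s else 1) *: pdv i f (sc s y)).
    by rewrite exprD -scalerA; case: eqP => _; rewrite ?expr1 ?expr0.
  apply: isDZ; apply: (@isD_comp_lin _ _ _ _ f (sc s) y _ _ ((if i == l then s else 1) *: e_ i)).
    by move=> h; rewrite sc_line.
  by apply: isD_scaledir; apply: (Ck_isD i Cf); exact: Usc01.
Qed.

Lemma Ck_Avg k c f : Ckv k f -> Ckv k (Avg c f).
Proof.
elim: k c f => [|k IH] c f Cf.
  by split=> // z Uz; apply: Avg_cont => // x; exact: Ck_cont Cf.
have C1 : Ckv 1 f by elim: k Cf {IH} => // k IH /CkS.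
apply: (CkI (df := fun i => Avg (c + (i == l)) (pdv i f))).
- by move=> z Uz; apply: Avg_cont => // x; exact: Ck_cont Cf.
- by move=> i z Uz; exact: Avg_isD.
- move=> i; apply: (@Ck_eq_on _ _ _ _ Uopen _ (Avg (c + (i == l)) (pdv i f))); last exact/IH/Ck_pd.
  by move=> z Uz; rewrite (isD_pd (Avg_isD _ _ C1 Uz)).
Qed.

Lemma smooth_Avg c f : smth f -> smth (Avg c f).
Proof. by move=> Sf k; exact: Ck_Avg. Qed.

Lemma pd_Avg c f i z : smth f -> U z -> pdv i (Avg c f) z = Avg (c + (i == l)) (pdv i f) z.
Proof. by move=> Sf Uz; apply: isD_pd; apply: Avg_isD. Qed.

Lemma Avg_mulmx c (M : 'M[R]_n) f z : (forall x, U x -> contAt f x) -> U z ->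
  Avg c (fun x => f x *m M) z = Avg c f z *m M.
Proof.
move=> cf Uz; rewrite /Avg -vint_mulmx; last by move=> s s01; exact: Avg_contK.
by congr vint; apply/funext => s; rewrite scalemxAl.
Qed.

Lemma Avg_sum c (I : Type) (r : seq I) (F : I -> pt -> val) z :
  (forall i x, U x -> contAt (F i) x) -> U z ->
  Avg c (fun x => \sum_(i <- r) F i x) z = \sum_(i <- r) Avg c (F i) z.
Proof.
move=> cf Uz; rewrite /Avg -vint_sum; last by move=> i s s01; apply: Avg_contK => // x; exact: cf.
by congr vint; apply/funext => s; rewrite scaler_sumr.
Qed.

(** The gain [1 / c.+1] is the integral of the weight [s ^+ c]; its repeated use restores k! in the
    Cauchy bounds for iterates of [Trad]. *)
Lemma Avg_bound c f z (M : R) : (forall x, U x -> contAt f x) -> U z ->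
  (forall s, 0 <= s <= 1 -> `|f (sc s z)| <= M) -> `|Avg c f z| <= M / c.+1%:R.
Proof.
move=> cf Uz H.
apply: (@le_trans _ _ (M / c.+1%:R * 1 ^+ c.+1 - M / c.+1%:R * 0 ^+ c.+1)); last first.
  by rewrite expr1n exprS mul0r mulr0 subr0 mulr1.
apply: (@vint_le _ _ _ (fun s => M / c.+1%:R * s ^+ c.+1) (fun s => s ^+ c * M)).
- by move=> s s01; exact: Avg_contK.
- move=> s _; have := isDZ (M / c.+1%:R) (isDX c.+1 s).
  have -> : (M / c.+1%:R) *: (c.+1%:R * s ^+ c.+1.-1) = s ^+ c * M.
    by rewrite /GRing.scale /= mulrA divfK ?pnatr_eq0 // mulrC.
  by congr isD.
- move=> s s01; rewrite normrZ ger0_norm ?exprn_ge0 //; last by lra.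
  by rewrite ler_wpM2l ?exprn_ge0 //; [lra|exact: H].
Qed.

Lemma sc_isD f z s : smth f -> U z -> 0 <= s <= 1 ->
  isD (fun s => f (sc s z)) s 1 (z ord0 l *: pdv l f (sc s z)).
Proof.
move=> Sf Uz s01.
have E t : sc t z = sc 0 z + t *: (z ord0 l *: e_ l).
  apply/rowP => k; rewrite scE [RHS]mxE scE !mxE /=.
    by have [->|kl] := eqVneq k l; rewrite ?mulr1n ?mulr0n; ring.
have -> : (fun s => f (sc s z)) = (fun t => f (sc 0 z + t *: (z ord0 l *: e_ l))).
  by apply/funext => t; rewrite -E.
apply/isD_line; rewrite -E; apply: isD_scaledir; apply: smooth_isD => //; exact: Usc01.
Qed.

Lemma Avg_ode c f z : smth f -> U z -> c.+1%:R *: Avg c f z + z ord0 l *: Avg c.+1 (pdv l f) z = f z.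
Proof.
move=> Sf Uz; have cf x : U x -> contAt f x by exact: smooth_cont.
have cdf x : U x -> contAt (pdv l f) x by exact: smooth_cont (smooth_pd l Sf).
rewrite /Avg -!vintZ; first last.
- by move=> s s01; exact: Avg_contK.
- by move=> s s01; exact: Avg_contK.
rewrite -vintD; first last.
- by move=> s s01; apply: contAtZ; exact: Avg_contK.
- by move=> s s01; apply: contAtZ; exact: Avg_contK.
rewrite (@vint_prim _ _ _ (fun s => s ^+ c.+1 *: f (sc s z))).
  by rewrite expr1n scale1r exprS mul0r scale0r subr0 sc1.
move=> s s01; have := isDZf (isDX c.+1 s) (sc_isD Sf Uz s01).
by rewrite addrC !scalerA /= [z ord0 l * _]mulrC.
Qed.

Lemma Avg_radial f z : smth f -> U z -> f z - f (sc 0 z) = z ord0 l *: Avg 0 (pdv l f) z.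
Proof.
move=> Sf Uz; have cdf x : U x -> contAt (pdv l f) x by exact: smooth_cont (smooth_pd l Sf).
rewrite /Avg -!vintZ; last by move=> s s01; exact: Avg_contK.
rewrite (@vint_prim _ _ _ (fun s => f (sc s z))) ?sc1 // => s s01.
by rewrite expr0 scale1r; exact: sc_isD.
Qed.

Definition even_on f := forall z, U z -> f (sc (-1) z) = f z.
Definition odd_on f := forall z, U z -> f (sc (-1) z) = - f z.

Lemma UscN z : U z -> U (sc (-1) z).
Proof. by apply: Usc; lra. Qed.

Lemma pd_sign f i z (sg : R) : smth f -> (forall z, U z -> f (sc (-1) z) = sg *: f z) -> U z ->
  (if i == l then -1 else 1) *: pdv i f (sc (-1) z) = sg *: pdv i f z.
Proof.
move=> Sf H Uz.
have D1 : isD (fun z => f (sc (-1) z)) z (e_ i) ((if i == l then -1 else 1) *: pdv i f (sc (-1) z)).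
  apply: (@isD_comp_lin _ _ _ _ f (sc (-1)) z _ _ ((if i == l then -1 else 1) *: e_ i)).
    by move=> h; rewrite sc_line.
  by apply: isD_scaledir; apply: smooth_isD => //; exact: UscN.
have D2 : isD (fun z => sg *: f z) z (e_ i) (sg *: pdv i f z) by apply: isDZ; exact: smooth_isD Sf Uz.
have E y : U y -> sg *: f y = f (sc (-1) y) by move=> Uy; rewrite H.
exact: (isD_uniq D1 (isD_eq_on Uopen E Uz D2)).
Qed.

Lemma even_pd f i : i != l -> smth f -> even_on f -> even_on (pdv i f).
Proof.
move=> il Sf Ef z Uz; have := @pd_sign f i z 1 Sf _ Uz.
by rewrite (negbTE il) !scale1r; apply => y Uy; rewrite scale1r Ef.
Qed.

Lemma odd_pd_even f : smth f -> even_on f -> odd_on (pdv l f).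
Proof.
move=> Sf Ef z Uz; have := @pd_sign f l z 1 Sf _ Uz.
rewrite eqxx scale1r scaleN1r => <-; first by rewrite opprK.
by move=> y Uy; rewrite scale1r Ef.
Qed.

Lemma even_pd_odd f : smth f -> odd_on f -> even_on (pdv l f).
Proof.
move=> Sf Ef z Uz; have := @pd_sign f l z (-1) Sf _ Uz.
rewrite eqxx !scaleN1r => H; apply: oppr_inj; apply: H.
by move=> y Uy; rewrite scaleN1r Ef.
Qed.

Lemma odd_at0 f z : odd_on f -> U z -> z ord0 l = 0 -> f z = 0.
Proof.
move=> Of Uz z0; have := Of z Uz; rewrite sc_fix // => /eqP.
by rewrite -subr_eq0 opprK -mulr2n -scaler_nat scaler_eq0 pnatr_eq0 => /eqP.
Qed.

Lemma even_Avg c f : even_on f -> even_on (Avg c f).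
Proof.
move=> Ef z Uz; apply: vint_eq => s s01.
by rewrite scM mulrC -scM (Ef _ (Usc01 s01 Uz)).
Qed.

Lemma even_mulmx (M : 'M[R]_n) f : even_on f -> even_on (fun x => f x *m M).
Proof. by move=> Ef z Uz; rewrite Ef. Qed.

Lemma even_sum (I : Type) (r : seq I) (P : pred I) (F : I -> pt -> val) :
  (forall i, P i -> even_on (F i)) -> even_on (fun x => \sum_(i <- r | P i) F i x).
Proof. by move=> H z Uz; apply: eq_bigr => i Pi; exact: H. Qed.

Lemma sc0_l z : sc 0 z ord0 l = 0.
Proof. by rewrite scE eqxx mul0r. Qed.

(** Off the slice [z_l = 0] the factor can be divided out; every point of the slice is a limit of
    points off it, where continuity concludes. *)
Lemma cancel_radius f g : (forall x, U x -> contAt f x) -> (forall x, U x -> contAt g x) ->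
  (forall z, U z -> z ord0 l *: f z = z ord0 l *: g z) -> forall z, U z -> f z = g z.
Proof.
move=> cf cg H z Uz; have [z0|z0] := eqVneq (z ord0 l) 0; last first.
  by have /(congr1 (fun v => (z ord0 l)^-1 *: v)) := H z Uz; rewrite !scalerA mulVf // !scale1r.
apply/eqP; rewrite -subr_eq0 -normr_le0; apply/ler_addgt0Pr => e e0; rewrite add0r.
have [r r0 Hr] := Uopen Uz.
have e20 : 0 < e / 2 by rewrite divr_gt0.
have [r1 r10 H1] := cf z Uz _ e20; have [r2 r20 H2] := cg z Uz _ e20.
pose m := Num.min r (Num.min r1 r2).
have m0 : 0 < m by rewrite !lt_min r0 r10.
have /andP [mr /andP [mr1 mr2]] : (m <= r) && ((m <= r1) && (m <= r2)) by rewrite /m !ge_min !lexx !orbT.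
pose y := z + (m / 2) *: e_ l.
have ym : `|y - z| < m.
  apply: le_lt_trans (line_close _ _ _) _; rewrite gtr0_norm ?divr_gt0 //.
  by rewrite ltr_pdivrMr // ltr_pMr // ltr1n.
have yl : y ord0 l != 0 by rewrite entryD eqxx z0 add0r gt_eqF // divr_gt0.
have Uy : U y by apply: Hr; exact: lt_le_trans mr.
have E : f y = g y.
  by have /(congr1 (fun v => (y ord0 l)^-1 *: v)) := H y Uy; rewrite !scalerA mulVf // !scale1r.
have -> : f z - g z = (g y - g z) - (f y - f z) by rewrite E; apply/rowP => j; rewrite !mxE; ring.
apply: le_trans (ler_normB _ _) _; rewrite [e]splitr; apply: lerD.
  by apply: H2; exact: lt_le_trans mr2.
by apply: H1; exact: lt_le_trans mr1.
Qed.

(* For even [f] this is the derivative of [f] in [z_l] divided by [z_l], also at [z_l = 0]. *)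
Definition Trad f : pt -> val := Avg 0 (pdv l (pdv l f)).

Lemma smooth_Trad f : smth f -> smth (Trad f).
Proof. by move=> Sf; apply: smooth_Avg; do 2! apply: smooth_pd. Qed.

Lemma even_Trad f : smth f -> even_on f -> even_on (Trad f).
Proof.
move=> Sf Ef; apply: even_Avg; apply: even_pd_odd; first exact: smooth_pd.
exact: odd_pd_even.
Qed.

(** The radial derivative of an even function is odd and vanishes on the slice, so [Avg_radial]
    writes it as the radius times an average. *)
Lemma pd_Trad f z : smth f -> even_on f -> U z -> pdv l f z = z ord0 l *: Trad f z.
Proof.
move=> Sf Ef Uz; rewrite /Trad -Avg_radial //; last exact: smooth_pd.
rewrite [X in _ - X]odd_at0 ?subr0 //; first exact: odd_pd_even.
  by apply: Usc01 => //; lra.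
exact: sc0_l.
Qed.

Lemma Trad_eq_on f g z : (forall y, U y -> f y = g y) -> U z -> Trad f z = Trad g z.
Proof.
move=> E Uz; apply: (@Avg_eq_on 0 (pdv l (pdv l f)) (pdv l (pdv l g)) z _ Uz) => x Ux.
apply: (eq_on_pd Uopen _ _ Ux) => y Uy; exact: (eq_on_pd Uopen l E Uy).
Qed.

(** Reduces the calculus of [Trad] to ordinary derivatives: a rule is checked after multiplication
    by the radius. *)
Lemma Trad_uniq f g : smth f -> even_on f -> (forall x, U x -> contAt g x) ->
  (forall z, U z -> pdv l f z = z ord0 l *: g z) -> forall z, U z -> Trad f z = g z.
Proof.
move=> Sf Ef cg H; apply: cancel_radius => //.
  by move=> x Ux; exact: smooth_cont (smooth_Trad Sf) Ux.
by move=> z Uz; rewrite -pd_Trad // H.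
Qed.

Lemma Trad_mulmx (M : 'M[R]_n) f z : smth f -> even_on f -> U z ->
  Trad (fun x => f x *m M) z = Trad f z *m M.
Proof.
move=> Sf Ef; apply: (@Trad_uniq (fun x => f x *m M) (fun z => Trad f z *m M)).
- exact: smooth_mulmx.
- exact: even_mulmx.
- by move=> x Ux; apply: contAt_mulmx; exact: smooth_cont (smooth_Trad Sf) Ux.
- by move=> y Uy; rewrite (pd_mulmx (U := U)) // pd_Trad // scalemxAl.
Qed.

Lemma Trad_sum (I : Type) (r : seq I) (P : pred I) (F : I -> pt -> val) z :
  (forall i, P i -> smth (F i)) -> (forall i, P i -> even_on (F i)) -> U z ->
  Trad (fun x => \sum_(i <- r | P i) F i x) z = \sum_(i <- r | P i) Trad (F i) z.
Proof.
move=> SF EF; apply: (@Trad_uniq (fun x => \sum_(i <- r | P i) F i x) (fun z => \sum_(i <- r | P i) Trad (F i) z)).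
- exact: smooth_sum.
- exact: even_sum.
- by move=> x Ux; apply: contAt_sum => i /SF Si; exact: smooth_cont (smooth_Trad Si) Ux.
- move=> y Uy; rewrite (pd_sum (U := U)) // scaler_sumr; apply: eq_bigr => i Pi.
  by rewrite pd_Trad //; [exact: SF|exact: EF].
Qed.

Lemma Trad_pd f i z : i != l -> smth f -> even_on f -> U z -> Trad (pdv i f) z = pdv i (Trad f) z.
Proof.
move=> il Sf Ef; apply: (@Trad_uniq (pdv i f) (pdv i (Trad f))).
- exact: smooth_pd.
- exact: even_pd.
- by move=> x Ux; exact: smooth_cont (smooth_pd i (smooth_Trad Sf)) Ux.
- move=> y Uy; rewrite (pdC Uopen) //.
  apply: isD_pd; apply: (isD_eq_on Uopen (f := fun z => z ord0 l *: Trad f z)) => //.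
    by move=> x Ux; rewrite pd_Trad.
  have zl : isD (fun z : pt => z ord0 l) y (e_ i) 0.
    move=> e e0; exists 1 => // h _.
    by rewrite entryD eq_sym (negbTE il) addr0 subrr scaler0 subr0 normr0 mulr_ge0 // ltW.
  have := isDZf zl (smooth_isD i (smooth_Trad Sf) Uy).
  by rewrite scale0r addr0.
Qed.

(** Two factors [s] appear: one from the chain rule, one from the radius of the scaled point. *)
Lemma Trad_Avg c f z : smth f -> even_on f -> U z -> Trad (Avg c f) z = Avg c.+2 (Trad f) z.
Proof.
move=> Sf Ef; apply: (@Trad_uniq (Avg c f) (Avg c.+2 (Trad f))).
- exact: smooth_Avg.
- exact: even_Avg.
- by move=> x Ux; exact: smooth_cont (smooth_Avg c.+2 (smooth_Trad Sf)) Ux.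
- move=> y Uy; rewrite pd_Avg // eqxx addn1 /Avg -vintZ; last first.
    by move=> s s01; apply: Avg_contK => // x Ux; exact: smooth_cont (smooth_Trad Sf) Ux.
  apply: vint_eq => s s01; rewrite pd_Trad //; last exact: Usc01.
  by rewrite scE eqxx !scalerA [s ^+ c.+2]exprS; congr (_ *: _); ring.
Qed.

Lemma smooth_iterT k f : smth f -> smth (iter k Trad f).
Proof. by move=> Sf; elim: k => [|k IH]; [exact: Sf|rewrite iterS; exact: smooth_Trad IH]. Qed.

Lemma even_iterT k f : smth f -> even_on f -> even_on (iter k Trad f).
Proof.
move=> Sf Ef; elim: k => [|k IH]; first exact: Ef.
by rewrite iterS; exact: even_Trad (smooth_iterT k Sf) IH.
Qed.

Lemma iterT_eq_on k f g z : (forall y, U y -> f y = g y) -> U z -> iter k Trad f z = iter k Trad g z.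
Proof.
move=> E; elim: k z => [|k IH] z Uz; first exact: E.
rewrite !iterS; exact: (Trad_eq_on IH Uz).
Qed.

Lemma iterT_Avg k c f z : smth f -> even_on f -> U z -> iter k Trad (Avg c f) z = Avg (c + k.*2) (iter k Trad f) z.
Proof.
move=> Sf Ef; elim: k z => [|k IH] z Uz; first by rewrite addn0.
rewrite iterS (@Trad_eq_on _ (Avg (c + k.*2) (iter k Trad f)) z IH Uz).
rewrite (Trad_Avg _ (smooth_iterT k Sf) (even_iterT k Sf Ef) Uz) -iterS.
by rewrite doubleS !addnS.
Qed.

(* c g + r^2 T g = f differentiates to (c+2) T g + r^2 T^2 g = T f. *)
Lemma Trad_euler (c : R) f g : smth f -> even_on f -> smth g -> even_on g ->
  (forall z, U z -> c *: g z + (z ord0 l) ^+ 2 *: Trad g z = f z) ->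
  forall z, U z -> (c + 2) *: Trad g z + (z ord0 l) ^+ 2 *: Trad (Trad g) z = Trad f z.
Proof.
move=> Sf Ef Sg Eg H z Uz; apply/esym.
have STg := smooth_Trad Sg; have ETg := even_Trad Sg Eg.
have zl y : isD (fun z : pt => z ord0 l) y (e_ l) 1.
  move=> e e0; exists 1 => // h _.
  by rewrite entryD eqxx [y ord0 l + h]addrC addrK /GRing.scale /= mulr1 subrr normr0 mulr_ge0 // ltW.
apply: (@Trad_uniq f (fun z => (c + 2) *: Trad g z + (z ord0 l) ^+ 2 *: Trad (Trad g) z)) => // x Ux.
  apply: contAtD; first by apply: contAtZ; exact: smooth_cont STg Ux.
  apply: contAtZf; last exact: smooth_cont (smooth_Trad STg) Ux.
  by apply: contAtM; exact: contAt_entry.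
have E y : U y -> c *: g y + (y ord0 l * y ord0 l) *: Trad g y = f y.
  by move=> Uy; rewrite -expr2; exact: H.
apply: isD_pd; apply: (isD_eq_on Uopen E Ux).
have D1 := isDZ c (smooth_isD l Sg Ux).
have D2 := isDZf (isDM (zl x) (zl x)) (smooth_isD l STg Ux).
have := isDD D1 D2; rewrite (pd_Trad Sg Eg Ux) (pd_Trad STg ETg Ux) !mulr1.
move=> D; apply: (isD_eqdir D (erefl _)) => {D D1 D2}.
move: (Trad g x) (Trad (Trad g) x) => a b; apply/rowP => j; rewrite !mxE; ring.
Qed.

Definition lapl f (z : pt) : val := \sum_(i | i != l) pdv i (pdv i f) z.

Lemma smooth_lapl f : smth f -> smth (lapl f).
Proof. move=> Sf; apply: (smooth_sum Uopen) => i _; exact: (smooth_pd i (smooth_pd i Sf)). Qed.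

Lemma even_lapl f : smth f -> even_on f -> even_on (lapl f).
Proof.
move=> Sf Ef; apply: even_sum => i il.
exact: (even_pd il (smooth_pd i Sf) (even_pd il Sf Ef)).
Qed.

Lemma Trad_lapl f z : smth f -> even_on f -> U z -> Trad (lapl f) z = lapl (Trad f) z.
Proof.
move=> Sf Ef Uz.
have S i : i != l -> smth (pdv i (pdv i f)) by move=> _; exact: (smooth_pd i (smooth_pd i Sf)).
have E i : i != l -> even_on (pdv i (pdv i f)).
  by move=> il; exact: (even_pd il (smooth_pd i Sf) (even_pd il Sf Ef)).
rewrite (Trad_sum (index_enum _) S E Uz : Trad (lapl f) z = _); apply: eq_bigr => i il.
rewrite (Trad_pd il (smooth_pd i Sf) (even_pd il Sf Ef) Uz).
by apply: (eq_on_pd Uopen i _ Uz) => y Uy; exact: (Trad_pd il Sf Ef Uy).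
Qed.

Definition radial_eq (c : R) f := forall z, U z ->
  lapl f z + c *: Trad f z + (z ord0 l) ^+ 2 *: Trad (Trad f) z = 0.

Lemma radial_eq_Trad (c : R) f : smth f -> even_on f -> radial_eq c f -> radial_eq (c + 2) (Trad f).
Proof.
move=> Sf Ef H z Uz.
(* The equation is read as an Euler equation for [Trad f] with right-hand side [- lapl f]; the sign
   is a matrix factor so that [Trad_mulmx] applies. *)
pose ml x := lapl f x *m (-1)%:M.
have Sml : smth ml := smooth_mulmx Uopen _ (smooth_lapl Sf).
have Eml : even_on ml := even_mulmx _ (even_lapl Sf Ef).
have E y : U y -> c *: Trad f y + (y ord0 l) ^+ 2 *: Trad (Trad f) y = ml y.
  move=> Uy; rewrite /ml mul_mx_scalar scaleN1r; apply/eqP.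
  rewrite -subr_eq0 opprK addrC addrA; apply/eqP; exact: H.
rewrite -(Trad_lapl Sf Ef Uz) -addrA.
rewrite (Trad_euler Sml Eml (smooth_Trad Sf) (even_Trad Sf Ef) E Uz).
by rewrite (Trad_mulmx _ (smooth_lapl Sf) (even_lapl Sf Ef) Uz) mul_mx_scalar scaleN1r subrr.
Qed.

Lemma radial_eq_iterT (c : R) f k : smth f -> even_on f -> radial_eq c f -> radial_eq (c + k.*2%:R) (iter k Trad f).
Proof.
move=> Sf Ef H; elim: k => [|k IH]; first by rewrite addr0.
rewrite doubleS -[X in X%:R]addn2 natrD addrA; rewrite iterS.
exact: (radial_eq_Trad (smooth_iterT k Sf) (even_iterT k Sf Ef) IH).
Qed.

(* Cauchy bounds on the whole segment from the slice [z_l = 0] to [z]. *)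
Definition analytic_at (z : pt) f := exists M C : R, 0 < C /\
  forall k s, 0 <= s <= 1 -> `|iter k Trad f (sc s z)| <= M * C ^+ k * k`!%:R.

Lemma analytic_at_eq_on z f g : U z -> (forall y, U y -> f y = g y) -> analytic_at z f -> analytic_at z g.
Proof.
move=> Uz E [M [C [C0 H]]]; exists M, C; split=> // k s s01.
rewrite -(iterT_eq_on k E (Usc01 s01 Uz)); exact: H.
Qed.

(** The shift of index turns k! into (k + 1)!; the extra factor is at most [2 ^+ k.+1] and goes into
    the constants. *)
Lemma analytic_at_Trad z f : analytic_at z f -> analytic_at z (Trad f).
Proof.
move=> [M [C [C0 H]]].
have M0 : 0 <= M.
  have := H 0%N 0; rewrite lexx ler01 expr0 !mulr1 => /(_ isT); exact: le_trans.
exists (M * C * 2), (2 * C); split=> [|k s s01]; first by rewrite mulr_gt0.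
rewrite -iterSr; apply: le_trans (H k.+1 s s01) _.
have k2 : (k.+1%:R : R) <= 2 ^+ k.+1 by rewrite -natrX ler_nat; exact/ltnW/ltn_expl.
rewrite factS natrM exprS exprMn.
have -> : M * C * 2 * (2 ^+ k * C ^+ k) * k`!%:R = M * (C * C ^+ k) * (2 ^+ k.+1 * k`!%:R) by rewrite exprS; ring.
rewrite ler_wpM2l ?mulr_ge0 ?exprn_ge0 ?(ltW C0) // ler_wpM2r //.
Qed.

Lemma analytic_at_iterT z f k : analytic_at z f -> analytic_at z (iter k Trad f).
Proof. by move=> H; elim: k => [|k IH]; [exact: H|rewrite iterS; exact: analytic_at_Trad IH]. Qed.

Lemma analytic_at_Avg z c f : smth f -> even_on f -> U z -> analytic_at z f -> analytic_at z (Avg c f).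
Proof.
move=> Sf Ef Uz [M [C [C0 H]]]; exists M, C; split=> // k s s01.
rewrite iterT_Avg //; last exact: Usc01.
set B := M * _ * _.
have B0 : 0 <= B by apply: le_trans (H k s s01).
apply: (@le_trans _ _ (B / (c + k.*2).+1%:R)); last by rewrite ler_pdivrMr // ler_peMr // ler1n.
apply: Avg_bound; [|exact: Usc01|].
  by move=> x Ux; exact: smooth_cont (smooth_iterT k Sf) Ux.
move=> t t01; rewrite scM; apply: H; case/andP: s01 => s0 s1; case/andP: t01 => t0 t1.
by rewrite mulr_ge0 //= mulr_ile1.
Qed.

Lemma iter_pd_smooth m f : smth f -> smth (iter m (pdv l) f).
Proof. by move=> Sf; elim: m => [|m IH]; [exact: Sf|rewrite iterS; exact: smooth_pd IH]. Qed.

Lemma iter_pd_Trad m f z : smth f -> U z -> iter m (pdv l) (Trad f) z = Avg m (iter m.+2 (pdv l) f) z.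
Proof.
move=> Sf; elim: m z => [|m IH] z Uz; first by [].
apply: (etrans (eq_on_pd Uopen l IH Uz)).
by rewrite (pd_Avg _ _ (iter_pd_smooth m.+2 Sf) Uz) eqxx addn1.
Qed.

(** Each [Trad] costs two radial derivatives but averages with weights [m], [m + 2], and so on, by
    [iter_pd_Trad]. For [m = 0] the divisor is the product of the first [k] odd numbers, which
    reduces (2k)! to [2^k k!]. *)
Lemma iterT_bound k m f z (B : R) : smth f -> U z ->
  (forall s, 0 <= s <= 1 -> `|iter (m + k.*2) (pdv l) f (sc s z)| <= B) ->
  `|iter m (pdv l) (iter k Trad f) z| <= B / \prod_(i < k) (m + i.*2).+1%:R.
Proof.
move=> Sf; elim: k m z => [|k IH] m z Uz H.
  by rewrite big_ord0 divr1; have := H 1; rewrite addn0 sc1 ler01 lexx; exact.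
rewrite [iter k.+1 _ _]iterS iter_pd_Trad //; last exact: smooth_iterT.
rewrite big_ord_recl /= addn0 invfM mulrA mulrAC.
have P0 : 0 <= (\prod_(i < k) (m + (bump 0 i).*2).+1%:R)^-1 :> R by rewrite invr_ge0 prodr_ge0.
apply: Avg_bound => //.
  by move=> x Ux; exact: (smooth_cont (iter_pd_smooth m.+2 (smooth_iterT k Sf)) Ux).
move=> s s01.
have -> : \prod_(i < k) (m + (bump 0 i).*2).+1%:R = \prod_(i < k) (m.+2 + i.*2).+1%:R :> R.
  by apply: eq_bigr => i _; rewrite /bump /= add1n doubleS !addnS !addSn.
apply: (IH m.+2 (sc s z) (Usc01 s01 Uz)) => t t01.
rewrite scM; have -> : (m.+2 + k.*2 = m + k.+1.*2)%N by rewrite doubleS !addnS !addSn.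
apply: H; case/andP: s01 => s0 s1; case/andP: t01 => t0 t1.
by rewrite mulr_ge0 //= mulr_ile1.
Qed.

Lemma iter_pd_coord m f z j : harmonic_val U f -> U z ->
  iter m (pdv l) f z ord0 j = iter m (fun g : pt -> R => 'D_(e_ l) g) (fun x => f x ord0 j) z.
Proof.
move=> Hf; elim: m z => [|m IH] z Uz //=.
have Sm := iter_pd_smooth m (harmonic_val_smooth Uopen Hf).
have /isD_coord /(_ j) D1 := smooth_isD l Sm Uz.
have [r r0 Hr] := Uopen Uz.
by apply/esym/isD_derive; apply: (isD_near r0) D1 => y /Hr /IH.
Qed.

End RadialOperators.

(** * Taylor series in the radius *)

Section AnalyticTaylor.
Variables (R : realType) (N n : nat) (l : 'I_N).
Local Notation pt := 'rV[R]_N.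
Local Notation val := 'rV[R]_n.
Local Notation e_ i := (delta_mx 0 i : pt).
Variable U : set pt.
Hypothesis Uopen : forall x, U x -> exists2 r : R, 0 < r & forall y, `|y - x| < r -> U y.
Hypothesis Usc : forall s z, -1 <= s <= 1 -> U z -> U (sc l s z).
Implicit Types (f : pt -> val) (z : pt).

Lemma sc_contAt z s : contAt (fun s => sc l s z) s.
Proof.
apply: contAtD; first exact: contAt_cst.
apply: contAtZf; last exact: contAt_cst.
apply: contAtM; last exact: contAt_cst.
by apply: contAtD; [exact: contAt_id|exact: contAt_cst].
Qed.

(** One radius and one bound serve all points of the compact segment, so the Cauchy constants below
    do not depend on the point. *)
Lemma segment_tube f z : (forall x, U x -> contAt f x) -> U z ->
  exists2 rho : R, 0 < rho & exists M : R, forall s y, 0 <= s <= 1 -> `|y - sc l s z| < rho ->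
    U y /\ `|f y| <= M.
Proof.
move=> cf Uz; have Us s : 0 <= s <= 1 -> U (sc l s z) by move=> h; exact: (Usc01 Usc h Uz).
pose K := (fun s => sc l s z) @` `[(0 : R), 1]%classic.
have KU x : K x -> U x by move=> [s /= + <-]; rewrite in_itv; exact: Us.
have Kc : compact K.
  apply: continuous_compact; last exact: segment_compact.
  by apply: continuous_subspaceT => s; apply/contAtP; exact: sc_contAt.
have [r1 r10 H1] := compact_tube Kc Uopen KU.
have [r2 r20 H2] := compact_unif Kc (fun x Kx => cf x (KU x Kx)) ltr01.
have [c _ Hc] : exists2 c : R, c \in `[0, 1]%R & forall t, t \in `[0, 1]%R -> `|f (sc l t z)| <= `|f (sc l c z)|.
  apply: EVT_max => //; apply: continuous_in_subspaceT => s; rewrite inE /= in_itv /= => s01.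
  apply: continuous_comp; last exact: norm_continuous.
  apply/contAtP; apply: (@contAt_comp _ _ _ _ f (fun s => sc l s z) s); first exact: sc_contAt.
  exact/cf/Us.
exists (Num.min r1 r2); first by rewrite lt_min r10.
exists (`|f (sc l c z)| + 1) => s y s01; rewrite lt_min => /andP [y1 y2].
have Ks : K (sc l s z) by exists s => //=; rewrite in_itv.
split; first exact: H1 Ks y1.
rewrite -[f y](subrK (f (sc l s z))) addrC; apply: le_trans (ler_normD _ _) _; apply: lerD.
  by apply: Hc; rewrite in_itv.
exact: H2.
Qed.

Lemma double_fact_odd k : ((k.*2)`! = (\prod_(i < k) (i.*2).+1) * (2 ^ k * k`!))%N.
Proof.
elim: k => [|k IH]; first by rewrite big_ord0.
by rewrite doubleS !factS IH big_ord_recr /= expnS -doubleS -mul2n; lia.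
Qed.

(** Cauchy estimates of order [2 k] on balls of the tube give [C0^(2k) (2k)!]; dividing by the odd
    numbers of [iterT_bound] leaves [(2 C0^2)^k k!]. *)
Lemma harmonic_analytic_at f z : harmonic_val U f -> U z -> analytic_at l z f.
Proof.
move=> Hf Uz; have Sf := harmonic_val_smooth Uopen Hf.
have [rho rho0 [M HM]] := @segment_tube f z (fun x Ux => smooth_cont Sf Ux) Uz.
pose C0 := 2 * N%:R * expR 1 / rho.
have N0 : 0 < N%:R :> R by rewrite ltr0n; apply: leq_ltn_trans (ltn_ord l).
have C00 : 0 < C0 by rewrite divr_gt0 // mulr_gt0 ?expR_gt0 // mulr_gt0.
have M0 : 0 <= M.
  have := HM 1 z; rewrite sc1 subrr normr0 lexx ler01 => /(_ isT rho0) [_].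
  exact: le_trans.
exists M, (2 * C0 ^+ 2); split; first by rewrite mulr_gt0 // exprn_gt0.
move=> k s s01; pose B := M * C0 ^+ k.*2 * (k.*2)`!%:R.
have B0 : 0 <= B by rewrite !mulr_ge0 // exprn_ge0 // ltW.
apply: le_trans (@iterT_bound R N n l U Uopen Usc k 0 f (sc l s z) B Sf (Usc01 Usc s01 Uz) _) _.
  move=> t t01; rewrite scM add0n.
  have ts01 : 0 <= t * s <= 1.
    by case/andP: s01 => s0 s1; case/andP: t01 => t0 t1; rewrite mulr_ge0 //= mulr_ile1.
  apply: rV_norm_le => // j; rewrite (@iter_pd_coord R N n l U Uopen _ f _ j Hf (Usc01 Usc ts01 Uz)).
  rewrite /B /C0; apply: (@harmonic_on_cauchy R N U Uopen _ l _ rho M (Hf j) rho0).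
    by move=> y yt; have [] := HM (t * s) y ts01 yt.
  move=> y yt; have [_] := HM (t * s) y ts01 yt; apply: le_trans.
  exact: rV_norm_coord.
rewrite /B double_fact_odd -natr_prod.
have P0 : 0 < (\prod_(i < k) (i.*2).+1)%N%:R :> R.
  by rewrite ltr0n; apply: prodn_gt0.
have -> : (\prod_(i < k) (0 + i.*2).+1 = \prod_(i < k) (i.*2).+1)%N by apply: eq_bigr => i _; rewrite add0n.
rewrite !natrM natrX -addnn exprD [(2 * C0 ^+ 2) ^+ k]exprMn [C0 ^+ 2]expr2 [(C0 * C0) ^+ k]exprMn.
move: P0; set P := (_%:R : R) => P0.
rewrite le_eqVlt; apply/orP; left; apply/eqP; field; rewrite gt_eqF //.
Qed.

Lemma cvgn_coord (u : nat -> val) (L : val) j : u @ \oo --> L -> (fun k => u k ord0 j) @ \oo --> L ord0 j.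
Proof.
move=> /cvgrPdist_le H; apply/cvgrPdist_le => e /H; apply: filterS => k; apply: le_trans.
by apply: le_trans (rV_norm_coord _ ord0 j); rewrite !mxE.
Qed.

Lemma series_coord (u : nat -> val) j : (fun k => series u k ord0 j) = series (fun k => u k ord0 j).
Proof. by apply/funext => k; rewrite /series /= summxE. Qed.

(** Coordinatewise, the iterates of [Trad] along the segment, parametrised by the radius, form a
    tower in the sense of [tower_sum_scalar]. *)
Lemma radial_taylor f z : smooth U f -> even_on l U f -> analytic_at l z f -> U z -> 0 <= z ord0 l ->
  cvgn (series (fun k => ((z ord0 l ^+ 2 / 2) ^+ k / k`!%:R) *: iter k (Trad l) f (sc l 0 z))) ->
  limn (series (fun k => ((z ord0 l ^+ 2 / 2) ^+ k / k`!%:R) *: iter k (Trad l) f (sc l 0 z))) = f z.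
Proof.
move=> Sf Ef [M [C [C0 HA]]] Uz z0 cv; set u := (fun k => _) in cv *.
have cvu : series u @ \oo --> limn (series u) by exact: cv.
apply/rowP => j; have cj := @cvgn_coord _ _ j cvu; rewrite series_coord in cj.
(* The point of the segment at radius [r]. Unlike [sc], which measures a fraction of the way, it has
   unit speed in [r]. *)
pose zr (r : R) := z + (r - z ord0 l) *: e_ l.
have zrE r : 0 <= r <= z ord0 l -> exists2 s, 0 <= s <= 1 & zr r = sc l s z.
  move=> /andP [r0 r1]; have [zl|zl] := eqVneq (z ord0 l) 0.
    exists 1; first by rewrite lexx ler01.
    have -> : r = 0 by apply: le_anti; rewrite r0 -zl r1.
    by rewrite sc1 /zr zl subrr scale0r addr0.
  have zp : 0 < z ord0 l by rewrite lt_neqAle eq_sym zl.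
  exists (r / z ord0 l); first by rewrite divr_ge0 //= ler_pdivrMr // mul1r.
  by rewrite /zr /sc mulrBl divfK // mul1r.
have := @tower_sum_scalar R (fun k r => iter k (Trad l) f (zr r) ord0 j) (z ord0 l) M C z0 C0.
have zr0 : zr 0 = sc l 0 z by rewrite /zr /sc !sub0r mulN1r.
have zrz : zr (z ord0 l) = z by rewrite /zr subrr scale0r addr0.
have E : (fun k => u k ord0 j) = (fun k => iter k (Trad l) f (zr 0) ord0 j / k`!%:R * (z ord0 l ^+ 2 / 2) ^+ k).
  by apply/funext => k; rewrite /u mxE zr0; ring.
rewrite -E zrz => H.
apply: (cvg_unique _ cj); first exact: norm_hausdorff.
apply: H.
- move=> k r hr; have [s s01 Ezr] := zrE r hr.
  have Uzr : U (zr r) by rewrite Ezr; exact: (Usc01 Usc s01 Uz).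
  have Sk := smooth_iterT Uopen Usc k Sf.
  have D := smooth_isD l Sk Uzr.
  rewrite (pd_Trad Uopen Usc Sk (even_iterT Uopen Usc k Sf Ef) Uzr) in D.
  have zrl : zr r ord0 l = r by rewrite /zr entryD eqxx addrC subrK.
  rewrite zrl in D.
  have D2 : isD (fun r => iter k (Trad l) f (zr r)) r 1 (r *: Trad l (iter k (Trad l) f) (zr r)).
    have zrL t : zr t = zr 0 + t *: e_ l.
      by rewrite /zr sub0r -addrA -scalerDl [- _ + t]addrC.
    rewrite (_ : (fun r => _) = (fun t => iter k (Trad l) f (zr 0 + t *: e_ l))); last first.
      by apply/funext => t; rewrite zrL.
    by apply/isD_line; rewrite -zrL.
  by have /isD_coord /(_ j) := D2; rewrite mxE.
- move=> k r hr; have [s s01 ->] := zrE r hr.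
  by apply: le_trans (HA k s s01); exact: rV_norm_coord.
- by apply/cvg_ex; exists (limn (series u) ord0 j).
Qed.

End AnalyticTaylor.

(** * Values on the slice of radius zero *)

Section Restriction.
Variables (R : realType) (d p : nat).
Local Notation Z := 'rV[R]_(p.+1 + 1).
Local Notation cod := 'rV[R]_d.
Local Notation lst := (rshift p.+1 (ord0 : 'I_1)).
Local Notation fs s := (lshift 1 (s : 'I_p.+1)).
Variable U : set Z.
Hypothesis Uopen : forall x, U x -> exists2 r : R, 0 < r & forall y, `|y - x| < r -> U y.
Hypothesis Usc : forall s z, -1 <= s <= 1 -> U z -> U (sc lst s z).
Implicit Types (F : Z -> cod) (g : 'rV[R]_p.+1 -> cod).

Lemma fs_lst s : fs s != lst.
Proof. by rewrite eq_lrshift. Qed.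

Lemma sum_fs (P : 'I_(p.+1 + 1) -> cod) : \sum_(i | i != lst) P i = \sum_s P (fs s).
Proof.
rewrite big_mkcond big_split_ord /= [X in _ + X]big1 ?addr0 => [|i _]; last first.
  by rewrite (ord1 i) eqxx.
by apply: eq_bigr => s _; rewrite fs_lst.
Qed.

Lemma row0_delta (s : 'I_p.+1) (y : 'rV[R]_p.+1) h :
  row_mx (y + h *: delta_mx 0 s) (0 : 'rV[R]_1) = row_mx y 0 + h *: (delta_mx 0 (fs s) : Z).
Proof.
apply/rowP => k; rewrite !mxE; case: splitP => i ki; rewrite !mxE.
  have -> : k = lshift 1 i by exact: val_inj.
  by rewrite (inj_eq (@lshift_inj _ _)).
have -> : k = rshift p.+1 i by exact: val_inj.
by rewrite eq_rlshift andbF mulr0 addr0.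
Qed.

Lemma slice0_open y : U (row_mx y 0) -> exists2 r : R, 0 < r & forall y', `|y' - y| < r -> U (row_mx y' 0).
Proof.
move=> /Uopen [r r0 Hr]; exists r => // y' hy; apply: Hr; apply: rV_norm_lt => // j.
rewrite opp_row_mx add_row_mx oppr0 addr0 mxE; case: splitP => i _; last by rewrite mxE normr0.
by apply: le_lt_trans hy; exact: rV_norm_coord.
Qed.

Lemma isD_slice0 (a : R) F g s y : (forall y, U (row_mx y 0) -> g y = a *: F (row_mx y 0)) -> smooth U F ->
  U (row_mx y 0) -> isD g y (eP R s) (a *: pd (fs s) F (row_mx y 0)).
Proof.
move=> E SF Uy; have [r r0 Hr] := slice0_open Uy.
apply: (isD_near (f := fun y => a *: F (row_mx y 0)) r0); first by move=> y' /Hr /E.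
apply: isDZ; apply: (@isD_comp_lin _ _ _ _ F (fun y => row_mx y 0) y _ _ (delta_mx 0 (fs s))).
  by move=> h; exact: row0_delta.
exact: smooth_isD.
Qed.

Lemma lapP_slice0 (a : R) F g y : (forall y, U (row_mx y 0) -> g y = a *: F (row_mx y 0)) -> smooth U F ->
  U (row_mx y 0) -> lapP g y = a *: lapl lst F (row_mx y 0).
Proof.
move=> E SF Uy; rewrite /lapP /lapl sum_fs scaler_sumr; apply: eq_bigr => s _.
apply: isD_derive; apply: isD_slice0 => //; last exact: smooth_pd.
by move=> y' Uy'; apply: isD_derive; exact: isD_slice0.
Qed.

(** With [b] equal to [halfq] or [halfq + 1] this is [cA] or [cH1] by conversion; [2 * b] is the
    constant of the corresponding radial equation. *)
Definition radial_coef (b : R) (k : nat) : R := (-1) ^+ k / (4 ^+ k * k`!%:R * poch b k).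

Lemma poch_gt0 (b : R) k : 0 < b -> 0 < poch b k.
Proof. by move=> b0; apply: prodr_gt0 => i _; rewrite ltr_wpDr. Qed.

(** At radius 0 the term with [T^2] drops out, and the equation for [T^k F], of constant
    [2 (b + k)], gives [T^(k+1) F] as a multiple of its Laplacian. The factors [2 (b + k)]
    accumulate to [2^k] times a rising factorial. *)
Lemma iterT_slice0 (b kap : R) F g k y : 0 < b -> kap != 0 -> smooth U F -> even_on lst U F ->
  radial_eq lst U (2 * b) F ->
  (forall y, U (row_mx y 0) -> F (row_mx y 0) = kap *: g y) ->
  U (row_mx y 0) -> iter k (Trad lst) F (row_mx y 0) = (kap * ((-1) ^+ k / (2 ^+ k * poch b k))) *: iter k (@lapP R d p) g y.
Proof.
move=> b0 kap0 SF EF HF Hg; elim: k y => [|k IH] y Uy.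
  by rewrite /poch big_ord0 !expr0 mulr1 divr1 mulr1; exact: Hg.
have pb := poch_gt0 k b0.
pose w := kap * ((-1) ^+ k / (2 ^+ k * poch b k)).
have w0 : w != 0.
  by rewrite !mulf_neq0 ?invr_eq0 ?mulf_neq0 ?expf_neq0 ?(gt_eqF pb) ?pnatr_eq0 ?oppr_eq0 ?oner_eq0.
have Sk := smooth_iterT Uopen Usc k SF.
(* [g] is known only through its relation to [F]; division by [w] transfers the smoothness of
   [T^k F] to the iterated Laplacian of [g]. *)
have E y' : U (row_mx y' 0) -> iter k (@lapP R d p) g y' = w^-1 *: iter k (Trad lst) F (row_mx y' 0).
  by move=> /IH ->; rewrite scalerA mulVf // scale1r.
have := radial_eq_iterT Uopen Usc k SF EF HF Uy.
have l0 : (row_mx y 0 : Z) ord0 lst = 0 by rewrite row_mxEr mxE.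
rewrite l0 expr2 mul0r scale0r addr0.
rewrite [iter k.+1 (@lapP R d p) g]iterS (lapP_slice0 E Sk Uy).
move: (lapl _ _ _) => L; rewrite iterS; move: (Trad lst _ _) => T /eqP.
rewrite addrC addr_eq0 => /eqP ET.
have c0 : 0 < 2 * b + k.*2%:R by rewrite ltr_wpDr // mulr_gt0.
have -> : T = (2 * b + k.*2%:R)^-1 *: - L by rewrite -ET scalerA mulVf ?gt_eqF // scale1r.
rewrite scalerN -scaleNr scalerA; congr (_ *: _).
have pS : poch b k.+1 = poch b k * (b + k%:R) by rewrite /poch big_ord_recr.
have bk : 0 < b + k%:R by rewrite ltr_wpDr.
have -> : 2 * b + k.*2%:R = 2 * (b + k%:R) by rewrite -mul2n natrM; ring.
rewrite /w pS; move: pb bk kap0; move: (poch b k) (b + k%:R) => P Q P0 Q0 kap0.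
rewrite [(-1) ^+ k.+1]exprS [2 ^+ k.+1]exprS.
have : (2 : R) ^+ k != 0 by rewrite expf_neq0 ?pnatr_eq0.
have : (-1 : R) ^+ k != 0 by rewrite expf_neq0 // oppr_eq0 oner_eq0.
move: ((-1 : R) ^+ k) ((2 : R) ^+ k) => s1 s2 s10 s20.
by field; rewrite ?s10 ?s20 ?kap0 ?gt_eqF.
Qed.

Lemma radial_sum (b kap : R) F g z : 0 < b -> kap != 0 -> smooth U F -> even_on lst U F ->
  analytic_at lst z F -> radial_eq lst U (2 * b) F ->
  (forall y, U (row_mx y 0) -> F (row_mx y 0) = kap *: g y) ->
  U z -> 0 <= z ord0 lst ->
  let S := series (fun k => (radial_coef b k * (z ord0 lst ^+ 2) ^+ k) *: iter k (@lapP R d p) g (lsubmx z)) in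
  cvgn S -> F z = kap *: limn S.
Proof.
move=> b0 kap0 SF EF AF HF Hg Uz z0 S cv.
have z0E : sc lst 0 z = row_mx (lsubmx z) 0.
  apply/rowP => k; rewrite scE mxE; case: splitP => i ki.
    have -> : k = lshift 1 i by exact: val_inj.
    by rewrite eq_lrshift mul1r mxE.
  have -> : k = lst by apply: val_inj; rewrite /= ki (ord1 i).
  by rewrite eqxx mul0r mxE.
have U0 : U (row_mx (lsubmx z) 0).
  by rewrite -z0E; apply: (Usc01 Usc) => //; rewrite lexx ler01.
have E k : ((z ord0 lst ^+ 2 / 2) ^+ k / k`!%:R) *: iter k (Trad lst) F (sc lst 0 z)
   = kap *: ((radial_coef b k * (z ord0 lst ^+ 2) ^+ k) *: iter k (@lapP R d p) g (lsubmx z)).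
  rewrite z0E (iterT_slice0 k b0 kap0 SF EF HF Hg U0) !scalerA; congr (_ *: _).
  rewrite /radial_coef; have pb := poch_gt0 k b0; move: pb; move: (poch b k) => P P0.
  have f0 : k`!%:R != 0 :> R by rewrite pnatr_eq0 -lt0n fact_gt0.
  have -> : (4 : R) ^+ k = 2 ^+ k * 2 ^+ k by rewrite -exprMn; congr (_ ^+ _); ring.
  rewrite expr_div_n; have : (2 : R) ^+ k != 0 by rewrite expf_neq0 ?pnatr_eq0.
  move: ((2 : R) ^+ k) ((-1 : R) ^+ k) ((z ord0 lst ^+ 2) ^+ k) (k`!%:R : R) f0 => a1 a2 a3 a4 f0 a10.
  by field; rewrite ?a10 ?f0 ?gt_eqF.
have SE : series (fun k => ((z ord0 lst ^+ 2 / 2) ^+ k / k`!%:R) *: iter k (Trad lst) F (sc lst 0 z))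
   = (fun m => kap *: S m).
  by apply/funext => m; rewrite /S /series /= scaler_sumr; apply: eq_bigr => k _; rewrite E.
have cvS : (fun m => kap *: S m) @ \oo --> kap *: limn S by apply: cvgZl_tmp; exact: cv.
rewrite -(radial_taylor Uopen Usc SF EF AF Uz z0) SE; last by apply/cvg_ex; exists (kap *: limn S).
by apply: cvg_lim.
Qed.

End Restriction.

(** * Dirac operators in the slice variables *)

Section SliceDirac.
Variables (R : realType) (d p : nat).
Local Notation Z := 'rV[R]_(p.+1 + 1).
Local Notation cod := 'rV[R]_d.
Local Notation lst := (rshift p.+1 (ord0 : 'I_1)).
Local Notation fs s := (lshift 1 (s : 'I_p.+1)).
Variable U : set Z.
Hypothesis Uopen : forall x, U x -> exists2 r : R, 0 < r & forall y, `|y - x| < r -> U y.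
Hypothesis Usc : forall s z, -1 <= s <= 1 -> U z -> U (sc lst s z).
Implicit Types (f g h : Z -> cod) (P Q : 'I_p.+1 -> 'M[R]_d) (z : Z).
Local Notation smth := (smooth U).
Local Notation even := (even_on lst U).
Local Notation T := (Trad lst).

(** The coefficients are left arbitrary so that the Dirac operator ([P = E]) and its conjugate
    ([P = Eb]) share one set of lemmas. *)
Definition genD P g z : cod := \sum_s pd (fs s) g z *m P s.

Lemma smooth_genD P g : smth g -> smth (genD P g).
Proof. by move=> Sg; apply: (smooth_sum Uopen) => s _; exact: (smooth_mulmx Uopen _ (smooth_pd _ Sg)). Qed.

Lemma even_genD P g : smth g -> even g -> even (genD P g).
Proof. by move=> Sg Eg; apply: even_sum => s _; exact: (even_mulmx _ (even_pd Uopen Usc (fs_lst s) Sg Eg)). Qed.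

Lemma harmonic_genD P g : harmonic_val U g -> harmonic_val U (genD P g).
Proof. by move=> Hg; apply: harmonic_val_sum => s _; exact: (harmonic_val_mulmx _ (harmonic_val_pd Uopen _ Hg)). Qed.

Lemma genD_eq_on P f g z : (forall y, U y -> f y = g y) -> U z -> genD P f z = genD P g z.
Proof. by move=> E Uz; apply: eq_bigr => s _; rewrite (eq_on_pd Uopen _ E Uz). Qed.

Lemma Trad_genD P g z : smth g -> even g -> U z -> T (genD P g) z = genD P (T g) z.
Proof.
move=> Sg Eg Uz.
have S s : true -> smth (fun z => pd (fs s) g z *m P s).
  by move=> _; exact: (smooth_mulmx Uopen _ (smooth_pd _ Sg)).
have E s : true -> even (fun z => pd (fs s) g z *m P s).
  by move=> _; exact: (even_mulmx _ (even_pd Uopen Usc (fs_lst s) Sg Eg)).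
rewrite (Trad_sum Uopen Usc (index_enum _) S E Uz : T (genD P g) z = _); apply: eq_bigr => s _.
rewrite (Trad_mulmx Uopen Usc _ (smooth_pd _ Sg) (even_pd Uopen Usc (fs_lst s) Sg Eg) Uz).
by rewrite (Trad_pd Uopen Usc (fs_lst s) Sg Eg Uz).
Qed.

Lemma iterT_genD k P g z : smth g -> even g -> U z -> iter k T (genD P g) z = genD P (iter k T g) z.
Proof.
move=> Sg Eg; elim: k z => [|k IH] z Uz; first by [].
rewrite !iterS (Trad_eq_on Uopen Usc IH Uz).
exact: (Trad_genD _ (smooth_iterT Uopen Usc k Sg) (even_iterT Uopen Usc k Sg Eg) Uz).
Qed.

Lemma pd_genD i P g z : smth g -> U z -> pd i (genD P g) z = genD P (pd i g) z.
Proof.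
move=> Sg Uz; have S s : true -> smth (fun z => pd (fs s) g z *m P s).
  by move=> _; exact: (smooth_mulmx Uopen _ (smooth_pd _ Sg)).
rewrite (pd_sum _ i S Uz : pd i (genD P g) z = _); apply: eq_bigr => s _.
by rewrite (pd_mulmx _ _ (smooth_pd _ Sg) Uz) (pdC Uopen _ _ Sg Uz).
Qed.

Lemma genD_mulmx P (J : 'M[R]_d) g z : smth g -> U z ->
  genD P (fun z => g z *m J) z = \sum_s pd (fs s) g z *m (J *m P s).
Proof. by move=> Sg Uz; apply: eq_bigr => s _; rewrite (pd_mulmx _ _ Sg Uz) mulmxA. Qed.

Lemma genD_radius P g z : smth g -> U z -> genD P (fun z => z ord0 lst *: g z) z = z ord0 lst *: genD P g z.
Proof.
move=> Sg Uz; rewrite scaler_sumr; apply: eq_bigr => s _; rewrite scalemxAl; congr (_ *m _).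
apply: isD_pd.
have zl : isD (fun z : Z => z ord0 lst) z (delta_mx 0 (fs s)) 0.
  move=> e e0; exists 1 => // t _.
  by rewrite entryD eq_sym eq_lrshift addr0 subrr scaler0 subr0 normr0 mulr_ge0 // ltW.
by have := isDZf zl (smooth_isD (fs s) Sg Uz); rewrite scale0r addr0.
Qed.

Lemma genD_conj P Q g z : (forall s t, P s *m Q t + P t *m Q s = (2 * (s == t)%:R)%:M) ->
  smth g -> U z -> genD Q (genD P g) z = lapl lst g z.
Proof.
move=> PQ Sg Uz.
have sym s t : pd (fs s) (pd (fs t) g) z = pd (fs t) (pd (fs s) g) z by exact: (pdC Uopen _ _ Sg Uz).
rewrite /lapl sum_fs -(clifford_sum (w := fun s t => pd (fs s) (pd (fs t) g) z) PQ sym).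
apply: eq_bigr => t _; rewrite (pd_genD _ _ Sg Uz) /genD mulmx_suml.
by apply: eq_bigr => s _; rewrite mulmxA.
Qed.

Definition laplace_on f := forall z, U z -> lapl lst f z + pd lst (pd lst f) z = 0.

(** The product rule for [df/dr = r T f] gives [T f + r^2 T^2 f] as second radial derivative. *)
Lemma laplace_radial f : smth f -> even f -> laplace_on f -> radial_eq lst U 1 f.
Proof.
move=> Sf Ef H z Uz; rewrite -[RHS](H z Uz) -addrA scale1r; congr (_ + _); apply/esym/isD_pd.
have zl : isD (fun z : Z => z ord0 lst) z (delta_mx 0 lst) 1.
  move=> e e0; exists 1 => // t _.
  by rewrite entryD eqxx [z ord0 lst + t]addrC addrK /GRing.scale /= mulr1 subrr normr0 mulr_ge0 // ltW.
have ST := smooth_Trad Uopen Usc Sf.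
have := isDZf zl (smooth_isD lst ST Uz).
rewrite (pd_Trad Uopen Usc ST (even_Trad Uopen Usc Sf Ef) Uz) scale1r scalerA -expr2 addrC => D.
by apply: (isD_eq_on Uopen _ Uz D) => y Uy; rewrite (pd_Trad Uopen Usc Sf Ef Uy).
Qed.

Lemma lapl_genD P g z : smth g -> U z -> lapl lst (genD P g) z = genD P (lapl lst g) z.
Proof.
move=> Sg Uz.
have C2 i : pd i (pd i (genD P g)) z = genD P (pd i (pd i g)) z.
  rewrite (@eq_on_pd R _ _ U Uopen (pd i (genD P g)) (genD P (pd i g)) i z (fun y Uy => pd_genD i P Sg Uy) Uz).
  exact: (pd_genD _ _ (smooth_pd _ Sg) Uz).
transitivity (\sum_(i | i != lst) genD P (pd i (pd i g)) z).
  by apply: eq_bigr => i _; exact: C2.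
rewrite exchange_big; apply: eq_bigr => s _.
have S i : i != lst -> smth (pd i (pd i g)) by move=> _; exact: (smooth_pd i (smooth_pd i Sg)).
refine (etrans (esym (mulmx_suml _ _ _ _)) _); congr (_ *m _); exact/esym/(pd_sum _ (fs s) S Uz).
Qed.

Lemma radial_genD (c : R) P g : smth g -> even g -> radial_eq lst U c g -> radial_eq lst U c (genD P g).
Proof.
move=> Sg Eg H z Uz.
have STg := smooth_Trad Uopen Usc Sg; have ETg := even_Trad Uopen Usc Sg Eg.
rewrite (lapl_genD P Sg Uz) (Trad_genD P Sg Eg Uz).
rewrite (Trad_eq_on Uopen Usc (fun y Uy => Trad_genD P Sg Eg Uy) Uz) (Trad_genD P STg ETg Uz).
rewrite /genD !scaler_sumr -!big_split big1 // => s _.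
have zl : isD (fun z : Z => z ord0 lst ^+ 2) z (delta_mx 0 (fs s)) 0.
  move=> e e0; exists 1 => // t _.
  by rewrite entryD eq_sym eq_lrshift addr0 subrr scaler0 subr0 normr0 mulr_ge0 // ltW.
have D0 : isD (fun=> 0 : cod) z (delta_mx 0 (fs s)) 0 := isD_cst _ _ _.
have D := isDD (isDD (smooth_isD (fs s) (smooth_lapl lst Uopen Sg) Uz) (isDZ c (smooth_isD (fs s) STg Uz)))
  (isDZf zl (smooth_isD (fs s) (smooth_Trad Uopen Usc STg) Uz)).
have := isD_uniq D (isD_eq_on Uopen (fun y Uy => esym (H y Uy)) Uz D0).
rewrite scale0r addr0 => K.
have lin (a b e : cod) (k : R) (M : 'M[R]_d) : a *m M + c *: (b *m M) + k *: (e *m M) = (a + c *: b + k *: e) *m M.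
  by rewrite !mulmxDl -!scalemxAl.
by refine (etrans (lin _ _ _ _ _) _); rewrite K mul0mx.
Qed.

Lemma lapP0 k : iter k (@lapP R d p) (fun=> 0) = fun=> 0.
Proof.
elim: k => [|k IH] //; rewrite iterS IH; apply/funext => y; rewrite /lapP big1 // => s _.
have -> : 'D_(eP R s) (fun=> 0) = (fun=> 0 : cod) by apply/funext => x; exact: (isD_derive (isD_cst _ _ _)).
exact: (isD_derive (isD_cst _ _ _)).
Qed.

(** The radial Taylor series is built from the values at radius 0; here all its terms vanish, so it
    converges and represents [f]. Negative radii follow by evenness. *)
Lemma even_laplace_unique f : harmonic_val U f -> even f -> laplace_on f ->
  (forall y, U (row_mx y 0) -> f (row_mx y 0) = 0) -> forall z, U z -> f z = 0.
Proof.
move=> Hf Ef Lf f0.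
have Sf := harmonic_val_smooth Uopen Hf.
have pos z : U z -> 0 <= z ord0 lst -> f z = 0.
  move=> Uz z0; have h2 : 0 < 2^-1 :> R by rewrite invr_gt0.
  have L1 : radial_eq lst U (2 * 2^-1) f.
    by rewrite mulfV ?pnatr_eq0 //; exact: laplace_radial.
  have g0 y : U (row_mx y 0) -> f (row_mx y 0) = 1 *: (fun=> 0 : cod) y by move=> /f0 ->; rewrite scaler0.
  have one0 : (1 : R) != 0 by exact: oner_neq0.
  have := radial_sum Uopen Usc h2 one0 Sf Ef (harmonic_analytic_at Uopen Usc Hf Uz) L1 g0 Uz z0.
  rewrite /=; have -> : series (fun k => (radial_coef 2^-1 k * (z ord0 lst ^+ 2) ^+ k) *: iter k (@lapP R d p) (fun=> 0) (lsubmx z)) = (fun=> 0).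
    by apply/funext => m; rewrite /series /= big1 // => k _; rewrite lapP0 scaler0.
  move=> H; rewrite H; last by apply/cvg_ex; exists 0; exact: cvg_cst.
  by rewrite lim_cst // scaler0.
move=> z Uz; have [z0|z0] := leP 0 (z ord0 lst); first exact: pos.
rewrite -(Ef z Uz); apply: pos; first by apply: Usc => //; lra.
by rewrite scE eqxx; lra.
Qed.

Variable E : 'I_p.+1 -> 'M[R]_d.
Definition Eb (s : 'I_p.+1) : 'M[R]_d := if s == ord0 then 1%:M else - E s.
Hypothesis E0 : E ord0 = 1%:M.
Hypothesis Ecliff : forall s t, s != ord0 -> t != ord0 -> E s *m E t + E t *m E s = (- 2 * (s == t)%:R)%:M.

Lemma E_Eb s t : E s *m Eb t + E t *m Eb s = (2 * (s == t)%:R)%:M.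
Proof.
rewrite /Eb; have [->|s0] := eqVneq s ord0; have [->|t0] := eqVneq t ord0.
- by rewrite E0 mulr1n mulr1 mulmx1 -raddfD.
- by rewrite E0 mulr0n mulr0 raddf0 mul1mx mulmx1 addNr.
- by rewrite E0 (negbTE s0) mulr0 raddf0 mul1mx mulmx1 subrr.
- by rewrite !mulmxN -opprD Ecliff // -raddfN mulNr opprK.
Qed.

Lemma Eb_E s t : Eb s *m E t + Eb t *m E s = (2 * (s == t)%:R)%:M.
Proof.
rewrite /Eb; have [->|s0] := eqVneq s ord0; have [->|t0] := eqVneq t ord0.
- by rewrite E0 mulr1n mulr1 mulmx1 -raddfD.
- by rewrite E0 mulr0n mulr0 raddf0 mul1mx mulmx1 subrr.
- by rewrite E0 (negbTE s0) mulr0 raddf0 mul1mx mulmx1 addNr.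
- by rewrite !mulNmx -opprD Ecliff // -raddfN mulNr opprK.
Qed.

Section OneSlice.
Variables (J : 'M[R]_d) (u ub : Z -> cod).
Hypothesis J2 : J *m J = - 1%:M.
Hypothesis EJ : forall s, E s *m J = J *m Eb s.
Hypotheses (Hu : harmonic_val U u) (Hub : harmonic_val U ub).
Hypothesis ubE : forall z, U z -> u (sc lst (-1) z) = ub z.
Hypothesis Du : forall z, U z -> genD E u z + pd lst u z *m J = 0.
Hypothesis Dub : forall z, U z -> genD E ub z - pd lst ub z *m J = 0.

Definition even_part z : cod := 2^-1 *: (u z + ub z).
(** The odd part of [u] divided by the unit: since [J] squares to -1, [u] is [even_part] plus
    [odd_stem *m J]. *)
Definition odd_stem z : cod := (- 2^-1) *: ((u z + (-1) *: ub z) *m J).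

Let Su := harmonic_val_smooth Uopen Hu.
Let Sub := harmonic_val_smooth Uopen Hub.

Lemma ubE' z : U z -> ub (sc lst (-1) z) = u z.
Proof.
move=> Uz; rewrite -ubE; last by apply: Usc => //; lra.
by rewrite scM mulN1r opprK sc1.
Qed.

Lemma harmonic_even_part : harmonic_val U even_part.
Proof. exact: harmonic_val_Z (harmonic_val_D Hu Hub). Qed.

Lemma harmonic_odd_stem : harmonic_val U odd_stem.
Proof. exact: harmonic_val_Z (harmonic_val_mulmx _ (harmonic_val_D Hu (harmonic_val_Z _ Hub))). Qed.

Lemma even_part_even : even even_part.
Proof. by move=> z Uz; rewrite /even_part ubE // ubE' // addrC. Qed.

Lemma odd_stem_odd : odd_on lst U odd_stem.
Proof.
move=> z Uz; rewrite /odd_stem ubE // ubE' // !scaleN1r -scalerN -mulNmx opprB //.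
Qed.

Lemma slice_recompose z : U z -> u z = even_part z + odd_stem z *m J.
Proof.
move=> Uz; rewrite /odd_stem -scalemxAl -mulmxA J2 mulmxN mulmx1 scalerN scaleNr opprK scaleN1r.
rewrite /even_part; move: (u z) (ub z) => a b; apply/rowP => j; rewrite !mxE; field; exact: isT.
Qed.

Let pd_even i z : U z -> pd i even_part z = 2^-1 *: (pd i u z + pd i ub z).
Proof. by move=> Uz; rewrite (pdZ _ _ (smooth_D Uopen Su Sub) Uz) (pdD _ Su Sub Uz). Qed.

Let pd_odd i z : U z -> pd i odd_stem z = (- 2^-1) *: ((pd i u z + (-1) *: pd i ub z) *m J).
Proof.
move=> Uz; have S1 := smooth_D Uopen Su (smooth_Z Uopen (-1) Sub).
rewrite (pdZ _ _ (smooth_mulmx Uopen J S1) Uz) (pd_mulmx _ _ S1 Uz).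
by rewrite (pdD _ Su (smooth_Z Uopen (-1) Sub) Uz) (pdZ _ _ Sub Uz).
Qed.

(** Half the sum of the Dirac equations for the two opposite units. With [pd_even_part], their half
    difference after [EJ] has exchanged [E] for [Eb], it forms a Cauchy-Riemann system free of
    [J]. *)
Lemma pd_odd_stem z : U z -> pd lst odd_stem z = genD E even_part z.
Proof.
move=> Uz; rewrite (pd_odd _ Uz).
have -> : genD E even_part z = 2^-1 *: (genD E u z + genD E ub z).
  rewrite /genD -big_split scaler_sumr; apply: eq_bigr => s _.
  by rewrite (pd_even _ Uz) -scalemxAl mulmxDl.
have /eqP := Du Uz; rewrite addr_eq0 => /eqP ->.
have /eqP := Dub Uz; rewrite subr_eq0 => /eqP ->.
by rewrite mulmxDl -scalemxAl scaleN1r scaleNr -scalerN opprB addrC.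
Qed.

Lemma pd_even_part z : U z -> pd lst even_part z = - genD Eb odd_stem z.
Proof.
move=> Uz; rewrite (pd_even _ Uz).
have -> : genD Eb odd_stem z = (- 2^-1) *: ((genD E u z + (-1) *: genD E ub z) *m J).
  rewrite /genD scaler_sumr -big_split mulmx_suml scaler_sumr; apply: eq_bigr => s _ /=.
  rewrite (pd_odd _ Uz) -scalemxAl -mulmxA -EJ; congr (_ *: _).
  by rewrite mulmxA mulmxDl -scalemxAl.
have /eqP := Du Uz; rewrite addr_eq0 => /eqP ->.
have /eqP := Dub Uz; rewrite subr_eq0 => /eqP ->.
rewrite mulmxDl -scalemxAl !mulNmx -!mulmxA J2 !mulmxN !mulmx1 opprK scaleN1r opprK.
by rewrite scaleNr opprK.
Qed.

Lemma laplace_even_part : laplace_on even_part.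
Proof.
move=> z Uz; have Se := harmonic_val_smooth Uopen harmonic_even_part.
have So := harmonic_val_smooth Uopen harmonic_odd_stem.
rewrite -(genD_conj E_Eb Se Uz).
have E1 y : U y -> pd lst even_part y = (-1) *: genD Eb odd_stem y by move=> /pd_even_part ->; rewrite scaleN1r.
rewrite (eq_on_pd Uopen _ E1 Uz) (pdZ _ _ (smooth_genD Eb So) Uz) (pd_genD _ _ So Uz).
rewrite (@genD_eq_on Eb (pd lst odd_stem) (genD E even_part) z) //; first by rewrite scaleN1r subrr.
by move=> y /pd_odd_stem.
Qed.

(** An odd function vanishes at radius 0, so it is the radius times the average of its radial
    derivative. The odd part is thus determined by the even one, and independence of the unit need
    only be proved for [even_part]. *)
Lemma odd_stem_radius z : U z -> odd_stem z = z ord0 lst *: Avg lst 0 (genD E even_part) z.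
Proof.
move=> Uz; have So := harmonic_val_smooth Uopen harmonic_odd_stem.
have c01 : 0 <= (0 : R) <= 1 by rewrite lexx ler01.
have Z0 : odd_stem (sc lst 0 z) = 0 := odd_at0 odd_stem_odd (Usc01 Usc c01 Uz) (sc0_l lst z).
have := Avg_radial Usc So Uz; rewrite Z0 subr0.
by move=> ->; congr (_ *: _); apply: (Avg_eq_on Usc 0 _ Uz) => y /pd_odd_stem.
Qed.

End OneSlice.

Section Towers.
Variable e : Z -> cod.
Hypotheses (He : harmonic_val U e) (Ee : even e) (Le : laplace_on e).
Let h := Avg lst 0 (genD E e).
Hypothesis pd_e : forall z, U z -> pd lst e z = - (z ord0 lst *: genD Eb h z).

Let Se := harmonic_val_smooth Uopen He.
Let SDe := smooth_genD E Se.
Let EDe := even_genD E Se Ee.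
Let HDe := harmonic_genD E He.

Lemma smooth_stem : smth h.
Proof. exact: (smooth_Avg Uopen Usc _ SDe). Qed.

Lemma even_stem : even h.
Proof. exact: (even_Avg Usc _ EDe). Qed.

Lemma stem_slice0 z : U z -> z ord0 lst = 0 -> h z = genD E e z.
Proof.
by move=> Uz z0; have := Avg_ode Usc 0 SDe Uz; rewrite z0 scale0r addr0 scale1r.
Qed.

(** For [k = 0] this is [Avg_ode], since the radial derivative of [h] is the radius times [T h];
    each further [T] raises the constant by 2 through [Trad_euler]. *)
Lemma stem_euler k z : U z -> (1 + k.*2%:R) *: iter k T h z + z ord0 lst ^+ 2 *: iter k.+1 T h z = iter k T (genD E e) z.
Proof.
elim: k z => [|k IH] z Uz.
  have A := Avg_ode Usc 0 SDe Uz.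
  have B := pd_Avg Uopen Usc 0 lst SDe Uz.
  have C := pd_Trad Uopen Usc smooth_stem even_stem Uz.
  rewrite eqxx in B; have it1 (X : Type) (t : X -> X) y : iter 1 t y = t y by [].
  rewrite it1 addr0 expr2 -scalerA -C /h B; exact: A.
rewrite doubleS -[X in X%:R]addn2 natrD addrA.
apply: (@Trad_euler R _ d lst U Uopen Usc (1 + k.*2%:R) (iter k T (genD E e)) (iter k T h)) => //.
- exact: (smooth_iterT Uopen Usc k SDe).
- exact: (even_iterT Uopen Usc k SDe EDe).
- exact: (smooth_iterT Uopen Usc k smooth_stem).
- exact: (even_iterT Uopen Usc k smooth_stem even_stem).
Qed.

Lemma Trad_even_part z : U z -> T e z = (-1) *: genD Eb h z.
Proof.
move: z; apply: (Trad_uniq Uopen Usc Se Ee) => z Uz.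
  by apply: contAtZ; exact: (smooth_cont (smooth_genD Eb smooth_stem) Uz).
by rewrite (pd_e Uz) scaleN1r scalerN.
Qed.

Lemma radial_even_part : radial_eq lst U 1 e.
Proof. exact: laplace_radial Se Ee Le. Qed.

(** [stem_euler] with [k = 1] has left side [3 T h + r^2 T^2 h] and right side [T] of [genD E e],
    that is [genD E (T e)]. Since [T e] is minus the conjugate operator applied to [h], this is
    minus the Laplacian of [h]. *)
Lemma radial_stem : radial_eq lst U 3 h.
Proof.
move=> z Uz; have := stem_euler 1 Uz; rewrite /= -addrA.
have -> : 1 + 2%:R = 3 :> R by ring.
move=> ->; rewrite (Trad_genD E Se Ee Uz).
rewrite (@genD_eq_on E (T e) (fun z => genD Eb h z *m (-1)%:M) z) //; last first.
  by move=> y /Trad_even_part ->; rewrite mul_mx_scalar.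
rewrite (genD_mulmx _ _ (smooth_genD Eb smooth_stem) Uz).
rewrite -(genD_conj Eb_E smooth_stem Uz) /genD -big_split /= big1 // => s _.
by rewrite mulmxA mul_mx_scalar scaleN1r mulNmx subrr.
Qed.

Lemma analytic_even_part z : U z -> analytic_at lst z e.
Proof. exact: (harmonic_analytic_at Uopen Usc He). Qed.

Lemma analytic_genD P z : U z -> analytic_at lst z (genD P e).
Proof. exact: (harmonic_analytic_at Uopen Usc (harmonic_genD P He)). Qed.

Lemma analytic_stem z : U z -> analytic_at lst z h.
Proof. by move=> Uz; exact: (analytic_at_Avg Uopen Usc 0 SDe EDe Uz (analytic_genD E Uz)). Qed.

(** [h] solves the radial equation with constant 3 rather than Laplace's equation in the slice
    variables, so the Cauchy bounds for its derivatives are taken from the harmonic function under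
    the average. *)
Lemma genD_stem P z : U z -> genD P h z = Avg lst 0 (genD P (genD E e)) z.
Proof.
move=> Uz.
have c s x : U x -> contAt (pd (fs s) (genD E e)) x by exact: (smooth_cont (smooth_pd _ SDe)).
rewrite (Avg_sum Usc 0 (index_enum _) (F := fun s z => pd (fs s) (genD E e) z *m P s)) //; last first.
  by move=> s x Ux; apply: contAt_mulmx; exact: c.
apply: eq_bigr => s _; rewrite (pd_Avg Uopen Usc 0 _ SDe Uz) (negbTE (fs_lst s)).
by rewrite (Avg_mulmx Usc 0 _ (c s) Uz).
Qed.

Lemma analytic_genD_stem P z : U z -> analytic_at lst z (genD P h).
Proof.
move=> Uz; apply: (analytic_at_eq_on Uopen Usc (f := Avg lst 0 (genD P (genD E e))) Uz).
  by move=> y Uy; rewrite genD_stem.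
apply: (analytic_at_Avg Uopen Usc 0 (smooth_genD P SDe) (even_genD P SDe EDe) Uz).
exact: (harmonic_analytic_at Uopen Usc (harmonic_genD P HDe) Uz).
Qed.

End Towers.
End SliceDirac.

(** * Slices of monogenic functions *)

Section AltAlgebra.
Variables (R : realType) (d : nat) (A : realAlg R d).
Hypothesis HA : is_alt_alg_with_anti_involution A.
Local Notation "x ** y" := (amul A x y) (at level 40, left associativity).

Let lin_l (k : R) x y z : (k *: x + y) ** z = k *: (x ** z) + y ** z.
Proof. by case: HA => _ [+ _ _ _ _]; exact. Qed.

Let lin_r (k : R) x y z : x ** (k *: y + z) = k *: (x ** y) + x ** z.
Proof. by case: HA => _ [_ + _ _ _]; exact. Qed.

(* Matrices act on row vectors from the right: [a ** y = y *m Lm a]. *)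
Definition Lm (a : 'rV[R]_d) : 'M[R]_d := \matrix_(i, j) (a ** delta_mx 0 i) ord0 j.

Lemma Lm_lin (k : R) a b : Lm (k *: a + b) = k *: Lm a + Lm b.
Proof. by apply/matrixP => i j; rewrite !mxE lin_l !mxE. Qed.

Lemma LmD a b : Lm (a + b) = Lm a + Lm b.
Proof. by rewrite -[a in LHS]scale1r Lm_lin scale1r. Qed.

Lemma Lm0 : Lm 0 = 0.
Proof. by have := Lm_lin (-1) 0 0; rewrite scaler0 addr0 scaleN1r addNr. Qed.

Lemma LmZ (k : R) a : Lm (k *: a) = k *: Lm a.
Proof. by rewrite -[k *: a]addr0 Lm_lin Lm0 addr0. Qed.

Lemma LmN a : Lm (- a) = - Lm a.
Proof. by rewrite -scaleN1r LmZ scaleN1r. Qed.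

Lemma Lm_sum (I : Type) (s : seq I) (P : pred I) (F : I -> 'rV[R]_d) :
  Lm (\sum_(i <- s | P i) F i) = \sum_(i <- s | P i) Lm (F i).
Proof. exact: (big_morph Lm LmD Lm0). Qed.

Lemma amulE a y : a ** y = y *m Lm a.
Proof.
have a0 : a ** 0 = 0 by have := lin_r (-1) a 0 0; rewrite scaler0 addr0 scaleN1r addNr.
have aD x z : a ** (x + z) = a ** x + a ** z by rewrite -[x in LHS]scale1r lin_r scale1r.
have aZ k x : a ** (k *: x) = k *: (a ** x) by rewrite -[k *: x]addr0 lin_r a0 addr0.
rewrite [in LHS](row_sum_delta y) (big_morph (amul A a) aD a0).
apply/rowP => j; rewrite summxE mxE; apply: eq_bigr => i _.
by rewrite aZ !mxE.
Qed.

Lemma Lm1 : Lm (aone A) = 1%:M.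
Proof.
apply/row_matrixP => i; rewrite !rowE -amulE mulmx1.
by case: HA => _ [_ _ + _ _] => /(_ (delta_mx 0 i)) [].
Qed.

(** The left alternative law. A product of left multiplications is in general no left
    multiplication, but Clifford relations involve only squares and anticommutators, and the latter
    follow by polarisation in [Lm_anticomm]. *)
Lemma Lm_sq a : Lm (a ** a) = Lm a *m Lm a.
Proof.
apply/row_matrixP => i; rewrite !rowE mulmxA -!amulE.
case: HA => _ [_ _ _ + _] => /(_ a (delta_mx 0 i)) [+ _ _].
by move=> /eqP; rewrite /assoc subr_eq0 => /eqP.
Qed.

Lemma Lm_anticomm a b : Lm a *m Lm b + Lm b *m Lm a = Lm (a ** b + b ** a).
Proof.
have := Lm_sq (a + b).
have -> : (a + b) ** (a + b) = (a ** a + b ** b) + (a ** b + b ** a).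
  have addl x y z : (x + y) ** z = x ** z + y ** z by rewrite -[x in LHS]scale1r lin_l scale1r.
  have addr' x y z : x ** (y + z) = x ** y + x ** z by rewrite -[y in LHS]scale1r lin_r scale1r.
  rewrite addl !addr'; move: (a ** a) (b ** b) (a ** b) (b ** a) => w x y z.
  by apply/rowP => j; rewrite !mxE; ring.
rewrite LmD (LmD (a ** a)) (LmD a b) mulmxDl !mulmxDr -!Lm_sq.
move: (Lm (a ** a)) (Lm (b ** b)) (Lm a *m Lm b) (Lm b *m Lm a) (Lm _) => w x y z u H.
apply/matrixP => i j; move/matrixP: H => /(_ i j); rewrite !mxE => H; lra.
Qed.

(** Trace zero means that the conjugate of [a] is [- a], so norm one says that [a] squares to -1. *)
Lemma Lm_unit_sq a : SA A a -> Lm (a ** a) = (- 1)%:M.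
Proof.
case=> /eqP; rewrite /atr addrC addr_eq0 => /eqP ca; rewrite /anrm ca => a1.
have : a ** (- a) = - (a ** a) by rewrite !amulE mulNmx.
by rewrite a1 => H; rewrite -[a ** a]opprK -H LmN Lm1 raddfN.
Qed.

Lemma good_basis_clifford (p q : nat) (v : 'I_(p.+1 + q) -> 'rV[R]_d) i j : good_basis A v ->
  i != idx0 p q -> j != idx0 p q -> Lm (v i) *m Lm (v j) + Lm (v j) *m Lm (v i) = (- 2 * (i == j)%:R)%:M.
Proof.
case=> _ _ Hv anti _ i0 j0; have [->|ij] := eqVneq i j.
  by rewrite -Lm_sq (Lm_unit_sq (Hv j j0)) -raddfD mulr1; congr (_%:M); ring.
by rewrite Lm_anticomm (anti i j i0 j0 ij) addNr Lm0 mulr0 raddf0.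
Qed.

End AltAlgebra.

(** * Left multiplication by vectors of the last q coordinates *)

Section SphereUnits.
Variables (R : realType) (d p q : nat).
Variables (E : 'I_p.+1 -> 'M[R]_d) (V : 'I_q -> 'M[R]_d).
Hypothesis Vcliff : forall j k, V j *m V k + V k *m V j = (- 2 * (j == k)%:R)%:M.
Hypothesis EV : forall s j, E s *m V j = V j *m Eb E s.

Definition JV (w : 'rV[R]_q) : 'M[R]_d := \sum_j w ord0 j *: V j.

Lemma JV_lin (k : R) w1 w2 : JV (k *: w1 + w2) = k *: JV w1 + JV w2.
Proof.
rewrite /JV scaler_sumr -big_split; apply: eq_bigr => j _ /=.
by rewrite !mxE scalerDl scalerA.
Qed.

Lemma JV0 : JV 0 = 0.
Proof. by rewrite /JV big1 // => j _; rewrite mxE scale0r. Qed.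

Lemma JVZ (k : R) w : JV (k *: w) = k *: JV w.
Proof. by rewrite -[k *: w]addr0 JV_lin JV0 addr0. Qed.

Lemma JVN w : JV (- w) = - JV w.
Proof. by rewrite -scaleN1r JVZ scaleN1r. Qed.

(** An instance of [clifford_sum] with coefficients [V] and [- V] and weights given by products of
    coordinates, row by row. *)
Lemma JV_sq w : JV w *m JV w = (- \sum_j (w ord0 j) ^+ 2)%:M.
Proof.
apply/row_matrixP => i; rewrite !rowE; set y := delta_mx 0 i.
have cl s t : V s *m - V t + V t *m - V s = (2 * (s == t)%:R)%:M.
  by rewrite !mulmxN -opprD Vcliff -raddfN mulNr opprK.
have := clifford_sum (w := fun s t => (w ord0 s * w ord0 t) *: y) cl.
move=> /(_ (fun s t => congr1 (fun k => k *: y) (mulrC _ _))) H.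
rewrite mul_mx_scalar scaleNr scaler_suml; apply/eqP; rewrite -eqr_oppLR; apply/eqP.
transitivity (\sum_t (w ord0 t * w ord0 t) *: y); last by apply: eq_bigr => t _; rewrite expr2.
rewrite -H /JV mulmx_sumr mulmx_sumr -sumrN; apply: eq_bigr => t _.
rewrite mulmx_suml mulmx_sumr -sumrN; apply: eq_bigr => s _.
by rewrite -!scalemxAl -!scalemxAr scalerA !mulmxN scalerN.
Qed.

Lemma E_JV s w : E s *m JV w = JV w *m Eb E s.
Proof.
rewrite /JV mulmx_sumr mulmx_suml; apply: eq_bigr => j _.
by rewrite -scalemxAr -scalemxAl EV.
Qed.

End SphereUnits.

(** * From the slices of f to one even harmonic function *)

Section SliceRepresentation.
Variables (R : realType) (d p q : nat).
Local Notation Z := 'rV[R]_(p.+1 + 1).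
Local Notation cod := 'rV[R]_d.
Local Notation lst := (rshift p.+1 (ord0 : 'I_1)).
Local Notation fs s := (lshift 1 (s : 'I_p.+1)).
Local Notation pt := 'rV[R]_(p.+1 + q).
Variables (E : 'I_p.+1 -> 'M[R]_d) (V : 'I_q -> 'M[R]_d).
Hypothesis E0 : E ord0 = 1%:M.
Hypothesis Ecliff : forall s t, s != ord0 -> t != ord0 -> E s *m E t + E t *m E s = (- 2 * (s == t)%:R)%:M.
Hypothesis Vcliff : forall j k, V j *m V k + V k *m V j = (- 2 * (j == k)%:R)%:M.
Hypothesis EV : forall s j, E s *m V j = V j *m Eb E s.
Variables (Om : set pt) (f : pt -> cod).
Hypothesis fD : forall w, in_sphere w -> forall z, slice_dom Om w z ->
  [/\ forall s : 'I_p.+1, derivable f (slice_pt w z) (eX R (lshift q s)) /\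
        {for z, continuous (fun z' => 'D_(eX R (lshift q s)) f (slice_pt w z'))},
      derivable f (slice_pt w z) (eR p w) /\
        {for z, continuous (fun z' => 'D_(eR p w) f (slice_pt w z'))} &
      \sum_(s < p.+1) 'D_(eX R (lshift q s)) f (slice_pt w z) *m E s
        + 'D_(eR p w) f (slice_pt w z) *m JV V w = 0].
Variable U : set Z.
Hypothesis Uopen : forall x, U x -> exists2 r : R, 0 < r & forall y, `|y - x| < r -> U y.
Hypothesis Usc : forall s z, -1 <= s <= 1 -> U z -> U (sc lst s z).

Definition inslice (w : 'rV[R]_q) (z : Z) : pt := slice_pt w (lsubmx z, z ord0 lst).
Hypothesis UOm : forall w z, in_sphere w -> U z -> Om (inslice w z).

Lemma inslice_fs w z s (h : R) : inslice w (z + h *: delta_mx 0 (fs s)) = inslice w z + h *: eX R (lshift q s).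
Proof.
apply/rowP => k; rewrite !mxE; case: splitP => i ki; rewrite !mxE.
  have -> : k = lshift q i by exact: val_inj.
  by rewrite !(inj_eq (@lshift_inj _ _)).
have -> : k = rshift p.+1 i by exact: val_inj.
by rewrite !eq_rlshift !andbF !mulr0 !addr0.
Qed.

Lemma inslice_lst w z (h : R) : inslice w (z + h *: delta_mx 0 lst) = inslice w z + h *: eR p w.
Proof.
apply/rowP => k; rewrite !mxE; case: splitP => i ki; rewrite !mxE.
  by rewrite !eq_lrshift !andbF !mulr0 !addr0.
by rewrite !eqxx mulr1 mulrDl.
Qed.

Lemma contAt_slice (g : 'rV[R]_p.+1 * R -> cod) (z : Z) :
  {for (lsubmx z, z ord0 lst), continuous g} -> contAt (fun z : Z => g (lsubmx z, z ord0 lst)) z.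
Proof.
move=> /contAtP Hg; apply: (contAt_comp (g := fun z : Z => (lsubmx z, z ord0 lst)) _ Hg).
move=> e e0; exists e => // y hy; rewrite prod_normE ge_max.
apply/andP; split; last first.
  by have := rV_norm_coord (y - z) ord0 lst; rewrite !mxE => /le_trans; apply; exact: ltW.
apply: rV_norm_le; first exact: ltW.
by move=> j; have := rV_norm_coord (y - z) ord0 (fs j); rewrite !mxE => /le_trans; apply; exact: ltW.
Qed.

Definition dslice w (i : 'I_(p.+1 + 1)) (z : Z) : cod :=
  match fintype.split i with inl s => 'D_(eX R (lshift q s)) f (inslice w z) | inr _ => 'D_(eR p w) f (inslice w z) end.

(** Dirac coefficients in the slice variables, the radial one being left multiplication by the unit
    [w]. [Kw] is the conjugate system, with [- JV V w] because [JV V w] squares to -1. *)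
Let Mw w (i : 'I_(p.+1 + 1)) : 'M[R]_d := match fintype.split i with inl s => E s | inr _ => JV V w end.
Let Kw w (i : 'I_(p.+1 + 1)) : 'M[R]_d := match fintype.split i with inl s => Eb E s | inr _ => - JV V w end.

Lemma split_fs (s : 'I_p.+1) : fintype.split (fs s) = inl s.
Proof. exact: (unsplitK (inl s)). Qed.

Lemma split_lst : fintype.split lst = inr ord0 :> 'I_p.+1 + 'I_1.
Proof. exact: (unsplitK (inr ord0)). Qed.

Lemma slice_clifford w : in_sphere w -> forall i j, Mw w i *m Kw w j + Mw w j *m Kw w i = (2 * (i == j)%:R)%:M.
Proof.
move=> w1 i j; rewrite -[i]splitK -[j]splitK /Mw /Kw !unsplitK.
have JJ : JV V w *m JV V w = (-1)%:M by rewrite JV_sq // w1.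
case: (fintype.split i) (fintype.split j) => [s|s] [t|t] /=.
- by rewrite (inj_eq (@lshift_inj _ _)) E_Eb.
- by rewrite eq_lrshift mulr0 raddf0 mulmxN (E_JV EV) addNr.
- by rewrite eq_rlshift mulr0 raddf0 mulmxN (E_JV EV) subrr.
- by rewrite (ord1 s) (ord1 t) eqxx mulr1 mulmxN JJ -opprD -raddfD -raddfN; congr (_%:M); ring.
Qed.

Lemma slice_isD w i z : in_sphere w -> U z -> isD (fun z => f (inslice w z)) z (delta_mx 0 i) (dslice w i z).
Proof.
move=> w1 Uz; have [Ds [Dr _] _] := fD w1 (UOm w1 Uz).
rewrite -[i]splitK /dslice unsplitK; case: (fintype.split i) => [s|s] /=.
  exact: (isD_comp_lin (fun h => inslice_fs w z s h) (derivable_isD (Ds s).1)).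
rewrite (ord1 s); exact: (isD_comp_lin (fun h => inslice_lst w z h) (derivable_isD Dr)).
Qed.

Lemma slice_dcont w i z : in_sphere w -> U z -> contAt (dslice w i) z.
Proof.
move=> w1 Uz; have [Ds [_ cr] _] := fD w1 (UOm w1 Uz).
rewrite /dslice; case: (fintype.split i) => [s|_]; first exact: (contAt_slice (Ds s).2).
exact: (contAt_slice cr).
Qed.

Lemma slice_harmonic w : in_sphere w -> harmonic_val U (fun z => f (inslice w z)).
Proof.
move=> w1 k a rho rho' rr sub.
apply: (dirac_approxH (slice_clifford w1) (du := dslice w) k rr) => z /sub Uz.
split=> [i|i|]; [exact: slice_isD|exact: slice_dcont|].
have [_ _ H] := fD w1 (UOm w1 Uz).
rewrite big_split_ord big_ord1 /=.
rewrite /Mw /dslice split_lst -[RHS]H; congr (_ + _).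
by apply: eq_bigr => s _; rewrite split_fs.
Qed.

Lemma slice_pd w i z : in_sphere w -> U z -> pd i (fun z => f (inslice w z)) z = dslice w i z.
Proof. by move=> w1 Uz; apply: isD_pd; exact: slice_isD. Qed.

Lemma slice_dirac w z : in_sphere w -> U z ->
  genD E (fun z => f (inslice w z)) z + pd lst (fun z => f (inslice w z)) z *m JV V w = 0.
Proof.
move=> w1 Uz; have [_ _ H] := fD w1 (UOm w1 Uz).
have A : genD E (fun z => f (inslice w z)) z = \sum_s 'D_(eX R (lshift q s)) f (inslice w z) *m E s.
  by apply: eq_bigr => s _; rewrite (slice_pd (fs s) w1 Uz) /dslice split_fs.
have B : pd lst (fun z => f (inslice w z)) z = 'D_(eR p w) f (inslice w z).
  by rewrite (slice_pd lst w1 Uz) /dslice split_lst.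
by rewrite A B; exact: H.
Qed.

Lemma in_sphereN (w : 'rV[R]_q) : in_sphere w -> in_sphere (- w).
Proof. by rewrite /in_sphere => w1; rewrite -[RHS]w1; apply: eq_bigr => j _; rewrite mxE sqrrN. Qed.

Lemma sc_lsubmx s (z : Z) : lsubmx (sc lst s z) = lsubmx z.
Proof. by apply/rowP => j; rewrite !mxE eq_lrshift andbF mulr0 addr0. Qed.

Lemma sc_lst s (z : Z) : sc lst s z ord0 lst = s * z ord0 lst.
Proof. by rewrite scE eqxx. Qed.

(** Negative radii on the slice of [w] are positive radii on that of [- w]: parity in [r] compares
    opposite slices. *)
Lemma inslice_refl w z : inslice w (sc lst (-1) z) = inslice (- w) z.
Proof. by rewrite /inslice sc_lsubmx sc_lst mulN1r /slice_pt /= scalerN scaleNr. Qed.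

Let uw w := fun z => f (inslice w z).
Let ew w := even_part (uw w) (uw (- w)).

Section AtUnit.
Variable w : 'rV[R]_q.
Hypothesis w1 : in_sphere w.

Let Hu : harmonic_val U (uw w) := slice_harmonic w1.
Let Hub : harmonic_val U (uw (- w)) := slice_harmonic (in_sphereN w1).

Let J2 : JV V w *m JV V w = - 1%:M.
Proof. by rewrite JV_sq // w1 raddfN. Qed.

Let EJ s : E s *m JV V w = JV V w *m Eb E s.
Proof. exact: E_JV. Qed.

Let ubE z : U z -> uw w (sc lst (-1) z) = uw (- w) z.
Proof. by move=> _; rewrite /uw inslice_refl. Qed.

Let Du z : U z -> genD E (uw w) z + pd lst (uw w) z *m JV V w = 0.
Proof. exact: slice_dirac. Qed.

Let Dub z : U z -> genD E (uw (- w)) z - pd lst (uw (- w)) z *m JV V w = 0.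
Proof. by move=> Uz; have := slice_dirac (in_sphereN w1) Uz; rewrite JVN mulmxN. Qed.

Lemma slice_even_harmonic : harmonic_val U (ew w).
Proof. exact: (harmonic_even_part Hu Hub). Qed.

Lemma slice_even_even : even_on lst U (ew w).
Proof. exact: (even_part_even Usc ubE). Qed.

Lemma slice_even_laplace : laplace_on U (ew w).
Proof. exact: (laplace_even_part Uopen E0 Ecliff J2 EJ Hu Hub Du Dub). Qed.

Lemma slice_even_at0 y : ew w (row_mx y 0) = f (row_mx y 0).
Proof.
have I0 w' : inslice w' (row_mx y 0) = row_mx y 0.
  by rewrite /inslice row_mxKl /slice_pt /= mxE split_lst mxE scale0r.
by rewrite /ew /even_part /uw !I0; move: (f _) => a; apply/rowP => j; rewrite !mxE; field.
Qed.

Lemma slice_even_pd z : U z -> pd lst (ew w) z = - (z ord0 lst *: genD (Eb E) (Avg lst 0 (genD E (ew w))) z).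
Proof.
move=> Uz; rewrite (pd_even_part Uopen J2 EJ Hu Hub Du Dub Uz); congr (- _).
rewrite -(genD_radius _ (smooth_stem Uopen Usc E slice_even_harmonic) Uz).
apply: (genD_eq_on Uopen _ _ Uz) => y Uy.
exact: (odd_stem_radius Uopen Usc Hu Hub ubE Du Dub Uy).
Qed.

Lemma slice_decompose z : U z -> f (inslice w z) = ew w z + (z ord0 lst *: Avg lst 0 (genD E (ew w)) z) *m JV V w.
Proof.
move=> Uz; rewrite -(odd_stem_radius Uopen Usc Hu Hub ubE Du Dub Uz).
exact: (slice_recompose (uw w) (uw (- w)) J2 Uz).
Qed.

End AtUnit.

(** Both even parts solve Laplace's equation and restrict to [f] at radius 0, where all slices meet;
    [even_laplace_unique] applies to their difference. *)
Lemma slice_even_indep w w' : in_sphere w -> in_sphere w' -> forall z, U z -> ew w z = ew w' z.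
Proof.
move=> w1 w1' z Uz.
have H1 := slice_even_harmonic w1; have H2 := slice_even_harmonic w1'.
have S1 := harmonic_val_smooth Uopen H1; have S2 := harmonic_val_smooth Uopen H2.
have H2' := harmonic_val_Z (-1) H2; have S2' := smooth_Z Uopen (-1) S2.
suff : ew w z + (-1) *: ew w' z = 0 by move/eqP; rewrite scaleN1r subr_eq0 => /eqP.
move: z Uz; apply: (even_laplace_unique Uopen Usc (harmonic_val_D H1 H2')).
- by move=> z Uz; rewrite (slice_even_even w Uz) (slice_even_even w' Uz).
- move=> z Uz.
  have D2 i : pd i (pd i (fun z => ew w z + (-1) *: ew w' z)) z = pd i (pd i (ew w)) z + (-1) *: pd i (pd i (ew w')) z.
    have D1 y : U y -> pd i (fun z => ew w z + (-1) *: ew w' z) y = pd i (ew w) y + (-1) *: pd i (ew w') y.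
      by move=> Uy; rewrite (pdD i S1 S2' Uy) (pdZ (-1) i S2 Uy).
    rewrite (eq_on_pd Uopen i D1 Uz).
    rewrite (pdD i (smooth_pd i S1) (smooth_Z Uopen (-1) (smooth_pd i S2)) Uz).
    by rewrite (pdZ (-1) i (smooth_pd i S2) Uz).
  have L1 := slice_even_laplace w1 Uz; have L2 := slice_even_laplace w1' Uz.
  rewrite /lapl (eq_bigr (fun i => pd i (pd i (ew w)) z + (-1) *: pd i (pd i (ew w')) z)) => [|i _]; last exact: D2.
  rewrite big_split -scaler_sumr D2 addrACA -scalerDr.
  rewrite /lapl in L1 L2; refine (etrans (congr2 +%R L1 (congr1 (fun a => -1 *: a) L2)) _).
  by rewrite scaler0 addr0.
- by move=> y Uy; rewrite (slice_even_at0 w) (slice_even_at0 w') scaleN1r subrr.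
Qed.

Lemma slice_representation : (0 < q)%N -> exists e : Z -> cod,
  [/\ harmonic_val U e, even_on lst U e, laplace_on U e,
      forall z, U z -> pd lst e z = - (z ord0 lst *: genD (Eb E) (Avg lst 0 (genD E e)) z) &
      (forall y, e (row_mx y 0) = f (row_mx y 0)) /\
      forall w z, in_sphere w -> U z -> f (inslice w z) = e z + (z ord0 lst *: Avg lst 0 (genD E e) z) *m JV V w].
Proof.
move=> q0; pose w0 : 'rV[R]_q := delta_mx 0 (Ordinal q0).
have w1 : in_sphere w0.
  rewrite /in_sphere (bigD1 (Ordinal q0)) //= mxE !eqxx expr1n big1 ?addr0 // => j j0.
  by rewrite mxE (negbTE j0) andbF expr0n.
exists (ew w0); split; [exact: slice_even_harmonic|exact: slice_even_even|exact: slice_even_laplace| |].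
  by move=> z; exact: slice_even_pd.
split=> [y|w z wS Uz]; first exact: slice_even_at0.
have I := slice_even_indep wS w1.
have D : Avg lst 0 (genD E (ew w)) z = Avg lst 0 (genD E (ew w0)) z.
  by apply: (Avg_eq_on Usc 0 _ Uz) => y Uy; exact: (genD_eq_on Uopen E I Uy).
exact: (etrans (slice_decompose wS Uz) (congr2 (fun a b => a + (z ord0 lst *: b) *m JV V w) (I z Uz) D)).
Qed.

End SliceRepresentation.

(** * Functions of the radius in the full space *)

Section XSpace.
Variables (R : realType) (d p q : nat).
Local Notation Z := 'rV[R]_(p.+1 + 1).
Local Notation cod := 'rV[R]_d.
Local Notation lst := (rshift p.+1 (ord0 : 'I_1)).
Local Notation fs s := (lshift 1 (s : 'I_p.+1)).
Local Notation pt := 'rV[R]_(p.+1 + q).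
Implicit Types (G H : Z -> cod) (x : pt).

(** The slice point with radius [|x_q|]. The square root is not differentiable at 0, so functions of
    [rho x] are differentiated through the polynomial [r2 x]. *)
Definition rho x : Z := row_mx (xpart x) (const_mx (Num.sqrt (r2 x))).

Lemma rho_lsub x : lsubmx (rho x) = xpart x.
Proof. exact: row_mxKl. Qed.

Lemma rho_lst x : rho x ord0 lst = Num.sqrt (r2 x).
Proof. by rewrite row_mxEr mxE. Qed.

Lemma r2_ge0 x : 0 <= r2 x.
Proof. by apply: sumr_ge0 => j _; exact: sqr_ge0. Qed.

Lemma rho_lst_sq x : rho x ord0 lst ^+ 2 = r2 x.
Proof. by rewrite rho_lst sqr_sqrtr // r2_ge0. Qed.

Lemma rho_lst_ge0 x : 0 <= rho x ord0 lst.
Proof. by rewrite rho_lst sqrtr_ge0. Qed.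

Lemma contAt_r2 x : contAt (@r2 R p q) x.
Proof.
apply: contAt_sum => j _.
apply: (@contAt_comp _ _ _ _ (fun a : R => a ^+ 2) (fun x : pt => xqpart x ord0 j)).
  have -> : (fun x : pt => xqpart x ord0 j) = (fun x : pt => x ord0 (rshift p.+1 j)).
    by apply/funext => y; rewrite mxE.
  exact: contAt_entry.
by apply/contAtP; exact: exprn_continuous.
Qed.

Lemma contAt_rho x : contAt rho x.
Proof.
apply/contAt_coord => j; rewrite -[j]splitK; case: (fintype.split j) => i /=.
  have -> : (fun y => rho y ord0 (lshift 1 i)) = (fun y : pt => y ord0 (lshift q i)).
    by apply/funext => y; rewrite row_mxEl mxE.
  exact: contAt_entry.
have -> : (fun y => rho y ord0 (rshift p.+1 i)) = (fun y => Num.sqrt (r2 y)).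
  by apply/funext => y; rewrite row_mxEr mxE.
apply: (contAt_comp (contAt_r2 x)); apply/contAtP; exact: sqrt_continuous.
Qed.

Lemma xpart_stepP x (s : 'I_p.+1) (h : R) : xpart (x + h *: eX R (lshift q s)) = xpart x + h *: delta_mx 0 s.
Proof. by apply/rowP => j; rewrite !mxE (inj_eq (@lshift_inj _ _)). Qed.

Lemma xqpart_stepP x (s : 'I_p.+1) (h : R) : xqpart (x + h *: eX R (lshift q s)) = xqpart x.
Proof. by apply/rowP => j; rewrite !mxE eq_rlshift andbF mulr0 addr0. Qed.

Lemma xpart_stepQ x (j : 'I_q) (h : R) : xpart (x + h *: eX R (rshift p.+1 j)) = xpart x.
Proof. by apply/rowP => i; rewrite !mxE eq_lrshift andbF mulr0 addr0. Qed.

Lemma xqpart_stepQ x (j : 'I_q) (h : R) : xqpart (x + h *: eX R (rshift p.+1 j)) = xqpart x + h *: delta_mx 0 j.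
Proof. by apply/rowP => i; rewrite !mxE (inj_eq (@rshift_inj _ _)). Qed.

Lemma rho_stepP x (s : 'I_p.+1) (h : R) : rho (x + h *: eX R (lshift q s)) = rho x + h *: delta_mx 0 (fs s).
Proof.
rewrite /rho /r2 xpart_stepP xqpart_stepP; apply/rowP => j; rewrite -[j]splitK.
case: (fintype.split j) => i /=.
  by rewrite row_mxEl !mxE (unsplitK (inl i)) !mxE (inj_eq (@lshift_inj _ _)).
by rewrite row_mxEr !mxE (unsplitK (inr i)) !mxE eq_rlshift andbF mulr0 addr0.
Qed.

Lemma r2_stepQ x (j : 'I_q) (h : R) : r2 (x + h *: eX R (rshift p.+1 j)) = r2 x + (2 * xqpart x ord0 j * h + h ^+ 2).
Proof.
rewrite /r2 xqpart_stepQ (bigD1 j) //= [in RHS](bigD1 j) //= !mxE !eqxx.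
rewrite (eq_bigr (fun i => xqpart x ord0 i ^+ 2)) => [|i ij]; last first.
  by rewrite !mxE (negbTE ij) mulr0 addr0.
rewrite andTb mulr1n mulr1; move: (\sum_(i | _) _) => S; ring.
Qed.

Lemma rho_stepQ x (j : 'I_q) (h : R) : let y := x + h *: eX R (rshift p.+1 j) in
  rho y = rho x + (Num.sqrt (r2 y) - Num.sqrt (r2 x)) *: delta_mx 0 lst.
Proof.
move=> y; rewrite {1}/rho xpart_stepQ -/y; apply/rowP => i; rewrite -[i]splitK.
case: (fintype.split i) => k /=.
  by rewrite row_mxEl !mxE (unsplitK (inl k)) !mxE eq_lrshift mulr0 addr0.
by rewrite row_mxEr (ord1 k) !mxE split_lst !mxE !eqxx mulr1 addrC subrK.
Qed.

Variable U : set Z.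
Hypothesis Uopen : forall x : Z, U x -> exists2 r : R, 0 < r & forall y, `|y - x| < r -> U y.
Hypothesis Usc : forall s z, -1 <= s <= 1 -> U z -> U (sc lst s z).
Local Notation smth := (smooth U).
Local Notation even := (even_on lst U).
Local Notation T := (Trad lst).

Definition rhoU : set pt := [set x | U (rho x)].

Lemma rhoU_open x : rhoU x -> exists2 r : R, 0 < r & forall y, `|y - x| < r -> rhoU y.
Proof.
move=> /Uopen [r r0 Hr]; have r2 : 0 < r / 2 by rewrite divr_gt0.
have [s s0 Hs] := contAt_rho x r2; exists s => // y /Hs hy; apply: Hr.
by apply: le_lt_trans hy _; lra.
Qed.

(* [T G] is the derivative of [G] with respect to half the square of the radius;
   in this form the estimate does not degenerate at radius [0]. *)
Lemma half_square_step G z (eps : R) : smth G -> even G -> U z -> 0 <= z ord0 lst -> 0 < eps ->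
  exists2 dl : R, 0 < dl & forall t : R, `|t| < dl -> 0 <= z ord0 lst + t ->
    `|G (z + t *: delta_mx 0 lst) - G z - (((z ord0 lst + t) ^+ 2 - z ord0 lst ^+ 2) / 2) *: T G z|
      <= eps * `|((z ord0 lst + t) ^+ 2 - z ord0 lst ^+ 2) / 2|.
Proof.
move=> SG EG Uz z0 e0.
have ST := smooth_Trad Uopen Usc SG.
have [r1 r10 Hr1] := Uopen Uz.
have [r2 r20 Hr2] := smooth_cont ST Uz e0.
exists (Num.min r1 r2); first by rewrite lt_min r10.
move=> t; rewrite lt_min => /andP [t1 t2].
set rr := z ord0 lst in z0 *; move=> zt.
(* The derivative of [g] is the radius [rr + s] times a variation of [T G], hence dominated by [eps]
   times the derivative of half the squared radius. *)
pose g (s : R) := G (z + s *: delta_mx 0 lst) - ((rr + s) ^+ 2 / 2) *: T G z.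
pose dg (s : R) := (rr + s) *: T G (z + s *: delta_mx 0 lst) - (rr + s) *: T G z.
pose B (s : R) := eps * ((rr + s) ^+ 2 / 2).
have dsq (s : R) : isD (fun s : R => (rr + s) ^+ 2 / 2) s 1 (rr + s).
  move=> e ee0; exists e => // h he; rewrite [h *: (1 : R)]mulr1 [h *: (rr + s)]mulrC.
  have -> : (rr + (s + h)) ^+ 2 / 2 - (rr + s) ^+ 2 / 2 - (rr + s) * h = h * (h / 2) by field.
  rewrite normrM mulrC ler_wpM2r // normrM [`|2^-1|]gtr0_norm ?invr_gt0 //; lra.
have dB (s : R) : isD B s 1 (eps * (rr + s)) by exact: (isDZ eps (dsq s)).
have close (s : R) : `|s| <= `|t| -> `|z + s *: delta_mx 0 lst - z| < r1 /\ `|z + s *: delta_mx 0 lst - z| < r2.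
  move=> st; rewrite [z + _]addrC addrK normrZ.
  have le : `|s| * `|delta_mx 0 lst : Z| <= `|t|.
    by apply: le_trans st; rewrite ler_piMr // norm_delta.
  by split; exact: le_lt_trans le _.
have Dg (s : R) : `|s| <= `|t| -> isD g s 1 (dg s).
  move=> st; have [/Hr1 Us _] := close s st.
  apply: isDB; last first.
    have := isDZf (dsq s) (isD_cst (T G z) s 1).
    by rewrite scaler0 add0r.
  have zc : (z + s *: delta_mx 0 lst) ord0 lst = rr + s by rewrite !mxE !eqxx mulr1.
  have E := pd_Trad Uopen Usc SG EG Us; rewrite zc in E.
  exact: ((isD_line G z (delta_mx 0 lst) s _).1 (isD_eqdir (smooth_isD lst SG Us) erefl E)).
have Bd (s : R) : `|s| <= `|t| -> 0 <= rr + s -> `|dg s| <= eps * (rr + s).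
  move=> st rs; have [_ /Hr2 h] := close s st.
  by rewrite /dg -scalerBr normrZ ger0_norm // mulrC ler_wpM2r.
have concl : `|g t - g 0| <= eps * `|((rr + t) ^+ 2 - rr ^+ 2) / 2|.
  have E : B t - B 0 = eps * (((rr + t) ^+ 2 - rr ^+ 2) / 2) by rewrite /B; field.
  have [t0|t0] := leP 0 t.
    have inr (s : R) : 0 <= s <= t -> `|s| <= `|t|.
      by move=> /andP [s0 s1]; rewrite !ger0_norm.
    apply: le_trans (mvt_dom t0 (fun s h => Dg s (inr s h)) (fun s _ => dB s) _) _.
      by move=> s h; apply: Bd (inr s h) _; case/andP: h => s0 _; rewrite addr_ge0.
    by rewrite E ler_wpM2l ?ler_norm // ltW.
  have inr (s : R) : t <= s <= 0 -> `|s| <= `|t|.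
    by move=> /andP [s0 s1]; rewrite !ler0_norm ?lerN2 // ltW.
  rewrite distrC; apply: le_trans (mvt_dom (ltW t0) (fun s h => Dg s (inr s h)) (fun s _ => dB s) _) _.
    move=> s h; apply: Bd (inr s h) _; case/andP: h => s0 _; apply: le_trans zt _; by rewrite lerD2l.
  by rewrite -opprB E -mulrN ler_wpM2l ?(ltW e0) // -normrN ler_norm.
suff -> : G (z + t *: delta_mx 0 lst) - G z - (((rr + t) ^+ 2 - rr ^+ 2) / 2) *: T G z = g t - g 0 by [].
rewrite /g scale0r !addr0 mulrBl scalerBl.
move: (G (z + _)) (G z) (((rr + t) ^+ 2 / 2) *: T G z) ((rr ^+ 2 / 2) *: T G z) => a b c e'.
by apply/rowP => j; rewrite !mxE; ring.
Qed.

Lemma isD_rhoP G x s : smth G -> rhoU x ->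
  isD (fun x => G (rho x)) x (eX R (lshift q s)) (pd (fs s) G (rho x)).
Proof. by move=> SG Ux; exact: (isD_comp_lin (fun h => rho_stepP x s h) (smooth_isD (fs s) SG Ux)). Qed.

(** [T G] is the derivative in half the squared radius, whose derivative in [x_j] is [x_j]; this
    holds at radius 0 as well. *)
Lemma isD_rhoQ G x (j : 'I_q) : smth G -> even G -> rhoU x ->
  isD (fun x => G (rho x)) x (eX R (rshift p.+1 j)) (xqpart x ord0 j *: T G (rho x)).
Proof.
move=> SG EG Ux e e0; set a := xqpart x ord0 j; set D := T G (rho x).
have a1 : 0 < `|a| + 1 by rewrite ltr_wpDl.
have D1 : 0 < `|D| + 1 by rewrite ltr_wpDl.
(* Half of [e] pays for [half_square_step], where the increment is at most [|h| (|a| + 1)]; the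
   other half pays for the term [h^2 / 2] of that increment. *)
have e3 : 0 < e / (2 * (`|a| + 1)) by rewrite divr_gt0 // mulr_gt0.
have [dl dl0 Hd] := half_square_step SG EG Ux (rho_lst_ge0 x) e3.
have [r1 r10 Hr1] := contAt_rho x (divr_gt0 dl0 (ltr0n R 2)).
exists (Num.min (Num.min r1 1) (e / (`|D| + 1))); first by rewrite !lt_min r10 ltr01 divr_gt0.
move=> h; rewrite !lt_min => /andP [/andP [h1 hh1] hD].
set y := x + h *: eX R (rshift p.+1 j); set t := Num.sqrt (r2 y) - Num.sqrt (r2 x).
have yx : `|y - x| < r1.
  rewrite /y [x + _]addrC addrK normrZ; apply: le_lt_trans h1.
  by rewrite ler_piMr // norm_delta.
have Ey : rho y = rho x + t *: delta_mx 0 lst := rho_stepQ x j h.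
have zt : rho x ord0 lst + t = Num.sqrt (r2 y) by rewrite rho_lst /t addrC subrK.
have td : `|t| < dl.
  have := le_trans (rV_norm_coord (rho y - rho x) ord0 lst) (Hr1 y yx).
  rewrite Ey [rho x + _]addrC addrK !mxE !eqxx mulr1 => /le_lt_trans; apply; lra.
have := Hd t td; rewrite zt sqrtr_ge0 rho_lst !sqr_sqrtr ?r2_ge0 // -Ey => /(_ isT).
rewrite /y r2_stepQ -/y -/a -/D [_ + _ - r2 x]addrC addKr.
set k := (2 * a * h + h ^+ 2) / 2; move=> step.
have Ek : k = h * a + h * (h / 2) by rewrite /k; field.
have -> : G (rho y) - G (rho x) - h *: (a *: D) = (G (rho y) - G (rho x) - k *: D) + (h * (h / 2)) *: D.
  by rewrite Ek scalerDl scalerA opprD addrA addrNK.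
apply: le_trans (ler_normD _ _) _.
have k_le : `|k| <= `|h| * (`|a| + 1).
  rewrite Ek; apply: le_trans (ler_normD _ _) _; rewrite !normrM mulrDr lerD2l ler_wpM2l //.
  by rewrite [`|2^-1|]gtr0_norm ?invr_gt0 //; lra.
have s1 : e / (2 * (`|a| + 1)) * `|k| <= (e / 2) * `|h|.
  apply: le_trans (ler_wpM2l (ltW e3) k_le) _.
  suff -> : e / (2 * (`|a| + 1)) * (`|h| * (`|a| + 1)) = e / 2 * `|h| by [].
  by field; rewrite gt_eqF.
have s2 : `|(h * (h / 2)) *: D| <= (e / 2) * `|h|.
  rewrite normrZ !normrM [`|2^-1|]gtr0_norm ?invr_gt0 //.
  have : `|h| * (`|D| + 1) <= e by rewrite -ler_pdivlMr // ltW.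
  have : 0 <= `|h| * `|D| by rewrite mulr_ge0.
  have := normr_ge0 h; move: (`|h|) (`|D|) => u w; nra.
by apply: le_trans (lerD (le_trans step s1) s2) _; rewrite -mulrDl -splitr.
Qed.

Variable V : 'I_q -> 'M[R]_d.
Local Notation W x := (JV V (xqpart x)).

Lemma mul_JV (y : cod) (w : 'rV[R]_q) : y *m JV V w = \sum_j w ord0 j *: (y *m V j).
Proof. by rewrite /JV mulmx_sumr; apply: eq_bigr => j _; rewrite scalemxAr. Qed.

Lemma isD_WP H x s : smth H -> rhoU x ->
  isD (fun x => H (rho x) *m W x) x (eX R (lshift q s)) (pd (fs s) H (rho x) *m W x).
Proof.
move=> SH Ux.
apply: (isD_eqdir (d := \sum_j (xqpart x ord0 j *: (pd (fs s) H (rho x) *m V j) + 0 *: (H (rho x) *m V j))));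
  [|reflexivity|].
  have -> : (fun x => H (rho x) *m W x) = (fun x => \sum_j xqpart x ord0 j *: (H (rho x) *m V j)).
    by apply/funext => y; rewrite mul_JV.
  apply: isD_sum => j _; apply: isDZf; last exact: (isD_mulmx _ (isD_rhoP s SH Ux)).
  move=> e e0; exists 1 => // h _; rewrite xqpart_stepP subrr sub0r scaler0 oppr0 normr0.
  by rewrite mulr_ge0 // ltW.
by rewrite mul_JV; apply: eq_bigr => j _; rewrite scale0r addr0.
Qed.

Lemma isD_WQ H x j : smth H -> even H -> rhoU x ->
  isD (fun x => H (rho x) *m W x) x (eX R (rshift p.+1 j))
    (xqpart x ord0 j *: (T H (rho x) *m W x) + H (rho x) *m V j).
Proof.
move=> SH EH Ux.
apply: (isD_eqdir (d := \sum_i (xqpart x ord0 i *: ((xqpart x ord0 j *: T H (rho x)) *m V i) + (i == j)%:R *: (H (rho x) *m V i))));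
  [|reflexivity|].
  have -> : (fun x => H (rho x) *m W x) = (fun x => \sum_j xqpart x ord0 j *: (H (rho x) *m V j)).
    by apply/funext => y; rewrite mul_JV.
  apply: isD_sum => i _; apply: isDZf; last exact: (isD_mulmx _ (isD_rhoQ j SH EH Ux)).
  move=> e e0; exists 1 => // h _; rewrite xqpart_stepQ !mxE.
  rewrite [_ *: (_ == _)%:R]/(_ * _) [x ord0 _ + _]addrC addrK subrr normr0.
  by rewrite mulr_ge0 // ltW.
rewrite big_split; congr (_ + _).
  rewrite mul_JV scaler_sumr; apply: eq_bigr => i _.
  by rewrite -scalemxAl !scalerA mulrC.
rewrite (bigD1 j) //= eqxx scale1r big1 ?addr0 // => i ij.
by rewrite (negbTE ij) scale0r.
Qed.

Definition XF G H x : cod := G (rho x) + H (rho x) *m W x.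

Lemma radial_second_diff (a : R) (g1 h1 g2 h2 t : cod) (M : 'M[R]_d) :
  a *: (a *: g2 + (a *: h2 + t *m M)) + 1 *: (g1 + h1) + (a *: t) *m M =
  (g1 + h1) + a ^+ 2 *: (g2 + h2) + (2 * a) *: (t *m M).
Proof. by rewrite -scalemxAl; move: (t *m M) => b; apply/rowP => i; rewrite !mxE; ring. Qed.

(** The q directions contribute [q g + r g2], and the radial equation replaces [r g2] plus the
    Laplacian in [x_p] by [- cG g]. For the other part the product rule with [x_q] adds a cross term
    worth [2 h], whence [q + 2 - cH]. *)
Lemma radial_laplacian_sum (c cG cH : R) (w : 'rV[R]_q) (n : nat) (P Q : 'I_n -> cod) (g g2 h h2 : cod) :
  let r := \sum_j w ord0 j ^+ 2 in
  \sum_s P s + cG *: g + r *: g2 = 0 -> \sum_s Q s + cH *: h + r *: h2 = 0 ->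
  \sum_s c *: (P s + Q s *m JV V w) +
    \sum_j c *: ((g + h *m JV V w) + w ord0 j ^+ 2 *: (g2 + h2 *m JV V w) + (2 * w ord0 j) *: (h *m V j)) =
  c *: ((q%:R - cG) *: g + (q%:R + 2 - cH) *: (h *m JV V w)).
Proof.
move=> r Hg Hh; rewrite -!scaler_sumr -scalerDr !big_split -mulmx_suml -scaler_suml -/r; congr (_ *: _).
have -> : \sum_j (2 * w ord0 j) *: (h *m V j) = 2 *: (h *m JV V w).
  by rewrite mul_JV scaler_sumr; apply: eq_bigr => j _; rewrite scalerA.
have -> : \sum_(j < q) g = q%:R *: g by rewrite sumr_const card_ord scaler_nat.
have -> : \sum_(j < q) (h *m JV V w) = q%:R *: (h *m JV V w) by rewrite sumr_const card_ord scaler_nat.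
have -> : \sum_s P s = - (cG *: g + r *: g2) by apply/eqP; rewrite -addr_eq0 addrA Hg.
have -> : \sum_s Q s = - (cH *: h + r *: h2) by apply/eqP; rewrite -addr_eq0 addrA Hh.
rewrite mulNmx mulmxDl -!scalemxAl.
move: (h *m _) (h2 *m _) => u u2; apply/rowP => i; rewrite !mxE; ring.
Qed.

Lemma lapX_XF (c cG cH : R) (F : pt -> cod) G H : smth G -> even G -> smth H -> even H ->
  radial_eq lst U cG G -> radial_eq lst U cH H -> (forall x, rhoU x -> F x = c *: XF G H x) ->
  forall x, rhoU x -> lapX F x = c *: ((q%:R - cG) *: T G (rho x) + (q%:R + 2 - cH) *: (T H (rho x) *m W x)).
Proof.
move=> SG EG SH EH RG RH EF x Ux.
have STG := smooth_Trad Uopen Usc SG; have ETG := even_Trad Uopen Usc SG EG.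
have STH := smooth_Trad Uopen Usc SH; have ETH := even_Trad Uopen Usc SH EH.
have DP1 s y : rhoU y -> pd (lshift q s) F y = c *: (pd (fs s) G (rho y) + pd (fs s) H (rho y) *m W y).
  move=> Uy; apply: isD_pd; apply: (isD_eq_on rhoU_open (f := fun x => c *: XF G H x)) => //.
    by move=> z /EF.
  by apply: isDZ; apply: isDD; [exact: isD_rhoP|exact: isD_WP].
have DP2 s : pd (lshift q s) (pd (lshift q s) F) x = c *: (pd (fs s) (pd (fs s) G) (rho x) + pd (fs s) (pd (fs s) H) (rho x) *m W x).
  apply: isD_pd; apply: (isD_eq_on rhoU_open (f := fun y => c *: (pd (fs s) G (rho y) + pd (fs s) H (rho y) *m W y))) => //.
    by move=> z /DP1.
  by apply: isDZ; apply: isDD; [exact: (isD_rhoP s (smooth_pd _ SG) Ux)|exact: (isD_WP s (smooth_pd _ SH) Ux)].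
have DQ1 j y : rhoU y -> pd (rshift p.+1 j) F y = c *: (xqpart y ord0 j *: (T G (rho y) + T H (rho y) *m W y) + H (rho y) *m V j).
  move=> Uy; apply: isD_pd; apply: (isD_eq_on rhoU_open (f := fun x => c *: XF G H x)) => //.
    by move=> z /EF.
  apply: isDZ; rewrite scalerDr -addrA.
  by apply: isDD; [exact: (isD_rhoQ j SG EG Uy)|exact: (isD_WQ j SH EH Uy)].
have xj j : isD (fun y : pt => xqpart y ord0 j) x (eX R (rshift p.+1 j)) 1.
  move=> e e0; exists 1 => // h _; rewrite xqpart_stepQ !mxE !eqxx.
  by rewrite [_ *: 1]mulr1 mulr1 [x ord0 _ + _]addrC addrK subrr normr0 mulr_ge0 // ltW.
have DQ2 j : pd (rshift p.+1 j) (pd (rshift p.+1 j) F) x =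
    c *: ((T G (rho x) + T H (rho x) *m W x) + (xqpart x ord0 j) ^+ 2 *: (T (T G) (rho x) + T (T H) (rho x) *m W x)
       + (2 * xqpart x ord0 j) *: (T H (rho x) *m V j)).
  apply: isD_pd; apply: (isD_eq_on rhoU_open (f := fun y => c *: (xqpart y ord0 j *: (T G (rho y) + T H (rho y) *m W y) + H (rho y) *m V j))) => //.
    by move=> z /DQ1.
  apply: isDZ.
  have D1 := isDD (isD_rhoQ j STG ETG Ux) (isD_WQ j STH ETH Ux).
  have D2 := isDD (isDZf (xj j) D1) (isD_mulmx (V j) (isD_rhoQ j SH EH Ux)).
  exact: (isD_eqdir D2 erefl (radial_second_diff _ _ _ _ _ _ _)).
have L (g : Z -> cod) : lapl lst g (rho x) = \sum_s pd (fs s) (pd (fs s) g) (rho x) := sum_fs _.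
have RG' : \sum_s pd (fs s) (pd (fs s) G) (rho x) + cG *: T G (rho x) + r2 x *: T (T G) (rho x) = 0.
  by rewrite -(L G) -(rho_lst_sq x); exact: (RG _ Ux).
have RH' : \sum_s pd (fs s) (pd (fs s) H) (rho x) + cH *: T H (rho x) + r2 x *: T (T H) (rho x) = 0.
  by rewrite -(L H) -(rho_lst_sq x); exact: (RH _ Ux).
refine (etrans _ (radial_laplacian_sum c RG' RH')).
have -> : lapX F x = \sum_(s < p.+1) pd (lshift q s) (pd (lshift q s) F) x
    + \sum_(j < q) pd (rshift p.+1 j) (pd (rshift p.+1 j) F) x by exact: big_split_ord.
apply: congr2; apply: eq_bigr => i _; [exact: DP2|exact: DQ2].
Qed.

(** * Iterated Laplacians in the full space and their even and odd parts *)

Section Iterate.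
Variables (E : 'I_p.+1 -> 'M[R]_d).
Hypothesis Vcliff : forall j k, V j *m V k + V k *m V j = (- 2 * (j == k)%:R)%:M.
Hypothesis EV : forall s j, E s *m V j = V j *m Eb E s.
Variables (e h : Z -> cod) (f : pt -> cod).
Hypotheses (Se : smth e) (Ee : even e) (Re : radial_eq lst U 1 e).
Hypotheses (Sh : smth h) (Eh : even h) (Rh : radial_eq lst U 3 h).
Hypothesis fE : forall x, rhoU x -> f x = XF e h x.

(** After [i] steps the constants of the two parts are [1 + 2 i] and [3 + 2 i], so [q - (1 + 2 i)]
    and [q + 2 - (3 + 2 i)] coincide and a single product serves both. *)
Definition lap_coef (k : nat) : R := \prod_(i < k) (q%:R - 1 - i.*2%:R).

Lemma iter_lapX k x : rhoU x ->
  iter k (@lapX R d p q) f x = lap_coef k *: XF (iter k T e) (iter k T h) x.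
Proof.
elim: k x => [|k IH] x Ux; first by rewrite /lap_coef big_ord0 scale1r; exact: fE.
have Rek := radial_eq_iterT Uopen Usc k Se Ee Re.
have Rhk := radial_eq_iterT Uopen Usc k Sh Eh Rh.
rewrite !iterS (lapX_XF (smooth_iterT Uopen Usc k Se) (even_iterT Uopen Usc k Se Ee)
  (smooth_iterT Uopen Usc k Sh) (even_iterT Uopen Usc k Sh Eh) Rek Rhk IH Ux).
rewrite /lap_coef big_ord_recr -scalerA; congr (_ *: _); rewrite /XF scalerDr.
by congr (_ *: _ + _ *: _); ring.
Qed.

Lemma sum_VV (y : cod) : \sum_j y *m V j *m V j = - (q%:R *: y).
Proof.
have VV j : V j *m V j = - 1%:M.
  have two : (2 : R) != 0 by rewrite pnatr_eq0.
  apply: (scalerI two); rewrite [LHS]scalerDl scale1r Vcliff eqxx mulr1.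
  by apply/matrixP => a b; rewrite !mxE; ring.
rewrite (eq_bigr (fun=> - y)) => [|j _]; last by rewrite -mulmxA VV mulmxN mulmx1.
by rewrite sumr_const card_ord scaler_nat mulNrn.
Qed.

Lemma rho_diamond x : rho (xdiamond x) = rho x.
Proof.
rewrite /rho /xdiamond /xpart /r2 /xqpart row_mxKl row_mxKr; congr (row_mx _ (const_mx (Num.sqrt _))).
by apply: eq_bigr => j _; rewrite mxE sqrrN.
Qed.

Section Order.
Variable k : nat.
Let F := iter k (@lapX R d p q) f.

Lemma iter_lapX_diamond x : rhoU x ->
  F (xdiamond x) = lap_coef k *: (iter k T e (rho x) - iter k T h (rho x) *m W x).
Proof.
move=> Ux; have Ux' : rhoU (xdiamond x) by rewrite /rhoU /= rho_diamond.
rewrite (iter_lapX k Ux' : F (xdiamond x) = _) /XF rho_diamond /xdiamond /xqpart row_mxKr JVN mulmxN; reflexivity.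
Qed.

Lemma PE_lapX x : rhoU x -> PE F x = lap_coef k *: iter k T e (rho x).
Proof.
move=> Ux; rewrite /PE (iter_lapX_diamond Ux) (iter_lapX k Ux : F x = _) /XF.
move: (iter k T e (rho x)) (iter k T h (rho x) *m W x) => a b.
by apply/rowP => j; rewrite !mxE; field.
Qed.

Lemma PO_lapX x : rhoU x -> PO F x = lap_coef k *: (iter k T h (rho x) *m W x).
Proof.
move=> Ux; rewrite /PO (iter_lapX_diamond Ux) (iter_lapX k Ux : F x = _) /XF.
move: (iter k T e (rho x)) (iter k T h (rho x) *m W x) => a b.
by apply/rowP => j; rewrite !mxE; field.
Qed.

Let Sek := smooth_iterT Uopen Usc k Se.
Let Eek := even_iterT Uopen Usc k Se Ee.
Let Shk := smooth_iterT Uopen Usc k Sh.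
Let Ehk := even_iterT Uopen Usc k Sh Eh.

(** [PE F] depends on [x_q] only through the radius, so each derivative in [x_j] produces [x_j T];
    the sum over [j] reassembles [x_q]. *)
Lemma Dbar_PE x : rhoU x ->
  \sum_s pd (lshift q s) (PE F) x *m Eb E s - \sum_j pd (rshift p.+1 j) (PE F) x *m V j =
  lap_coef k *: (genD (Eb E) (iter k T e) (rho x) - iter k.+1 T e (rho x) *m W x).
Proof.
move=> Ux.
have EP y : rhoU y -> lap_coef k *: iter k T e (rho y) = PE F y by move=> /PE_lapX ->.
have DP s : pd (lshift q s) (PE F) x = lap_coef k *: pd (fs s) (iter k T e) (rho x).
  exact: (isD_pd (isD_eq_on rhoU_open EP Ux (isDZ _ (isD_rhoP s Sek Ux)))).
have DQ j : pd (rshift p.+1 j) (PE F) x = lap_coef k *: (xqpart x ord0 j *: T (iter k T e) (rho x)).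
  exact: (isD_pd (isD_eq_on rhoU_open EP Ux (isDZ _ (isD_rhoQ j Sek Eek Ux)))).
rewrite scalerBr /genD scaler_sumr iterS mul_JV scaler_sumr; congr (_ - _).
  by apply: eq_bigr => s _; rewrite DP -scalemxAl.
by apply: eq_bigr => j _; rewrite DQ -!scalemxAl.
Qed.

(** Moving [Eb E s] across [x_q] turns the conjugate operator into [genD E]. The squares of the
    [V j] sum to [- q], and [x_q] squares to [- r2 x], which gives the two remaining terms. *)
Lemma Dbar_PO x : rhoU x ->
  \sum_s pd (lshift q s) (PO F) x *m Eb E s - \sum_j pd (rshift p.+1 j) (PO F) x *m V j =
  lap_coef k *: (q%:R *: iter k T h (rho x) + rho x ord0 lst ^+ 2 *: iter k.+1 T h (rho x)
    + genD E (iter k T h) (rho x) *m W x).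
Proof.
move=> Ux; rewrite rho_lst_sq.
have EP y : rhoU y -> lap_coef k *: (iter k T h (rho y) *m W y) = PO F y by move=> /PO_lapX ->.
have DP s : pd (lshift q s) (PO F) x = lap_coef k *: (pd (fs s) (iter k T h) (rho x) *m W x).
  exact: (isD_pd (isD_eq_on rhoU_open EP Ux (isDZ _ (isD_WP s Shk Ux)))).
have DQ j : pd (rshift p.+1 j) (PO F) x =
    lap_coef k *: (xqpart x ord0 j *: (T (iter k T h) (rho x) *m W x) + iter k T h (rho x) *m V j).
  exact: (isD_pd (isD_eq_on rhoU_open EP Ux (isDZ _ (isD_WQ j Shk Ehk Ux)))).
have A1 : \sum_s pd (lshift q s) (PO F) x *m Eb E s = lap_coef k *: (genD E (iter k T h) (rho x) *m W x).
  rewrite /genD mulmx_suml scaler_sumr; apply: eq_bigr => s _.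
  by rewrite DP -scalemxAl -!mulmxA (E_JV EV).
have A2 : \sum_j pd (rshift p.+1 j) (PO F) x *m V j =
    lap_coef k *: (T (iter k T h) (rho x) *m W x *m W x - q%:R *: iter k T h (rho x)).
  rewrite (mul_JV (T (iter k T h) (rho x) *m W x)).
  have -> : - (q%:R *: iter k T h (rho x)) = \sum_j iter k T h (rho x) *m V j *m V j.
    by rewrite sum_VV.
  rewrite -big_split scaler_sumr; apply: eq_bigr => j _.
  by rewrite DQ -scalemxAl mulmxDl -scalemxAl.
rewrite A1 A2 -mulmxA (JV_sq Vcliff) -/(r2 x) mul_mx_scalar iterS scaleNr -scalerBr; congr (_ *: _).
move: (genD _ _ _ *m _) (iter k T h (rho x)) (T (iter k T h) (rho x)) => a b c.
by apply/rowP => j; rewrite !mxE; ring.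
Qed.

End Order.
End Iterate.
End XSpace.

(** * Tubes and constants *)

Section Polar.
Variables (R : realType) (p q : nat).
Local Notation Z := 'rV[R]_(p.+1 + 1).
Local Notation lst := (rshift p.+1 (ord0 : 'I_1)).
Local Notation pt := 'rV[R]_(p.+1 + q).

Lemma polar (x : pt) : (0 < q)%N -> exists2 w : 'rV[R]_q, in_sphere w & xqpart x = Num.sqrt (r2 x) *: w.
Proof.
move=> q0; have [x0|x0] := eqVneq (r2 x) 0.
  exists (delta_mx 0 (Ordinal q0)).
    rewrite /in_sphere (bigD1 (Ordinal q0)) //= mxE !eqxx expr1n big1 ?addr0 // => j j0.
    by rewrite mxE (negbTE j0) andbF expr0n.
  rewrite x0 sqrtr0 scale0r; apply/rowP => j; rewrite [RHS]mxE; apply/eqP.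
  rewrite -sqrf_eq0; apply/eqP; move: x0; rewrite /r2 => /eqP.
  by rewrite psumr_eq0 => [/allP /(_ j (mem_index_enum j)) /eqP|i _]; last exact: sqr_ge0.
have s0 : 0 < r2 x by rewrite lt_neqAle eq_sym x0 r2_ge0.
have r0 : Num.sqrt (r2 x) != 0 by rewrite sqrtr_eq0 -ltNge.
exists ((Num.sqrt (r2 x))^-1 *: xqpart x); last by rewrite scalerA mulfV ?scale1r.
rewrite /in_sphere (eq_bigr (fun j => (Num.sqrt (r2 x))^-1 ^+ 2 * xqpart x ord0 j ^+ 2)) => [|j _].
  by rewrite -mulr_sumr -/(r2 x) exprVn sqr_sqrtr ?r2_ge0 // mulVf.
by rewrite mxE exprMn.
Qed.

Lemma sphere_coord_le (w : 'rV[R]_q) j : in_sphere w -> `|w ord0 j| <= 1.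
Proof.
move=> w1; rewrite -(@expr_le1 _ 2) // real_normK ?num_real // -w1 (bigD1 j) //= lerDl.
by apply: sumr_ge0 => i _; exact: sqr_ge0.
Qed.

Lemma inslice_rho (w : 'rV[R]_q) (x : pt) : xqpart x = Num.sqrt (r2 x) *: w -> inslice w (rho x) = x.
Proof. by move=> xw; rewrite /inslice rho_lsub rho_lst /slice_pt /= -xw; exact: hsubmxK. Qed.

Lemma lsubmx_norm (y : Z) : `|lsubmx y| <= `|y|.
Proof.
apply: rV_norm_le; first exact: normr_ge0.
by move=> j; rewrite mxE; exact: rV_norm_coord.
Qed.

(** The second condition bounds only the modulus of the radius, so the set is stable under the
    scalings [sc] and contains the whole segment needed by the averages. *)
Definition tube (c : 'rV[R]_p.+1) (r dl : R) : set Z :=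
  [set z | `|lsubmx z - c| < dl /\ `|z ord0 lst| < r + dl].

Lemma tube_open c r dl z : tube c r dl z -> exists2 s : R, 0 < s & forall y, `|y - z| < s -> tube c r dl y.
Proof.
move=> [z1 z2]; exists (Num.min (dl - `|lsubmx z - c|) (r + dl - `|z ord0 lst|)).
  by rewrite lt_min !subr_gt0 z1.
move=> y; rewrite lt_min => /andP [y1 y2]; split.
  have -> : lsubmx y - c = lsubmx (y - z) + (lsubmx z - c).
    by apply/rowP => j; rewrite !mxE; ring.
  apply: le_lt_trans (ler_normD _ _) _; have := lsubmx_norm (y - z); lra.
have -> : y ord0 lst = (y - z) ord0 lst + z ord0 lst by rewrite !mxE subrK.
apply: le_lt_trans (ler_normD _ _) _; have := rV_norm_coord (y - z) ord0 lst; lra.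
Qed.

Lemma tube_sc c r dl s z : -1 <= s <= 1 -> tube c r dl z -> tube c r dl (sc lst s z).
Proof.
rewrite -ler_norml /tube /= sc_lsubmx sc_lst normrM => s1 [z1 z2]; split=> //.
by apply: le_lt_trans z2; rewrite ler_piMl.
Qed.

Lemma tube_slices (Om : set pt) x : (0 < q)%N -> p_sym_slice_domain Om ->
  (forall s : R, 0 <= s <= 1 -> Om (row_mx (xpart x) (s *: xqpart x))) ->
  exists2 dl : R, 0 < dl & forall w z, in_sphere w -> tube (xpart x) (Num.sqrt (r2 x)) dl z -> Om (inslice w z).
Proof.
move=> q0 [Oopen _ _ _ Osym] seg.
have Oo y : Om y -> exists2 r : R, 0 < r & forall y', `|y' - y| < r -> Om y'.
  move=> Oy; have /nbhs_normP [r r0 Hr] : nbhs y Om by exact: open_nbhs_nbhs.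
  by exists r => // y' hy; apply: Hr; rewrite /ball_ /= distrC.
pose gam (s : R) : pt := row_mx (xpart x) (s *: xqpart x).
have gamE s : gam s = row_mx (xpart x) 0 + s *: row_mx 0 (xqpart x).
  by rewrite scale_row_mx add_row_mx scaler0 addr0 add0r.
pose K := gam @` `[(0 : R), 1]%classic.
have Kc : compact K.
  apply: continuous_compact; last exact: segment_compact.
  apply: continuous_subspaceT => s; apply/contAtP.
  have -> : gam = (fun s => row_mx (xpart x) 0 + s *: row_mx 0 (xqpart x)) by apply/funext => t; exact: gamE.
  by apply: contAtD; [exact: contAt_cst|apply: contAtZf; [exact: contAt_id|exact: contAt_cst]].
have KO : K `<=` Om by move=> y [s /= + <-]; rewrite in_itv; exact: seg.
have [dl dl0 Hdl] := compact_tube Kc Oo KO; exists dl => //.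
have near (s : R) (y : 'rV[R]_p.+1) (u : 'rV[R]_q) : 0 <= s <= 1 -> `|y - xpart x| < dl -> (forall j, `|u ord0 j - s * xqpart x ord0 j| < dl) -> Om (row_mx y u).
  move=> s01 hy hu; apply: (Hdl (gam s)); first by exists s => //=; rewrite in_itv.
  rewrite opp_row_mx add_row_mx; apply: rV_norm_lt => // j; rewrite mxE.
  case: (fintype.split j) => i.
    by apply: le_lt_trans hy; exact: rV_norm_coord.
  by move: (hu i); rewrite !mxE.
have [w0 w01 xw0] := polar x q0; set r0 := Num.sqrt (r2 x) in xw0 *.
have r00 : 0 <= r0 by exact: sqrtr_ge0.
have pos w y t : in_sphere w -> `|y - xpart x| < dl -> 0 <= t -> t < r0 + dl -> Om (slice_pt w (y, t)).
  move=> w1 hy t0 tr; have [tz|tp] := eqVneq t 0.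
    rewrite /slice_pt /= tz scale0r; apply: (near 0); rewrite ?lexx ?ler01 // => j.
    by rewrite mxE mul0r subr0 normr0.
  apply: (Osym w0) w1 => //; first by rewrite lt_neqAle eq_sym tp.
  (* The point of the segment nearest to radius [t]; when [r0 = 0] the segment is a single point and
     [s = 0] serves. *)
  have [s s01 sr] : exists2 s : R, 0 <= s <= 1 & s * r0 = Num.min t r0.
    have [rz|rp] := eqVneq r0 0.
      by exists 0; rewrite ?lexx ?ler01 // mul0r rz min_r.
    have rp' : 0 < r0 by rewrite lt_neqAle eq_sym rp.
    exists (Num.min t r0 / r0); last by rewrite divfK.
    by rewrite ler_pdivlMr // mul0r ler_pdivrMr // mul1r le_min t0 r00 ge_min lexx orbT.
  apply: (near s) => // j; rewrite /slice_pt /= xw0 !mxE mulrA sr -mulrBl normrM.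
  apply: (@le_lt_trans _ _ `|t - Num.min t r0|).
    by rewrite ler_piMr // sphere_coord_le.
  have [le|lt] := leP t r0; first by rewrite subrr normr0.
  by rewrite ger0_norm ?subr_ge0 ?(ltW lt) // ltrBlDl.
move=> w z w1 [z1 z2]; rewrite /inslice; have [zp|zn] := leP 0 (z ord0 lst).
  by apply: pos => //; rewrite ger0_norm in z2.
have -> : slice_pt w (lsubmx z, z ord0 lst) = slice_pt (- w) (lsubmx z, - z ord0 lst).
  by rewrite /slice_pt /= scalerN scaleNr opprK.
by apply: pos; [exact: in_sphereN| |rewrite oppr_ge0 ltW|rewrite -ltr0_norm].
Qed.

End Polar.

(** * Double factorials, rising factorials and the constant gamma *)

Section Constants.
Variable R : realType.

(** Read in reverse order, the factors are 2, 4, ..., 2k. *)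
Lemma lap_coef_dfact k : lap_coef R k.*2.+1 k = (dfact k.*2)%:R.
Proof.
rewrite /lap_coef (reindex_inj rev_ord_inj) /= (eq_bigr (fun i : 'I_k => (i.+1).*2%:R)) => [|i _].
  elim: k => [|k IH]; first by rewrite big_ord0.
  by rewrite big_ord_recr /= IH doubleS -natrM mulnC.
rewrite -(natrB _ (ltn0Sn _)) subn1 /= -natrB ?leq_double ?leq_subr // -doubleB.
by congr (_.*2%:R); have := ltn_ord i; lia.
Qed.

Lemma poch_recr (b : R) k : poch b k.+1 = poch b k * (b + k%:R).
Proof. by rewrite /poch big_ord_recr. Qed.

Lemma poch_recl (b : R) k : poch b k.+1 = b * poch (b + 1) k.
Proof.
rewrite /poch big_ord_recl addr0; congr (_ * _).
by apply: eq_bigr => i _; rewrite lift0 -natr1; ring.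
Qed.

Lemma natr_doubleS k : k.*2.+1%:R = 2 * (2^-1 + k%:R) :> R.
Proof. by rewrite -natr1 -mul2n natrM; field. Qed.

Lemma poch_half_dfact k : 2 ^+ k * poch (2^-1 : R) k = (dfact (k.*2.+1 - 2))%:R.
Proof.
elim: k => [|k IH]; first by rewrite /poch big_ord0 mulr1.
transitivity (2 ^+ k * poch (2^-1 : R) k * k.*2.+1%:R).
  by rewrite poch_recr exprS natr_doubleS; move: (2 ^+ k) (poch _ _) => a b; ring.
(* At [k = 0] truncated subtraction yields [dfact 0], standing for (-1)!!. *)
rewrite IH; case: k {IH} => [|k]; first by rewrite mul1r.
by rewrite -natrM mulnC !doubleS !subSS !subn0.
Qed.

(** The factors of [iterT_slice0] for constants 1 and 3, that is [b = 1/2] and [b = 3/2]: they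
    relate [T^k] at radius 0 to the iterated Laplacian in [x_p]. *)
Definition ecoef k : R := (-1) ^+ k / (2 ^+ k * poch 2^-1 k).
Definition hcoef k : R := (-1) ^+ k / (2 ^+ k * poch (2^-1 + 1) k).

Lemma ecoef_neq0 k : ecoef k != 0.
Proof.
rewrite /ecoef mulf_neq0 ?signr_eq0 // invr_eq0 mulf_neq0 ?expf_neq0 ?pnatr_eq0 //.
by rewrite gt_eqF // poch_gt0 // invr_gt0.
Qed.

(** The two expansions of the rising factorial of 1/2, from the left and from the right, differ by
    this ratio. It is the origin of the factor 1/q in the odd identity. *)
Lemma hcoefE k : hcoef k = ecoef k / k.*2.+1%:R.
Proof.
have h0 : 0 < 2^-1 :> R by rewrite invr_gt0.
have h1 : 0 < 2^-1 + 1 :> R by lra.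
have P1 := poch_gt0 k h0; have P2 := poch_gt0 k h1.
have := esym (poch_recl 2^-1 k); rewrite poch_recr /hcoef /ecoef.
rewrite natr_doubleS; have k0 : 0 < 2^-1 + k%:R :> R by rewrite ltr_pwDl.
move: (poch _ _) (poch _ _) P1 P2 (2^-1 + k%:R) k0 => a b a0 b0 c c0 H.
have -> : a = 2 * (b * c) by rewrite -H; field.
have t0 : 0 < 2 ^+ k :> R by rewrite exprn_gt0.
move: (2 ^+ k) t0 ((-1) ^+ k) => t t0 s.
by field; rewrite !gt_eqF.
Qed.

Lemma lap_ecoef k : lap_coef R k.*2.+1 k * ecoef k = gammaq R k.*2.+1.
Proof. by rewrite lap_coef_dfact /ecoef poch_half_dfact /gammaq /= doubleK mulrA [_ * (-1) ^+ k]mulrC. Qed.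

Lemma lap_hcoef k : lap_coef R k.*2.+1 k * hcoef k = gammaq R k.*2.+1 / k.*2.+1%:R.
Proof. by rewrite hcoefE mulrA lap_ecoef. Qed.

(** Splitting off the first factor [q / 2] of the longer rising factorial leaves the one in
    [cH1]. *)
Lemma cG1_cH1 q k : (0 < q)%N -> cG1 R q k = q%:R^-1 * cH1 R q k.
Proof.
move=> q0; have hq : 0 < halfq R q by rewrite divr_gt0 ?ltr0n.
have hq1 : 0 < halfq R q + 1 by rewrite ltr_wpDr.
rewrite /cG1 /cH1 poch_recl.
have -> : q%:R = 2 * halfq R q by rewrite /halfq; field.
have := poch_gt0 k hq1; move: (poch _ _) => a a0; move: {hq1} (halfq R q) hq => b b0.
have t0 : 0 < 4 ^+ k :> R by rewrite exprn_gt0.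
have f0 : 0 < k`!%:R :> R by rewrite ltr0n fact_gt0.
move: (4 ^+ k) t0 ((-1) ^+ k) (k`!%:R) f0 => t t0 s u u0.
by field; rewrite !gt_eqF.
Qed.

End Constants.

(** * The extension series *)

Section TermSums.
Variables (R : realType) (d p q : nat).
Local Notation cod := 'rV[R]_d.
Implicit Types (g : 'rV[R]_p.+1 -> cod) (x : 'rV[R]_(p.+1 + q)).

Lemma termA_zero (c : nat -> R) x : limn (series (termA c (fun=> 0 : cod) x)) = 0.
Proof.
have -> : series (termA c (fun=> 0 : cod) x) = (fun=> 0).
  by apply/funext => m; rewrite /series /= big1 // => k _; rewrite /termA lapP0 scaler0.
by rewrite lim_cst.
Qed.

Lemma termA_cG1 g x : (0 < q)%N -> cvgn (series (termA (cG1 R q) g x)) ->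
  cvgn (series (termA (cH1 R q) g x)) /\
  limn (series (termA (cG1 R q) g x)) = q%:R^-1 *: limn (series (termA (cH1 R q) g x)).
Proof.
move=> q0 C; have q1 : q%:R != 0 :> R by rewrite pnatr_eq0 -lt0n.
have E : series (termA (cH1 R q) g x) = q%:R *: series (termA (cG1 R q) g x).
  apply/funext => m; transitivity (q%:R *: series (termA (cG1 R q) g x) m); last by [].
  rewrite /series /= scaler_sumr; apply: eq_bigr => k _.
  by rewrite /termA cG1_cH1 // scalerA !mulrA mulfV // mul1r.
rewrite E; split; first exact: is_cvgZl_tmp.
by rewrite limZl_tmp // scalerA mulVf // scale1r.
Qed.

End TermSums.

(** * The iterates of T as extension series *)

Section StemSums.
Variables (R : realType) (d p q k : nat).
Hypothesis qk : q = k.*2.+1.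
Local Notation Z := 'rV[R]_(p.+1 + 1).
Local Notation cod := 'rV[R]_d.
Local Notation lst := (rshift p.+1 (ord0 : 'I_1)).
Local Notation fs s := (lshift 1 (s : 'I_p.+1)).
Local Notation T := (Trad lst).
Variable U : set Z.
Hypothesis Uopen : forall x : Z, U x -> exists2 r : R, 0 < r & forall y, `|y - x| < r -> U y.
Hypothesis Usc : forall s z, -1 <= s <= 1 -> U z -> U (sc lst s z).
Implicit Types (P : 'I_p.+1 -> 'M[R]_d) (g : 'rV[R]_p.+1 -> cod) (F : Z -> cod).

Definition diffP P g (y : 'rV[R]_p.+1) : cod := \sum_s 'D_(eP R s) g y *m P s.

Lemma diffP_slice0 (a : R) F g P y : a != 0 -> (forall y, U (row_mx y 0) -> F (row_mx y 0) = a *: g y) ->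
  smooth U F -> U (row_mx y 0) -> genD P F (row_mx y 0) = a *: diffP P g y.
Proof.
move=> a0 Fg SF Uy; rewrite /genD scaler_sumr; apply: eq_bigr => s _.
have gF y' : U (row_mx y' 0) -> g y' = a^-1 *: F (row_mx y' 0).
  by move=> /Fg ->; rewrite scalerA mulVf // scale1r.
by rewrite (isD_derive (isD_slice0 Uopen s gF SF Uy)) -scalemxAl scalerA mulfV // scale1r.
Qed.

Variable x : 'rV[R]_(p.+1 + q).
Hypothesis Ux : U (rho x).

Lemma radial_sum_rho (b c kap : R) F g : 0 < b -> c = 2 * b -> kap != 0 -> smooth U F -> even_on lst U F ->
  analytic_at lst (rho x) F -> radial_eq lst U c F ->
  (forall y, U (row_mx y 0) -> F (row_mx y 0) = kap *: g y) ->
  cvgn (series (termA (radial_coef b) g x)) -> F (rho x) = kap *: limn (series (termA (radial_coef b) g x)).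
Proof.
move=> b0 cb kap0 SF EF AF RF Fg.
rewrite cb in RF.
have := radial_sum Uopen Usc b0 kap0 SF EF AF RF Fg Ux (rho_lst_ge0 x).
by rewrite rho_lst_sq rho_lsub.
Qed.

Variables (E : 'I_p.+1 -> 'M[R]_d) (e : Z -> cod) (f0 : 'rV[R]_p.+1 -> cod).
Hypothesis E0 : E ord0 = 1%:M.
Hypothesis Ecliff : forall s t, s != ord0 -> t != ord0 -> E s *m E t + E t *m E s = (- 2 * (s == t)%:R)%:M.
Hypotheses (He : harmonic_val U e) (Ee : even_on lst U e) (Le : laplace_on U e).
Hypothesis pd_e : forall z, U z -> pd lst e z = - (z ord0 lst *: genD (Eb E) (Avg lst 0 (genD E e)) z).
Hypothesis ef0 : forall y, e (row_mx y 0) = f0 y.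

Let h := Avg lst 0 (genD E e).
Let De := genD E e.
Let Se := harmonic_val_smooth Uopen He.
Let SDe := smooth_genD Uopen E Se.
Let EDe := even_genD Uopen Usc E Se Ee.
Let Sh := smooth_stem Uopen Usc E He.
Let Eh := even_stem Uopen Usc E He Ee.
Let Re := radial_even_part Uopen Usc He Ee Le.
Let Rh := radial_stem Uopen Usc E0 Ecliff He Ee pd_e.
Let Sek := smooth_iterT Uopen Usc k Se.
Let Eek := even_iterT Uopen Usc k Se Ee.
Let Shk := smooth_iterT Uopen Usc k Sh.
Let Ehk := even_iterT Uopen Usc k Sh Eh.
Let Rek := radial_eq_iterT Uopen Usc k Se Ee Re.
Let Rhk := radial_eq_iterT Uopen Usc k Sh Eh Rh.

Let half_gt0 : 0 < 2^-1 :> R.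
Proof. by rewrite invr_gt0. Qed.

Let half1_gt0 : 0 < 2^-1 + 1 :> R.
Proof. by rewrite addr_gt0. Qed.

Let halfq_gt0 : 0 < halfq R q.
Proof. by rewrite divr_gt0 // qk ltr0n. Qed.

Let halfq1_gt0 : 0 < halfq R q + 1.
Proof. by rewrite addr_gt0. Qed.

(** [T^k] raises the constants 1 and 3 by [2 k]; for [q = 2 k + 1] they become [q] and [q + 2],
    twice the parameters of [cA] and [cH1]. *)
Let cE : 1 + k.*2%:R = 2 * halfq R q.
Proof. by rewrite /halfq qk -natr1; field. Qed.

Let cH : 3 + k.*2%:R = 2 * (halfq R q + 1).
Proof. by rewrite /halfq qk -natr1; field. Qed.

Let radial1 F : radial_eq lst U 1 F -> radial_eq lst U (2 * 2^-1) F.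
Proof. by rewrite mulfV ?pnatr_eq0. Qed.

Let radial3 F : radial_eq lst U 3 F -> radial_eq lst U (2 * (2^-1 + 1)) F.
Proof. by have -> : 2 * (2^-1 + 1) = 3 :> R by field. Qed.

Let RDe : radial_eq lst U 1 De := radial_genD Uopen Usc E Se Ee Re.

Let oneZ (a : R) (w : cod) : (1 * a) *: w = a *: w.
Proof. by rewrite mul1r. Qed.

Lemma even_slice0 y : U (row_mx y 0) -> iter k T e (row_mx y 0) = ecoef R k *: iter k (@lapP R d p) f0 y.
Proof.
move=> Uy; rewrite -oneZ; apply: (iterT_slice0 Uopen Usc k half_gt0 (oner_neq0 R) Se Ee (radial1 Re) _ Uy).
by move=> y' _; rewrite ef0 scale1r.
Qed.

Let De_slice0 y : U (row_mx y 0) -> De (row_mx y 0) = 1 *: diffP E f0 y.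
Proof. by move=> Uy; apply: (diffP_slice0 _ (oner_neq0 R) _ Se Uy) => y' _; rewrite ef0 scale1r. Qed.

Lemma genD_slice0 y : U (row_mx y 0) -> iter k T De (row_mx y 0) = ecoef R k *: iter k (@lapP R d p) (diffP E f0) y.
Proof.
move=> Uy; rewrite -oneZ.
exact: (iterT_slice0 Uopen Usc k half_gt0 (oner_neq0 R) SDe EDe (radial1 RDe) De_slice0 Uy).
Qed.

Lemma stem_iter_slice0 y : U (row_mx y 0) -> iter k T h (row_mx y 0) = hcoef R k *: iter k (@lapP R d p) (diffP E f0) y.
Proof.
move=> Uy; rewrite -oneZ.
apply: (iterT_slice0 Uopen Usc k half1_gt0 (oner_neq0 R) Sh Eh (radial3 Rh) _ Uy) => y' Uy'.
rewrite -(De_slice0 Uy'); apply: (stem_slice0 Uopen Usc E He Uy').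
by rewrite row_mxEr mxE.
Qed.

Let qn0 : q%:R != 0 :> R.
Proof. by rewrite qk pnatr_eq0. Qed.

Lemma hcoef_neq0 : hcoef R k != 0.
Proof. by rewrite hcoefE -qk mulf_neq0 ?ecoef_neq0 // invr_eq0. Qed.

Lemma even_part_series : let g := iter k (@lapP R d p) f0 in
  cvgn (series (termA (cA R q) g x)) -> iter k T e (rho x) = ecoef R k *: limn (series (termA (cA R q) g x)).
Proof.
exact: (radial_sum_rho halfq_gt0 cE (ecoef_neq0 R k) Sek Eek
  (analytic_at_iterT k (analytic_even_part Uopen Usc He Ux)) Rek even_slice0).
Qed.

Lemma stem_sum : let g := iter k (@lapP R d p) (diffP E f0) in
  cvgn (series (termA (cH1 R q) g x)) -> iter k T h (rho x) = hcoef R k *: limn (series (termA (cH1 R q) g x)).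
Proof.
exact: (radial_sum_rho halfq1_gt0 cH hcoef_neq0 Shk Ehk
  (analytic_at_iterT k (analytic_stem Uopen Usc E He Ee Ux)) Rhk stem_iter_slice0).
Qed.

Lemma genD_even_sum : let g := iter k (@lapP R d p) (diffP E f0) in
  cvgn (series (termA (cA R q) g x)) -> iter k T De (rho x) = ecoef R k *: limn (series (termA (cA R q) g x)).
Proof.
exact: (radial_sum_rho halfq_gt0 cE (ecoef_neq0 R k) (smooth_iterT Uopen Usc k SDe) (even_iterT Uopen Usc k SDe EDe)
  (analytic_at_iterT k (analytic_genD Uopen Usc He E Ux))
  (radial_eq_iterT Uopen Usc k SDe EDe RDe) genD_slice0).
Qed.

Lemma genDb_even_sum : let g := diffP (Eb E) (iter k (@lapP R d p) f0) in
  cvgn (series (termA (cA R q) g x)) ->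
  genD (Eb E) (iter k T e) (rho x) = ecoef R k *: limn (series (termA (cA R q) g x)).
Proof.
(* [T^k] commutes with the operator, so the bounds come from the harmonic function
   [genD (Eb E) e]. *)
have An : analytic_at lst (rho x) (genD (Eb E) (iter k T e)).
  apply: (analytic_at_eq_on Uopen Usc Ux (fun y Uy => iterT_genD Uopen Usc k (Eb E) Se Ee Uy)).
  exact: (analytic_at_iterT k (analytic_genD Uopen Usc He (Eb E) Ux)).
exact: (radial_sum_rho halfq_gt0 cE (ecoef_neq0 R k) (smooth_genD Uopen _ Sek) (even_genD Uopen Usc _ Sek Eek)
  An (radial_genD Uopen Usc _ Sek Eek Rek)
  (fun y Uy => diffP_slice0 (Eb E) (ecoef_neq0 R k) even_slice0 Sek Uy)).
Qed.

Lemma genD_stem_sum : let g := diffP E (iter k (@lapP R d p) (diffP E f0)) in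
  cvgn (series (termA (cH1 R q) g x)) ->
  genD E (iter k T h) (rho x) = hcoef R k *: limn (series (termA (cH1 R q) g x)).
Proof.
have An : analytic_at lst (rho x) (genD E (iter k T h)).
  apply: (analytic_at_eq_on Uopen Usc Ux (fun y Uy => iterT_genD Uopen Usc k E Sh Eh Uy)).
  exact: (analytic_at_iterT k (analytic_genD_stem Uopen Usc E He Ee E Ux)).
exact: (radial_sum_rho halfq1_gt0 cH hcoef_neq0 (smooth_genD Uopen _ Shk) (even_genD Uopen Usc _ Shk Ehk)
  An (radial_genD Uopen Usc _ Shk Ehk Rhk)
  (fun y Uy => diffP_slice0 E hcoef_neq0 stem_iter_slice0 Shk Uy)).
Qed.

(** At radius 0 the equation for [T^k e], of constant [q], gives [q T^(k+1) e] as minus the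
    Laplacian of [T^k e], which factors as the Dirac operator after its conjugate. *)
Lemma next_even_slice0 y : U (row_mx y 0) -> iter k.+1 T e (row_mx y 0) =
  (- (ecoef R k / q%:R)) *: diffP E (diffP (Eb E) (iter k (@lapP R d p) f0)) y.
Proof.
move=> Uy; have z0 : (row_mx y 0 : Z) ord0 lst = 0 by rewrite row_mxEr mxE.
have := Rek Uy; rewrite z0 expr0n scale0r addr0 iterS.
rewrite -(genD_conj Uopen (Eb_E E0 Ecliff) Sek Uy).
rewrite (diffP_slice0 E (ecoef_neq0 R k) (fun y Uy => diffP_slice0 (Eb E) (ecoef_neq0 R k) even_slice0 Sek Uy)
  (smooth_genD Uopen _ Sek) Uy).
have -> : 1 + k.*2%:R = q%:R :> R by rewrite qk -natr1 addrC.
move: (T _ _) (diffP _ _ _) => a b H; apply: (scalerI qn0).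
by rewrite scalerA mulrN mulrCA mulfV // mulr1 scaleNr; apply/eqP; rewrite -addr_eq0 addrC H.
Qed.

(** [T^(k+1) e] multiplies [x_q] in [Dbar_PE]. Its constant is [q + 2], hence the coefficients
    [cH1], and the factor 1/q is the one of [termA_cG1]. *)
Lemma next_even_sum : let g := diffP E (diffP (Eb E) (iter k (@lapP R d p) f0)) in
  cvgn (series (termA (cH1 R q) g x)) ->
  iter k.+1 T e (rho x) = (- (ecoef R k / q%:R)) *: limn (series (termA (cH1 R q) g x)).
Proof.
have kap0 : - (ecoef R k / q%:R) != 0 by rewrite oppr_eq0 mulf_neq0 ?ecoef_neq0 // invr_eq0.
have cS : 1 + k.+1.*2%:R = 2 * (halfq R q + 1).
  by rewrite -cH doubleS -[X in X%:R]addn2 natrD; ring.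
exact: (radial_sum_rho halfq1_gt0 cS kap0 (smooth_iterT Uopen Usc k.+1 Se) (even_iterT Uopen Usc k.+1 Se Ee)
  (analytic_at_iterT k.+1 (analytic_even_part Uopen Usc He Ux))
  (radial_eq_iterT Uopen Usc k.+1 Se Ee Re) next_even_slice0).
Qed.

End StemSums.

(** * Translation into matrices and conclusion *)

Section Main.
Variables (R : realType) (d p q : nat) (A : realAlg R d) (v : 'I_(p.+1 + q) -> 'rV[R]_d).
Variables (Om : set 'rV[R]_(p.+1 + q)) (f : 'rV[R]_(p.+1 + q) -> 'rV[R]_d).
Hypothesis HA : is_alt_alg_with_anti_involution A.
Hypothesis HB : good_basis A v.
Hypothesis HO : p_sym_slice_domain Om.
Hypothesis Hf : gpsm A v Om f.
Local Notation Z := 'rV[R]_(p.+1 + 1).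
Local Notation cod := 'rV[R]_d.
Local Notation lst := (rshift p.+1 (ord0 : 'I_1)).
Local Notation fs s := (lshift 1 (s : 'I_p.+1)).
Local Notation T := (Trad lst).
Local Notation E := (fun s : 'I_p.+1 => Lm A (v (lshift q s))).
Local Notation V := (fun j : 'I_q => Lm A (v (rshift p.+1 j))).

Lemma basis_E0 : E ord0 = 1%:M.
Proof. by case: HB => + _ _ _ _; rewrite /idx0 /= => ->; exact: Lm1. Qed.

Lemma basis_Ecliff s t : s != ord0 -> t != ord0 -> E s *m E t + E t *m E s = (- 2 * (s == t)%:R)%:M.
Proof.
move=> s0 t0; rewrite (good_basis_clifford HA HB) ?(inj_eq (@lshift_inj _ _)) //.
Qed.

Lemma basis_Vcliff j k : V j *m V k + V k *m V j = (- 2 * (j == k)%:R)%:M.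
Proof. by rewrite (good_basis_clifford HA HB) ?eq_rlshift // (inj_eq (@rshift_inj _ _)). Qed.

Lemma basis_EV s j : E s *m V j = V j *m Eb E s.
Proof.
rewrite /Eb; have [->|s0] := eqVneq s ord0; first by rewrite basis_E0 mul1mx mulmx1.
have := good_basis_clifford HA HB (i := lshift q s) (j := rshift p.+1 j).
rewrite eq_rlshift (inj_eq (@lshift_inj _ _)) eq_lrshift => /(_ s0 isT).
by rewrite mulr0 raddf0 mulmxN => /eqP; rewrite addr_eq0 => /eqP.
Qed.

Lemma Lm_emb_row0 (w : 'rV[R]_q) : Lm A (emb v (row_mx 0 w)) = JV V w.
Proof.
have -> : emb v (row_mx 0 w) = \sum_j w ord0 j *: v (rshift p.+1 j).
  rewrite /emb big_split_ord /= [X in X + _]big1 => [|s _]; last by rewrite row_mxEl mxE scale0r.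
  by rewrite add0r; apply: eq_bigr => j _; rewrite row_mxEr.
by rewrite (Lm_sum HA); apply: eq_bigr => j _; rewrite (LmZ HA).
Qed.

Lemma DbarX_mx (F : 'rV[R]_(p.+1 + q) -> cod) x : DbarX A v F x =
  \sum_s pd (lshift q s) F x *m Eb E s - \sum_j pd (rshift p.+1 j) F x *m V j.
Proof.
have E0 : Eb E ord0 = 1%:M by rewrite /Eb eqxx.
rewrite /DbarX big_mkcond big_split_ord /= opprD addrA; congr (_ - _); last first.
  by apply: eq_bigr => j _; rewrite (amulE HA).
rewrite [in RHS](bigD1 ord0) //= E0 mulmx1; congr (_ + _).
rewrite -big_mkcond /= -sumrN; apply: eq_big => [s|s s0].
  by rewrite (inj_eq (@lshift_inj _ _)).
by rewrite /Eb ifN ?(amulE HA) ?mulmxN // -(inj_eq (@lshift_inj p.+1 q)).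
Qed.

Lemma DP_mx (g : 'rV[R]_p.+1 -> cod) y : DP A v g y = \sum_s 'D_(eP R s) g y *m E s.
Proof. by apply: eq_bigr => s _; rewrite (amulE HA). Qed.

Lemma DbarP_mx (g : 'rV[R]_p.+1 -> cod) y : DbarP A v g y = \sum_s 'D_(eP R s) g y *m Eb E s.
Proof.
rewrite /DbarP [in RHS](bigD1 ord0) //= /Eb eqxx mulmx1 -sumrN; congr (_ + _).
by apply: eq_bigr => s s0; rewrite (negbTE s0) (amulE HA) mulmxN.
Qed.

Lemma gpsm_mx w : in_sphere w -> forall z, slice_dom Om w z ->
  [/\ forall s : 'I_p.+1, derivable f (slice_pt w z) (eX R (lshift q s)) /\
        {for z, continuous (fun z' => 'D_(eX R (lshift q s)) f (slice_pt w z'))},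
      derivable f (slice_pt w z) (eR p w) /\
        {for z, continuous (fun z' => 'D_(eR p w) f (slice_pt w z'))} &
      \sum_(s < p.+1) 'D_(eX R (lshift q s)) f (slice_pt w z) *m E s
        + 'D_(eR p w) f (slice_pt w z) *m JV V w = 0].
Proof.
move=> w1 z zO; have [C D] := Hf w1; have [C1 C2] := C z zO; split=> //.
rewrite -[RHS](D z zO) (amulE HA) Lm_emb_row0; congr (_ + _).
by apply: eq_bigr => s _; rewrite (amulE HA).
Qed.

End Main.

Theorem theorem5p3 (R : realType) (d p q : nat) (A : realAlg R d)
  (v : 'I_(p.+1 + q) -> 'rV[R]_d)
  (Om : set 'rV[R]_(p.+1 + q)) (f : 'rV[R]_(p.+1 + q) -> 'rV[R]_d) :
  is_alt_alg_with_anti_involution A ->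
  good_basis A v ->
  p_sym_slice_domain Om ->
  gpsm A v Om f ->
  odd q ->
  let k := (q.-1)./2 in
  let F := iter k (@lapX R d p q) f in
  let f0 := restr0 f in
  let g := gammaq R q in
  forall x : 'rV[R]_(p.+1 + q),
    (forall s : R, 0 <= s <= 1 -> Om (row_mx (xpart x) (s *: xqpart x))) ->
    [/\ HGCK_defined (fun _ => 0) (iter k (@lapP R d p) (DP A v f0)) x ->
          PO F x = (g / q%:R) *: HGCK A v (fun _ => 0) (iter k (@lapP R d p) (DP A v f0)) x,
        HGCK_defined (iter k (@lapP R d p) f0) (fun _ => 0) x ->
          PE F x = g *: HGCK A v (iter k (@lapP R d p) f0) (fun _ => 0) x,
        GCK_defined A v (iter k (@lapP R d p) (DP A v f0)) x ->
          DbarX A v (PO F) x = g *: GCK A v (iter k (@lapP R d p) (DP A v f0)) x &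
        GCK_defined A v (DbarP A v (iter k (@lapP R d p) f0)) x ->
          DbarX A v (PE F) x = g *: GCK A v (DbarP A v (iter k (@lapP R d p) f0)) x].
Proof.
move=> HA HB HO Hf oq k F f0 g x seg.
have q0 : (0 < q)%N by case: (q) oq.
have qk : q = k.*2.+1.
  have odd_eq n : odd n -> n = (n.-1)./2.*2.+1.
    by case: n => //= n on; rewrite -[in LHS](odd_double_half n) (negbTE on).
  exact: odd_eq.
pose E (s : 'I_p.+1) := Lm A (v (lshift q s)).
pose V (j : 'I_q) := Lm A (v (rshift p.+1 j)).
have E0 : E ord0 = 1%:M := basis_E0 HA HB.
have Ecliff := basis_Ecliff HA HB : forall s t, _ -> _ -> E s *m E t + E t *m E s = _.
have Vcliff := basis_Vcliff HA HB : forall i j, V i *m V j + V j *m V i = _.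
have EV := basis_EV HA HB : forall s j, E s *m V j = V j *m Eb E s.
(* The hypothesis on the segment provides one tube valid for all units, on which the slice functions
   can be compared. *)
have [dl dl0 UOm] := tube_slices q0 HO seg.
set r := Num.sqrt (r2 x) in UOm.
pose U := tube (xpart x) r dl.
have Uopen : forall z, U z -> exists2 s : R, 0 < s & forall y, `|y - z| < s -> U y by exact: tube_open.
have Usc : forall s z, -1 <= s <= 1 -> U z -> U (sc (rshift p.+1 ord0) s z).
  by move=> s z; exact: tube_sc.
have [e [He Ee Le pde [e0 edec]]] := slice_representation E0 Ecliff Vcliff EV (gpsm_mx HA Hf) Uopen Usc UOm q0.
pose h := Avg (rshift p.+1 ord0) 0 (genD E e).
have Se := harmonic_val_smooth Uopen He.
have Sh : smooth U h := smooth_stem Uopen Usc E He.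
have Eh : even_on _ U h := even_stem Uopen Usc E He Ee.
have Re := radial_even_part Uopen Usc He Ee Le.
have Rh : radial_eq _ U 3 h := radial_stem Uopen Usc E0 Ecliff He Ee pde.
have Ux : rhoU U x.
  split; first by rewrite rho_lsub subrr normr0.
  by rewrite rho_lst ger0_norm ?sqrtr_ge0 // ltrDl.
have fE y : rhoU U y -> f y = XF V e h y.
  move=> Uy; have [w w1 yw] := polar y q0.
  rewrite -[in LHS](inslice_rho yw) (edec w _ w1 Uy) /XF yw JVZ rho_lst -scalemxAl -scalemxAr; reflexivity.
have DPE : DP A v f0 = diffP E f0 by apply/funext => y; exact: DP_mx.
have uxqE (w : 'rV[R]_d) : amul A (uxq v x) w = w *m JV V (xqpart x).
  by rewrite (amulE HA) /uxq (Lm_emb_row0 v HA).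
have ef0 y : e (row_mx y 0) = f0 y := e0 y.
have gq : lap_coef R q k * hcoef R k = g / q%:R by rewrite /g qk lap_hcoef.
have ge : lap_coef R q k * ecoef R k = g by rewrite /g qk lap_ecoef.
have POF := PO_lapX Uopen Usc Se Ee Re Sh Eh Rh fE k Ux.
have PEF := PE_lapX Uopen Usc Se Ee Re Sh Eh Rh fE k Ux.
rewrite DPE; split.
- case=> _ C; rewrite /HGCK termA_zero add0r uxqE.
  rewrite POF (stem_sum qk Uopen Usc Ux E0 Ecliff He Ee pde ef0 C).
  by rewrite -scalemxAl scalerA gq.
- case=> C _; rewrite /HGCK termA_zero uxqE mul0mx addr0.
  by rewrite PEF (even_part_series qk Uopen Usc Ux He Ee Le ef0 C) scalerA ge.
- case=> C C1; rewrite /GCK uxqE.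
  have [C2 L] := termA_cG1 q0 C1.
  have DD : DP A v (iter k (@lapP R d p) (diffP E f0)) = diffP E (iter k (@lapP R d p) (diffP E f0)).
    by apply/funext => y; exact: DP_mx.
  rewrite DD in C2 L *.
  rewrite (DbarX_mx v HA) (Dbar_PO Uopen Usc Vcliff EV Se Ee Re Sh Eh Rh fE k Ux).
  (* In this form [stem_euler] collapses the first two terms to [T^k] applied to [genD E e], whose
     radial constant is the one of [cA]. *)
  have -> : q%:R = 1 + k.*2%:R :> R by rewrite {1}qk -natr1 addrC.
  rewrite (stem_euler Uopen Usc E He Ee k Ux).
  rewrite (genD_even_sum qk Uopen Usc Ux He Ee Le ef0 C).
  rewrite (genD_stem_sum qk Uopen Usc Ux E0 Ecliff He Ee pde ef0 C2) L.
  by rewrite !scalerDr -!scalemxAl !scalerA ge gq.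
- case=> C C1; rewrite /GCK uxqE.
  have [C2 L] := termA_cG1 q0 C1.
  have DD : DP A v (DbarP A v (iter k (@lapP R d p) f0)) = diffP E (diffP (Eb E) (iter k (@lapP R d p) f0)).
    apply/funext => y; rewrite DP_mx //; congr (diffP E _ y).
    by apply/funext => y'; exact: DbarP_mx.
  have DE : DbarP A v (iter k (@lapP R d p) f0) = diffP (Eb E) (iter k (@lapP R d p) f0).
    by apply/funext => y; exact: DbarP_mx.
  rewrite DD in C2 L *; rewrite DE in C *.
  rewrite (DbarX_mx v HA) (Dbar_PE Uopen Usc E Se Ee Re Sh Eh Rh fE k Ux).
  rewrite (genDb_even_sum qk Uopen Usc Ux He Ee Le ef0 C).
  rewrite (next_even_sum qk Uopen Usc Ux E0 Ecliff He Ee Le ef0 C2) L.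
  (* The sign of [next_even_sum] cancels the minus sign of [Dbar_PE]. *)
  rewrite scaleNr mulNmx opprK !scalerDr -!scalemxAl !scalerA ge.
  by rewrite mulrA ge.
Qed.
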